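(* Let $n\geqslant 1$ be an integer and $p>1$. Let $b\in C^1([0,\infty))\cap L^\infty((0,\infty))$ and $m\in C([0,\infty))$ be real-valued, put $B(t):=\int_0^t b(\tau)\,\mathrm{d}\tau$ and $V(t):=m(t)-\frac12 b'(t)-\frac14[b(t)]^2$, and assume $V\in L^1((0,\infty))$. Suppose that $(u_0,u_1)\in H^1(\mathbb{R}^n)\times L^2(\mathbb{R}^n)$ are nonnegative and compactly supported, not both identically zero, with $\operatorname{supp}u_0\cup\operatorname{supp}u_1\subset B_R$ for some $R>0$. For $\varepsilon>0$, let $u$ be a local in-time energy solution, with lifespan $T_\varepsilon$, to $$\begin{cases}u_{tt}-\Delta u+b(t)u_t+m(t)u=|u_t|^p, & x\in\mathbb{R}^n,\ t>0,\\ u(0,x)=\varepsilon u_0(x),\ u_t(0,x)=\varepsilon u_1(x), & x\in\mathbb{R}^n.\end{cases}$$ Assume, in addition, that there exist constants $\mu\geqslant 0$ and $C_B\geqslant 0$ such that $$B(t)\leqslant \mu\log(1+t)+C_B\quad\text{for every } t\geqslant 0.$$ (i) If $n+\mu>1$ and $1<p\leqslant p_{\mathrm{Gla}}(n+\mu)$, then $T_\varepsilon<\infty$ for every $\varepsilon>0$. Moreover, for every sufficiently small $\varepsilon>0$, $$T_\varepsilon\leqslant\begin{cases}C\varepsilon^{-\frac{2(p-1)}{2-(n+\mu-1)(p-1)}} & \text{if } 1<p<p_{\mathrm{Gla}}(n+\mu),\\ \exp\big(C\varepsilon^{-(p-1)}\big) & \text{if } p=p_{\mathrm{Gla}}(n+\mu).\end{cases}$$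 (ii) If $n=1$ and $\mu=0$, then $T_\varepsilon<\infty$ for every $p>1$ and every $\varepsilon>0$. Moreover, for every sufficiently small $\varepsilon>0$, $$T_\varepsilon\leqslant C\varepsilon^{-(p-1)}.$$ Here the constant $C>0$ is independent of $\varepsilon$.
   Context: $B_r$ denotes the open ball in $\mathbb{R}^n$ centered at the origin with radius $r$. The Glassey exponent is $p_{\mathrm{Gla}}(d):=1+\frac{2}{d-1}$ for real $d>1$. Energy solution. Let $T>0$. A function $u\in C([0,T),H^1(\mathbb{R}^n))\cap C^1([0,T),L^2(\mathbb{R}^n))$ with $u_t\in L^p_{\mathrm{loc}}([0,T)\times\mathbb{R}^n)$ is called a local in-time energy solution on $[0,T)$ if $\operatorname{supp}u(t,\cdot)\subset B_{R+t}$ for every $t\in[0,T)$, the initial conditions $u(0,\cdot)=\varepsilon u_0$, $u_t(0,\cdot)=\varepsilon u_1$ hold in $H^1\times L^2$, and for every $t\in[0,T)$ and every $\Phi\in C_0^\infty([0,T)\times\mathbb{R}^n)$, $$\int_{\mathbb{R}^n}u_t(t,x)\Phi(t,x)\,\mathrm{d}x-\varepsilon\int_{\mathbb{R}^n}u_1(x)\Phi(0,x)\,\mathrm{d}x-\int_0^t\!\int_{\mathbb{R}^n}u_t\Phi_s\,\mathrm{d}x\,\mathrm{d}s+\int_0^t\!\int_{\mathbb{R}^n}\nabla u\cdot\nabla\Phi\,\mathrm{d}x\,\mathrm{d}s+\int_0^t\!\int_{\mathbb{R}^n}\big(b(s)u_t+m(s)u\big)\Phi\,\mathrm{d}x\,\mathrm{d}s=\int_0^t\!\int_{\mathbb{R}^n}|u_t|^p\Phi\,\mathrm{d}x\,\mathrm{d}s.$$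 The lifespan $T_\varepsilon\in(0,\infty]$ of $u$ is its maximal continuation time within this class of energy solutions; $u$ is regarded as defined on $[0,T_\varepsilon)$. *)

(* Defs.v *)
From HB Require Import structures.
From mathcomp Require Import all_boot all_order all_algebra.
From mathcomp Require Import all_classical all_reals all_analysis.

Set Implicit Arguments.
Unset Strict Implicit.
Unset Printing Implicit Defensive.
Import Order.TTheory GRing.Theory Num.Theory.
Import numFieldNormedType.Exports.

Local Open Scope classical_set_scope.
Local Open Scope ring_scope.

(* 'rV[R]_n carries the product sigma-algebra generated by the coordinates,
   as the library does for n.-tuple T. *)
Section measurable_rV.
Context {R : realType} {n : nat}.

Let coord (i : 'I_n) (x : 'rV[R]_n) : R := x ord0 i.

Let rV_set0 : g_sigma_preimage coord set0.
Proof. exact: sigma_algebra0. Qed.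

Let rV_setC A : g_sigma_preimage coord A -> g_sigma_preimage coord (~` A).
Proof. exact: sigma_algebraC. Qed.

Let rV_bigcup (F : (set 'rV[R]_n)^nat) :
  (forall i, g_sigma_preimage coord (F i)) ->
  g_sigma_preimage coord (\bigcup_i (F i)).
Proof. exact: sigma_algebra_bigcup. Qed.

HB.instance Definition _ := @isMeasurable.Build default_measure_display
  'rV[R]_n (g_sigma_preimage coord) rV_set0 rV_setC rV_bigcup.

Lemma measurable_coord_rV (i : 'I_n) :
  measurable_fun [set: 'rV[R]_n] (fun x : 'rV[R]_n => x ord0 i).
Proof.
move=> _ Y mY; rewrite setTI; apply: sub_sigma_algebra => /=.
rewrite -bigcup_seq/=; exists i => /=; first by rewrite mem_index_enum.
by exists Y => //; rewrite setTI.
Qed.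

Lemma measurable_fun_rVP d (T : measurableType d) (f : T -> 'rV[R]_n) :
  (forall i, measurable_fun [set: T] (fun x => f x ord0 i)) ->
  measurable_fun [set: T] f.
Proof.
move=> mf.
suff H : g_sigma_preimage (fun i => coord i \o f) `<=` measurable.
  move=> _ A mA; apply: H.
  by rewrite g_sigma_preimage_comp; exists A.
apply: smallest_sub; first exact: sigma_algebra_measurable.
rewrite -bigcup_seq/=; apply: bigcup_sub => i _ A [B mB <-].
exact: (mf i).
Qed.

End measurable_rV.

Section lebesgue_rV.
Context {R : realType}.

Definition rV_cons n (z : R * 'rV[R]_n) : 'rV[R]_n.+1 :=
  \row_i (if unlift ord0 i is Some j then z.2 ord0 j else z.1).

Let rV_uncons n (x : 'rV[R]_n.+1) : R * 'rV[R]_n :=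
  (x ord0 ord0, \row_j x ord0 (lift ord0 j)).

Let rV_consK n : cancel (@rV_cons n) (@rV_uncons n).
Proof.
move=> [a x]; rewrite /rV_uncons /rV_cons mxE unlift_none /=; congr pair.
by apply/rowP => j; rewrite !mxE liftK.
Qed.

Lemma measurable_rV_cons n : measurable_fun setT (@rV_cons n).
Proof.
apply: measurable_fun_rVP => i; rewrite /rV_cons.
case: (unliftP ord0 i) => [j ->|->].
  apply: (@eq_measurable_fun _ _ _ _ _
      ((fun x : 'rV[R]_n => x ord0 j) \o snd)).
    by move=> z _; rewrite mxE liftK.
  apply: measurableT_comp => //; exact: measurable_coord_rV.
apply: (@eq_measurable_fun _ _ _ _ _ fst) => //.
by move=> z _; rewrite mxE unlift_none.
Qed.

Let measurable_rV_uncons n : measurable_fun setT (@rV_uncons n).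
Proof.
apply: measurable_fun_pair; first exact: measurable_coord_rV.
apply: measurable_fun_rVP => j.
apply: (@eq_measurable_fun _ _ _ _ _
    (fun x : 'rV[R]_n.+1 => x ord0 (lift ord0 j))).
  by move=> z _; rewrite /= mxE.
exact: measurable_coord_rV.
Qed.

Section cons_measure.
Context n (mu : {sigma_finite_measure set 'rV[R]_n -> \bar R}).
Local Open Scope ereal_scope.

Definition cons_measure : set 'rV[R]_n.+1 -> \bar R :=
  pushforward (@lebesgue_measure R \x mu) (@rV_cons n).

Let cons_measure0 : cons_measure set0 = 0.
Proof. by rewrite /cons_measure /pushforward preimage_set0 measure0. Qed.

Let cons_measure_ge0 A : 0 <= cons_measure A.
Proof. by apply: integral_ge0 => x _; exact: measure_ge0. Qed.

Let cons_measure_sigma_additive : semi_sigma_additive cons_measure.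
Proof.
move=> F mF tF mUF; rewrite /cons_measure /pushforward preimage_bigcup.
apply: measure_semi_sigma_additive.
- by move=> k; rewrite -[X in measurable X]setTI; exact: measurable_rV_cons.
- apply/trivIsetP => /= i j _ _ ij; rewrite -preimage_setI.
  by move/trivIsetP : tF => /(_ _ _ _ _ ij) ->//; rewrite preimage_set0.
- rewrite -preimage_bigcup -[X in measurable X]setTI.
  exact: measurable_rV_cons.
Qed.

HB.instance Definition _ := isMeasure.Build _ _ _ cons_measure
  cons_measure0 cons_measure_ge0 cons_measure_sigma_additive.

Let cons_measure_sigma_finite : sigma_finite setT cons_measure.
Proof.
have /sigma_finiteP[F [TF ndF Foo]] := sigma_finiteT (@lebesgue_measure R).
have /sigma_finiteP[G [TG ndG Goo]] := sigma_finiteT mu.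
exists (fun k => @rV_uncons n @^-1` (F k `*` G k)).
  apply/esym; rewrite -subTset => x _.
  have : [set: measurableTypeR R] (rV_uncons x).1 by [].
  rewrite TF => -[i _ Fi].
  have : [set: 'rV[R]_n] (rV_uncons x).2 by [].
  rewrite TG => -[j _ Gj].
  exists (maxn i j) => //; split.
    by move: Fi; exact/subsetPset/ndF/leq_maxl.
  by move: Gj; exact/subsetPset/ndG/leq_maxr.
move=> k; have [mF Fk] := Foo k; have [mG Gk] := Goo k; split.
  rewrite -[X in measurable X]setTI; apply: measurable_rV_uncons => //.
  exact: measurableX.
rewrite /cons_measure /pushforward -comp_preimage.
rewrite (_ : _ \o _ = id); last by apply/funext => z; exact: rV_consK.
by rewrite preimage_id product_measure1E// lte_mul_pinfty// ge0_fin_numE.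
Qed.

HB.instance Definition _ := Measure_isSigmaFinite.Build _ _ _ cons_measure
  cons_measure_sigma_finite.

End cons_measure.

(* n-dimensional Lebesgue measure, as the n-fold product of the measure on R;
   see lebesgue_rV_box. *)
Fixpoint lebesgue_rV n : {sigma_finite_measure set 'rV[R]_n -> \bar R} :=
  match n with
  | 0 => dirac (0 : 'rV[R]_0)
  | k.+1 => cons_measure (lebesgue_rV k)
  end.

Let measurable_box n (a b : 'I_n -> R) :
  measurable [set x : 'rV[R]_n | forall i, a i <= x ord0 i <= b i].
Proof.
rewrite (_ : [set _ | _] = \bigcap_(i in [set: 'I_n])
    ((fun x : 'rV[R]_n => x ord0 i) @^-1` `[a i, b i])).
  apply: fin_bigcap_measurable; first exact: finite_finset.
  by move=> i _; rewrite -[X in measurable X]setTI; exact: measurable_coord_rV.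
apply/seteqP; split=> x /=.
  by move=> xab i _ /=; rewrite in_itv /=.
by move=> xab i; have := xab i I; rewrite /= in_itv.
Qed.

Lemma lebesgue_rV_box n (a b : 'I_n -> R) : (forall i, a i <= b i) ->
  lebesgue_rV n [set x | forall i, a i <= x ord0 i <= b i] =
  (\prod_i (b i - a i))%:E.
Proof.
elim: n a b => [|n IH] a b ab.
  by rewrite big_ord0 /= diracE mem_set// => -[].
rewrite big_ord_recl EFinM -IH//.
transitivity ((@lebesgue_measure R \x lebesgue_rV n)%E
    (`[a ord0, b ord0] `*` [set x : 'rV[R]_n | forall i : 'I_n,
      a (lift ord0 i) <= x ord0 i <= b (lift ord0 i)])).
  rewrite /= /cons_measure /pushforward; congr (_ _).
  apply/seteqP; split=> -[r x] /=.
    move=> H; split.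
      by have := H ord0; rewrite mxE unlift_none /= in_itv.
    by move=> i; have := H (lift ord0 i); rewrite mxE liftK.
  rewrite in_itv /= => -[r0 H] i; rewrite mxE.
  by case: unliftP => [j ->|->].
rewrite product_measure1E//; last exact: measurable_box.
congr (_ * _)%E.
rewrite [LHS](lebesgue_measure_itv `[a ord0, b ord0])/= lte_fin.
have := ab ord0; rewrite le_eqVlt => /orP[/eqP ->|->].
  by rewrite ltxx subrr.
by rewrite -EFinB.
Qed.

End lebesgue_rV.

Section smooth_functions.
Context {R : realType} {V : normedModType R}.

Definition iter_derive (vs : seq V) (f : V -> R) : V -> R :=
  foldr (fun v g x => 'D_v g x) f vs.

(* C^oo on the whole of V: Frechet differentiability of each iterated
   directional derivative gives the continuity of all of them. *)
Definition smooth (f : V -> R) : Prop :=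
  forall (vs : seq V) (x : V), differentiable (iter_derive vs f) x.

End smooth_functions.

Section sobolev.
Context {R : realType} {n : nat}.
Implicit Types (f g phi : 'rV[R]_n -> R) (i : 'I_n).
Local Notation leb := (@lebesgue_rV R n).

(* The norm of 'rV[R]_n is the sup norm, so the Euclidean ball is spelled out. *)
Definition eball (r : R) : set 'rV[R]_n :=
  [set x | Num.sqrt (\sum_i x ord0 i ^+ 2) < r].

(* Support of an a.e. class: complement of the largest open set on which f
   vanishes a.e. *)
Definition ess_supp f : set 'rV[R]_n :=
  [set x | forall U, nbhs x U -> ~ {ae leb, forall y, U y -> f y = 0}].

Definition test_fun phi : Prop :=
  smooth phi /\ exists2 K : set 'rV[R]_n, compact K & forall x, ~ K x -> phi x = 0.

Definition partial i phi : 'rV[R]_n -> R := fun x => 'D_(delta_mx ord0 i) phi x.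

Definition is_weak_partial i f g : Prop := forall phi, test_fun phi ->
  \int[leb]_x (f x * partial i phi x) = - \int[leb]_x (g x * phi x).

Definition in_H1 f : Prop := f \in Lfun leb 2%:E /\
  forall i, exists2 g, g \in Lfun leb 2%:E & is_weak_partial i f g.

(* Weak partial derivatives are unique up to null sets, so norms and integrals
   do not depend on the chosen representative. *)
Definition weak_partial i f : 'rV[R]_n -> R :=
  xget (cst 0) [set g | g \in Lfun leb 2%:E /\ is_weak_partial i f g].

Definition L2norm f : R := fine 'N[leb]_2%:E[EFin \o f].

Definition H1norm f : R :=
  Num.sqrt (L2norm f ^+ 2 + \sum_i L2norm (weak_partial i f) ^+ 2).

End sobolev.

Section time_interval.
Context {R : realType}.

Definition time_itv (T : \bar R) : set R := [set t | 0 <= t /\ (t%:E < T)%E].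

(* Derivative relative to D, hence one-sided at an end point of D. *)
Definition derive_on (D : set R) (b : R -> R) (t : R) : R :=
  lim ((b s - b t) / (s - t) @[s --> within D t^']).

Definition C1_on (D : set R) (b : R -> R) : Prop :=
  (forall t, D t -> cvg ((b s - b t) / (s - t) @[s --> within D t^'])) /\
  {within D, continuous (derive_on D b)}.

End time_interval.

Section energy_solution.
Context {R : realType} {n : nat}.
Implicit Types (u ut : R -> 'rV[R]_n -> R) (T : \bar R).
Local Notation leb := (@lebesgue_rV R n).

(* A curve with values in H^1 or L^2 is given by a representative u t of its
   value at each time t. *)
Definition C0_H1 T u : Prop := forall t, time_itv T t -> in_H1 (u t) /\
  H1norm (u s \- u t) @[s --> within (time_itv T) (nbhs t)] --> (0 : R).

Definition C0_L2 T u : Prop :=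
  forall t, time_itv T t -> u t \in Lfun leb 2%:E /\
  L2norm (u s \- u t) @[s --> within (time_itv T) (nbhs t)] --> (0 : R).

Definition deriv_L2 T u ut : Prop := forall t, time_itv T t ->
  L2norm (fun x => (u s x - u t x) / (s - t) - ut t x)
    @[s --> within (time_itv T) t^'] --> (0 : R).

Definition Lp_loc T (p : R) (w : R * 'rV[R]_n -> R) : Prop :=
  measurable_fun (time_itv T `*` setT) w /\
  forall K : set (R * 'rV[R]_n), compact K -> K `<=` time_itv T `*` setT ->
    (\int[(@lebesgue_measure R \x leb)%E]_(z in K) (`|w z| `^ p)%:E < +oo)%E.

(* C_0^oo([0, T) x R^n): restrictions of smooth functions on R x R^n, with
   compact support in [0, T) x R^n; they need not vanish at time 0. *)
Definition spacetime_test_fun T (Phi : R * 'rV[R]_n -> R) : Prop :=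
  smooth Phi /\ exists K : set (R * 'rV[R]_n), [/\ compact K,
    K `<=` time_itv T `*` setT &
    forall t x, time_itv T t -> ~ K (t, x) -> Phi (t, x) = 0].

Definition weak_form (b m : R -> R) (p eps : R) (u1 : 'rV[R]_n -> R) u ut
    (Phi : R * 'rV[R]_n -> R) (t : R) : Prop :=
  \int[leb]_x (ut t x * Phi (t, x))
  - eps * \int[leb]_x (u1 x * Phi (0, x))
  - \int[lebesgue_measure]_(s in `[0, t])
      \int[leb]_x (ut s x * 'D_1 (fun r => Phi (r, x)) s)
  + \int[lebesgue_measure]_(s in `[0, t])
      \int[leb]_x (\sum_i weak_partial i (u s) x
                           * partial i (fun y => Phi (s, y)) x)
  + \int[lebesgue_measure]_(s in `[0, t])
      \int[leb]_x ((b s * ut s x + m s * u s x) * Phi (s, x))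
  = \int[lebesgue_measure]_(s in `[0, t])
      \int[leb]_x (`|ut s x| `^ p * Phi (s, x)).

(* The curve ut is determined by u up to null sets at every time; asking for a
   jointly measurable representative is no restriction, because a continuous
   curve in L^2 always has one. *)
Definition energy_solution (b m : R -> R) (p rho eps : R)
    (u0 u1 : 'rV[R]_n -> R) T u : Prop :=
  (0 < T)%E /\ exists ut,
  [/\ C0_H1 T u, deriv_L2 T u ut /\ C0_L2 T ut,
      Lp_loc T p (fun z => ut z.1 z.2),
      forall t, time_itv T t -> ess_supp (u t) `<=` eball (rho + t) &
      [/\ u 0 = (fun x => eps * u0 x) %[ae leb],
          ut 0 = (fun x => eps * u1 x) %[ae leb] &
          forall t Phi, time_itv T t -> spacetime_test_fun T Phi ->
            weak_form b m p eps u1 u ut Phi t]].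

(* u, defined on [0, T), is an energy solution that no energy solution on a
   longer interval extends. *)
Definition is_lifespan (b m : R -> R) (p rho eps : R)
    (u0 u1 : 'rV[R]_n -> R) T u : Prop :=
  energy_solution b m p rho eps u0 u1 T u /\
  forall T' v, (T < T')%E -> energy_solution b m p rho eps u0 u1 T' v ->
    ~ (forall t, time_itv T t -> v t = u t %[ae leb]).

End energy_solution.

Definition damping_primitive {R : realType} (b : R -> R) (t : R) : R :=
  \int[lebesgue_measure]_(tau in `[0, t]) b tau.

Definition effective_potential {R : realType} (b m : R -> R) (t : R) : R :=
  m t - derive_on `[0, +oo[ b t / 2 - b t ^+ 2 / 4.

Definition glassey {R : realType} (d : R) : R := 1 + 2 / (d - 1).

(* Main.v *)
(* Test the equation against [expR (eta * x_1)], for one large [eta]; finite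
   propagation speed makes the cut-off of this weight irrelevant.  The weighted
   mean [F] of the solution satisfies
   [F'' + b F' + (m - eta^2) F = G] with [G >= 0] the weighted mean of [|u_t|^p].
   The substitution [F = exp (- B / 2) f] turns this into
   [f'' = (eta^2 - V) f + ...], and because [V] is integrable a decaying
   subsolution of the homogeneous equation gives a multiplier
   [lam ~ exp (B / 2 - eta t)] whose Wronskian [H] with [F] is nondecreasing,
   satisfies [H' >= lam G], is at least [eps] times a constant, and is at most
   [4 lam F'] for [t >= 1].  The integral of the weight over the ball of radius
   [rho + t + 1] of R^n is of order [expR (eta t) (1 + t)^((n-1)/2)], so Hoelder's
   inequality bounds [G] from below by a power of [F'], and hence
   [H' >= c (1 + t)^(- (n - 1 + mu) (p - 1) / 2) H^p]. *)
Require Import Defs.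
From HB Require Import structures.
From mathcomp Require Import finmap.
From mathcomp Require Import all_boot all_order all_algebra.
From mathcomp Require Import all_classical all_reals all_analysis.
From mathcomp Require Import measurable_realfun ess_sup_inf.
From mathcomp Require Import ring lra.

Set Implicit Arguments.
Unset Strict Implicit.
Unset Printing Implicit Defensive.
Import Order.TTheory GRing.Theory Num.Theory.
Import numFieldNormedType.Exports.

Local Open Scope classical_set_scope.
Local Open Scope ring_scope.

(** * Primitives on an interval *)

(** The source [|u_t|^p] is only integrable in time, so the mean velocity [f = F'] need not be
    differentiable. It is split into a differentiable part [E], built from a continuous lower bound
    of the source, and a nondecreasing remainder [f - E]; the growth of the Wronskian is then
    expressed through primitives, never through its derivative. The nonlinearity sees [u_t], so a
    lower bound on the Wronskian has to be turned into one on [F'] alone. Taking [eta] ten times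
    larger than the bounds on [b] and on the L1 norm of [V] makes every correction to the pure
    exponentials a small fraction of [eta]; for [t >= 1] the share of the Wronskian carried by [F]
    is then below three quarters. Growth of the Wronskian needs [F >= 0], and [F >= 0] needs a
    positive Wronskian; a first-time argument breaks this circle. In the final inequality the
    exponentials of multiplier and weighted volume cancel, leaving [(1 + t)^(- a)] with
    [a = (n - 1 + mu) (p - 1) / 2]. The Glassey condition is [a <= 1], that is, divergence of the
    integral of this power; part (ii) is the case [a = 0]. *)

Section primitives.
Context {R : realType}.
Implicit Types (a b c d x : R) (f g F G : R -> R).
Local Notation mu := (@lebesgue_measure R).

(** Differentiability is asked only in the open interval, which is all the mean value theorem needs,
    so one-sided derivatives at the end points never enter. Differential inequalities are derived
    from this notion through [primitive_on_le], which puts no integrability condition on [f]. *)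
Definition primitive_on a b F f : Prop := {within `[a, b], continuous F} /\
  forall x, x \in `]a, b[ -> is_derive x 1 F (f x).

Lemma primitive_onS a b c d F f : a <= c -> d <= b ->
  primitive_on a b F f -> primitive_on c d F f.
Proof.
move=> ac db [cF dF]; split.
  by apply: continuous_subspaceW cF; exact: subset_itv.
by move=> x xcd; apply: dF; apply: subset_itv xcd; rewrite bnd_simp.
Qed.

Lemma eq_primitive_on a b F f g : {in `]a, b[, f =1 g} ->
  primitive_on a b F f -> primitive_on a b F g.
Proof. by move=> fg [cF dF]; split=> // x xab; rewrite -fg//; exact: dF. Qed.

Lemma primitive_onD a b F f G g : primitive_on a b F f -> primitive_on a b G g ->
  primitive_on a b (fun x => F x + G x) (fun x => f x + g x).
Proof.
move=> [cF dF] [cG dG]; split.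
  by move=> x; apply: cvgD; [exact: cF|exact: cG].
by move=> x xab; apply: is_deriveD; [exact: dF|exact: dG].
Qed.

Lemma primitive_onN a b F f : primitive_on a b F f ->
  primitive_on a b (fun x => - F x) (fun x => - f x).
Proof.
move=> [cF dF]; split; first by move=> x; apply: cvgN; exact: cF.
by move=> x xab; apply: is_deriveN; exact: dF.
Qed.

Lemma primitive_onB a b F f G g : primitive_on a b F f -> primitive_on a b G g ->
  primitive_on a b (fun x => F x - G x) (fun x => f x - g x).
Proof. by move=> dF dG; apply: primitive_onD => //; exact: primitive_onN. Qed.

Lemma primitive_onM a b F f G g : primitive_on a b F f -> primitive_on a b G g ->
  primitive_on a b (fun x => F x * G x) (fun x => F x * g x + G x * f x).
Proof.
move=> [cF dF] [cG dG]; split.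
  by move=> x; apply: cvgM; [exact: cF|exact: cG].
by move=> x xab; apply: is_deriveM; [exact: dF|exact: dG].
Qed.

Lemma primitive_on_cst a b c : primitive_on a b (fun=> c) (fun=> 0).
Proof.
split; first by move=> x; exact: cvg_cst.
by move=> x _; exact: is_derive_cst.
Qed.

Lemma primitive_onZ a b c F f : primitive_on a b F f ->
  primitive_on a b (fun x => c * F x) (fun x => c * f x).
Proof.
move=> dF; apply: eq_primitive_on (primitive_onM (primitive_on_cst a b c) dF).
by move=> x _ /=; rewrite mulr0 addr0.
Qed.

Lemma primitive_on_id a b : primitive_on a b id (fun=> 1).
Proof.
split; first by apply: continuous_subspaceT => x; exact: cvg_id.
by move=> x _; exact: is_derive_id.
Qed.

Lemma primitive_on_comp a b F f (h dh : R -> R) :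
  (forall x, x \in `[a, b] -> is_derive (F x) 1 h (dh (F x))) ->
  primitive_on a b F f ->
  primitive_on a b (fun x => h (F x)) (fun x => f x * dh (F x)).
Proof.
move=> ddh [cF dF]; split.
  apply/subspace_continuousP => x xab.
  have hF : {for F x, continuous h}.
    by apply/differentiable_continuous/derivable1_diffP; case: (ddh _ xab).
  apply: (@cvg_comp _ _ _ F h _ (nbhs (F x))) => //.
  by move/subspace_continuousP : cF; exact.
move=> x xab; rewrite mulrC.
have xab' : x \in `[a, b] by apply: subset_itv_oo_cc xab.
have := dF x xab; have := ddh x xab' => Dh DF.
exact: (@is_derive1_comp _ h F x (dh (F x)) (f x)).
Qed.

Lemma primitive_on_expR a b F f : primitive_on a b F f ->
  primitive_on a b (fun x => expR (F x)) (fun x => f x * expR (F x)).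
Proof. by apply: primitive_on_comp => x _; exact: is_derive_expR. Qed.

Lemma primitive_on_le a b F f : a <= b -> primitive_on a b F f ->
  {in `]a, b[, forall x, 0 <= f x} -> F a <= F b.
Proof.
rewrite le_eqVlt => /predU1P[->//|ab] [cF dF] f0.
have [c cab] := MVT ab dF cF.
by rewrite -subr_ge0 => ->; rewrite mulr_ge0 ?f0// subr_ge0 ltW.
Qed.

Lemma within_continuous_integrable a b f : {within `[a, b], continuous f} ->
  mu.-integrable `[a, b] (EFin \o f).
Proof. by apply: continuous_compact_integrable; exact: segment_compact. Qed.

Lemma primitive_on_int a b f : {within `[a, b], continuous f} ->
  primitive_on a b (fun x => \int[mu]_(t in `[a, x]) f t) f.
Proof.
move=> cf; have [ab|ba] := leP a b; last first.
  split; last by move=> x; rewrite itv_ge // bnd_simp le_gtF // ltW.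
  by rewrite set_itv_ge ?bnd_simp -?ltNge//; exact: continuous_subspace0.
have fi := within_continuous_integrable cf.
split; first exact: parameterized_integral_continuous.
move=> x xab; have xab' : a < x < b by rewrite in_itv in xab.
have cfx : {for x, continuous f}.
  move: cf xab.
  rewrite continuous_within_itvP ?(lt_trans (andP xab').1 (andP xab').2)//.
  by move=> -[+ _ _]; exact.
have [|df df1] := continuous_FTC1_closed (andP xab').2 fi _ cfx.
  by case/andP : xab'.
by split; [exact: df|rewrite -derive1E].
Qed.

Lemma Rintegral_primitive_on a b F f : a <= b ->
  {within `[a, b], continuous f} -> primitive_on a b F f ->
  \int[mu]_(t in `[a, b]) f t = F b - F a.
Proof.
move=> ab cf dF; have dG := primitive_on_int cf.
have [h1 h2] : (fun x => \int[mu]_(t in `[a, x]) f t - F x) a <=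
    \int[mu]_(t in `[a, b]) f t - F b /\
  (fun x => F x - \int[mu]_(t in `[a, x]) f t) a <=
    F b - \int[mu]_(t in `[a, b]) f t.
  by split; [apply: (primitive_on_le ab (primitive_onB dG dF))|
    apply: (primitive_on_le ab (primitive_onB dF dG))] => x _; rewrite subrr.
move: h1 h2; rewrite /= set_itv1 Rintegral_set1; lra.
Qed.

End primitives.

(** * Lower bound on a Wronskian and blow-up *)

Section wronskian.
Context {R : realType}.
Local Notation mu := (@lebesgue_measure R).
Variables (T eta v beta : R) (b db m V B F f E h : R -> R).
Hypothesis v0 : 0 <= v.
Hypothesis beta0 : 0 <= beta.
Hypothesis etaE : 10 * (v + beta + 1) <= eta.
Hypothesis B0 : B 0 = 0.
Hypothesis dB : primitive_on 0 T B b.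
Hypothesis b_db : primitive_on 0 T b db.
Hypothesis b_beta : forall t, 0 <= t <= T -> `|b t| <= beta.
Hypothesis VE : forall t, 0 < t < T -> V t = m t - db t / 2 - b t ^+ 2 / 4.
Hypothesis cV : {within `[0, T], continuous V}.
Hypothesis V1 : \int[mu]_(t in `[0, T]) `|V t| <= v.
Hypothesis dF : primitive_on 0 T F f.
Hypothesis cf : {within `[0, T], continuous f}.
Hypothesis dE : primitive_on 0 T E
  (fun t => (eta ^+ 2 - m t) * F t - b t * f t + h t).
Hypothesis h0 : forall t, 0 <= t <= T -> 0 <= h t.
Hypothesis fE_nd : forall s t, 0 <= s -> s <= t -> t <= T ->
  f s - E s <= f t - E t.
Hypothesis F0 : 0 <= F 0.
Hypothesis f0 : 0 <= f 0.
Hypothesis Ff0 : 0 < F 0 + f 0.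

(** The [- v] absorbs the square of [g]: if [g' = k g - |V|], then [(g - eta)^2 + g' = eta^2 - |V| -
    g (v - g)], which is at most [eta^2 - V] as soon as [0 <= g <= v]. *)
Let k := 2 * eta - v.
Let eta10 : 10 <= eta. Proof. by move: etaE v0 beta0; lra. Qed.
Let eta0 : 0 < eta. Proof. exact: lt_le_trans eta10. Qed.
Let k0 : 0 < k. Proof. by rewrite /k; move: etaE v0 beta0; lra. Qed.

Let cabsV : {within `[0, T], continuous (fun t => `|V t|)}.
Proof. by move=> t; apply: cvg_norm; exact: cV. Qed.

Let cexpV : {within `[0, T], continuous (fun t => expR (- k * t) * `|V t|)}.
Proof.
move=> t; apply: cvgM; last exact: cabsV.
have [+ _] := primitive_on_expR (primitive_onZ (- k) (primitive_on_id 0 T)).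
exact.
Qed.

Let W t := \int[mu]_(s in `[0, t]) `|V s|.
Let A t := \int[mu]_(s in `[0, t]) (expR (- k * s) * `|V s|).
Let dW : primitive_on 0 T W (fun t => `|V t|).
Proof. exact: primitive_on_int cabsV. Qed.
Let dA : primitive_on 0 T A (fun t => expR (- k * t) * `|V t|).
Proof. exact: primitive_on_int cexpV. Qed.

(* [g] is the bounded solution of [g' = k g - |V|], so that
   [r t := expR (G t - eta * t)], with [G' = g], satisfies
   [r'' <= (eta^2 - V) r]. *)
Let g t := expR (k * t) * (A T - A t).

Let dg : primitive_on 0 T g (fun t => k * g t - `|V t|).
Proof.
apply: eq_primitive_on (primitive_onM
  (primitive_on_expR (primitive_onZ k (primitive_on_id 0 T)))
  (primitive_onB (primitive_on_cst 0 T (A T)) dA)) => t _ /=.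
rewrite /g mulr1 mulNr expRN; have := expR_gt0 (k * t) => e0.
field; exact: lt0r_neq0.
Qed.

(** For [s >= t] the factor [expR (- k * s)] is at most [expR (- k * t)], which cancels
    [expR (k * t)] and leaves a tail of the integral of [|V|]. This is why [g] is normalised by
    [g T = 0]: a solution prescribed at time 0 would in general grow like [expR (k * t)]. *)
Let g_bnd (t : R) : 0 <= t <= T -> 0 <= g t <= v.
Proof.
move=> /andP[t0 tT].
have dAt := primitive_onS t0 (lexx T) dA.
have dWt := primitive_onS t0 (lexx T) dW.
apply/andP; split.
  rewrite /g mulr_ge0 ?expR_ge0// subr_ge0.
  by apply: (primitive_on_le tT dAt) => s _; rewrite mulr_ge0// expR_ge0.
have : (fun s => expR (- k * t) * W s - A s) t <= expR (- k * t) * W T - A T.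
  apply: (primitive_on_le tT (primitive_onB (primitive_onZ _ dWt) dAt)) => s.
  rewrite in_itv/= => /andP[ts _]; rewrite -mulrBl mulr_ge0// subr_ge0.
  by rewrite ler_expR !mulNr lerN2 ler_wpM2l// ltW.
move=> /= AW; have {}AW : A T - A t <= expR (- k * t) * (W T - W t) by lra.
have Wt : 0 <= W t by apply: Rintegral_ge0 => s _.
rewrite /g (le_trans (ler_wpM2l (expR_ge0 (k * t)) AW))// mulrA mulNr -expRD.
by rewrite subrr expR0 mul1r; move: V1; rewrite -/(W T); lra.
Qed.

Let G t := \int[mu]_(s in `[0, t]) g s.
Let dG : primitive_on 0 T G g. Proof. by apply: primitive_on_int; case: dg. Qed.

Let G0 : G 0 = 0. Proof. by rewrite /G set_itv1 Rintegral_set1. Qed.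

(** Integrating [g' = k g - |V|] bounds [k * G t] by [g t - g 0 + W t], hence by [2 * v], and [k] is
    much larger than [4 * v]. The perturbation by [V] thus changes the multiplier only by a bounded
    factor. *)
Let G_bnd (t : R) : 0 <= t <= T -> 0 <= G t <= 1/2.
Proof.
move=> /andP[t0 tT].
have dGt := primitive_onS (lexx 0) tT dG.
have T0 := le_trans t0 tT.
have W0 : W 0 = 0 by rewrite /W set_itv1 Rintegral_set1.
have := primitive_onB (primitive_onD dg dW) (primitive_onZ k dG).
move=> /(primitive_onS (lexx 0) tT).
move=> /(primitive_on_le t0) /(_ _)/wrap[s _|].
  by rewrite subrK subrr.
rewrite W0 G0 => kG.
have G0t : G 0 <= G t.
  apply: (primitive_on_le t0 dGt) => s; rewrite in_itv/= => /andP[s0 st].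
  have /andP[] // : 0 <= g s <= v.
  by apply: g_bnd; rewrite (ltW s0) (le_trans (ltW st)).
have Wv : W t <= v.
  apply: le_trans V1; apply: (primitive_on_le tT (primitive_onS t0 (lexx T) dW)).
  by move=> s _.
have /andP[g1 g2] : 0 <= g t <= v by apply: g_bnd; rewrite t0.
have /andP[g3 g4] : 0 <= g 0 <= v by apply: g_bnd; rewrite lexx.
rewrite -G0 G0t/=; have : k * G t <= 2 * v by lra.
rewrite -ler_pdivlMl// => /le_trans; apply; rewrite ler_pdivrMl// /k.
by move: etaE v0 beta0; lra.
Qed.

Let lam t := expR (B t / 2 - eta * t + G t).
(** This is the Wronskian [r phi' - r' phi] of [phi = expR (B / 2) F] and
    [r = expR (G t - eta * t)], written in terms of [F] and its derivative [f]; accordingly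
    [lam = expR (B / 2) r]. *)
Let H t := lam t * (f t + (b t / 2 + (eta - g t)) * F t).

Let lam0 : lam 0 = 1.
Proof. by rewrite /lam B0 G0 mul0r mulr0 subr0 addr0 expR0. Qed.

Let dlam : primitive_on 0 T lam (fun t => (b t / 2 - eta + g t) * lam t).
Proof.
have := primitive_onD (primitive_onB (primitive_onZ (1/2) dB)
  (primitive_onZ eta (primitive_on_id 0 T))) dG.
have lamE : lam = (fun x => expR (1 / 2 * B x - eta * id x + G x)).
  by apply/funext => x; rewrite /lam; congr expR => /=; field.
by rewrite lamE => /primitive_on_expR; apply: eq_primitive_on => t _ /=; field.
Qed.

Let cH : {within `[0, T], continuous H}.
Proof.
have [clam _] := dlam; have [cF _] := dF; have [cb _] := b_db; have [cg _] := dg.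
move=> t; apply: cvgM; [exact: clam|apply: cvgD; [exact: cf|apply: cvgM; [|exact: cF]]].
apply: cvgD; last by apply: cvgB; [exact: cvg_cst|exact: cg].
by apply: cvgM; [exact: cb|exact: cvg_cst].
Qed.

(** The factor 10 in [etaE] makes [v + beta / 2] at most [eta / 10] and [beta / 2] alone at most
    [eta / 20]. The last bound says that [lam] is nonincreasing. *)
Let coef_bnd (t : R) : 0 <= t <= T ->
  [/\ 9/10 * eta <= b t / 2 + (eta - g t), b t / 2 + (eta - g t) <= 21/20 * eta
   & b t / 2 - eta + g t <= 0].
Proof.
move=> tT; have := b_beta tT; rewrite ler_norml => /andP[b1 b2].
have /andP[g1 g2] := g_bnd tT.
by split; move: etaE v0 beta0; lra.
Qed.

(* [J] below is the smooth part of [H]; the monotone part [f - E] of the second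
   derivative is frozen at time [s], which only helps since [lam] decreases. *)
Let H_incr (s t : R) P q : 0 <= s -> s <= t -> t <= T ->
  (forall x, s <= x <= t -> 0 <= F x) -> primitive_on s t P q ->
  (forall x, s < x < t -> q x <= lam x * h x) -> P t - P s <= H t - H s.
Proof.
move=> s0 st tT Fst dP qh.
pose J x := lam x * (E x + (1 / 2 * b x + (eta - g x)) * F x).
have dJ := primitive_onM dlam (primitive_onD dE (primitive_onM
  (primitive_onD (primitive_onZ (1/2) b_db)
    (primitive_onB (primitive_on_cst 0 T eta) dg)) dF)).
have := primitive_onB (primitive_onD (primitive_onS s0 tT dJ)
  (primitive_onM (primitive_onS s0 tT dlam)
    (primitive_on_cst s t (f s - E s)))) dP.
move=> /(primitive_on_le st) /(_ _)/wrap[x|].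
  rewrite in_itv/= => /andP[sx xt].
  have x0T : 0 <= x <= T by rewrite (le_trans s0 (ltW sx)) (le_trans (ltW xt)).
  have x0T' : 0 < x < T by rewrite (le_lt_trans s0 sx) (lt_le_trans xt).
  have [c1 c2 c3] := coef_bnd x0T.
  have l0 : 0 < lam x by exact: expR_gt0.
  have Fx : 0 <= F x by rewrite Fst// !ltW.
  have qx := qh x; rewrite sx xt in qx; have {}qx := qx isT.
  have Dx : f s - E s <= f x - E x.
    by apply: fE_nd => //; rewrite ltW// ?(lt_le_trans xt).
  have Vx := VE x0T'.
  have /andP[g1 g2] := g_bnd x0T.
  (* [m1] is [- lam'] times the growth of [f - E] since time [s], the gain from freezing it. [m2] is
     [lam * F] times the amount by which [r''] falls below [(eta^2 - V) r]. The derivative to be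
     shown nonnegative is [m1 + m2 + (lam x * h x - q x)]. *)
  have m1 : 0 <= lam x * (- (b x / 2 - eta + g x)) * ((f x - E x) - (f s - E s)).
    by rewrite mulr_ge0 ?subr_ge0// mulr_ge0 ?oppr_ge0// ltW.
  have m2 : 0 <= lam x * F x * ((`|V x| - V x) + g x * (v - g x)).
    rewrite mulr_ge0 ?(mulr_ge0 (ltW l0) Fx)//.
    by rewrite addr_ge0 ?subr_ge0 ?ler_norm// mulr_ge0// subr_ge0.
  apply: le_trans (addr_ge0 m1 (addr_ge0 m2 _)) _.
    exact: (etrans (subr_ge0 (q x) (lam x * h x)) qx).
  rewrite le_eqVlt; apply/orP; left; apply/eqP.
  by rewrite Vx /k; field.
move=> le1.
have {}le1 : J s + lam s * (f s - E s) - P s <=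
    J t + lam t * (f s - E s) - P t.
  exact: le1.
have lt0 : 0 < lam t by exact: expR_gt0.
have le2 := ler_wpM2l (ltW lt0) (fE_nd s0 st tT).
have Ht : H t = lam t * (f t - E t) + J t by rewrite /H /J; ring.
have Hs : H s = lam s * (f s - E s) + J s by rewrite /H /J; ring.
move: Ht Hs le1 le2.
by move: (J s) (J t) (H s) (H t) (lam s) (lam t) (f s - E s) (f t - E t) => *; lra.
Qed.

(** Reduction of order: [q] is the quotient [phi / r], whose derivative is the Wronskian divided by
    [r^2], and [X] is [r^(-2)]. The sign of [H] is thereby transferred to [F]. *)
Let q t := expR (B t / 2 + eta * t - G t) * F t.
Let X t := expR (2 * eta * t - 2 * G t).

Let dq : primitive_on 0 T q (fun t => H t * X t).
Proof.
have := primitive_onB (primitive_onD (primitive_onZ (1/2) dB)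
  (primitive_onZ eta (primitive_on_id 0 T))) dG.
move=> /primitive_on_expR /primitive_onM /(_ dF).
have -> : q = (fun x => expR (1 / 2 * B x + eta * id x - G x) * F x).
  by apply/funext => x; rewrite /q; congr (expR _ * _) => /=; field.
apply: eq_primitive_on => t _ /=.
have -> : expR (1 / 2 * B t + eta * t - G t) = lam t * X t.
  by rewrite /lam /X -expRD; congr expR => /=; field.
by rewrite /H; field.
Qed.

Let q0 : q 0 = F 0.
Proof. by rewrite /q B0 G0 mul0r mulr0 subr0 addr0 expR0 mul1r. Qed.

Let F_ge0 (t : R) : 0 <= t <= T -> (forall s, 0 <= s < t -> 0 < H s) -> 0 <= F t.
Proof.
move=> /andP[t0 tT] Hs.
have : q 0 <= q t.
  apply: (primitive_on_le t0 (primitive_onS (lexx 0) tT dq)) => s.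
  rewrite in_itv/= => /andP[s0 st].
  by rewrite mulr_ge0 ?expR_ge0// ltW// Hs// ltW.
by rewrite q0 => /(le_trans F0); rewrite pmulr_rge0// expR_gt0.
Qed.

Let H0_ge : 0 <= T -> F 0 + f 0 <= H 0 /\ 9/10 * eta * F 0 <= H 0.
Proof.
move=> T0; have [|c1 _ _] := coef_bnd (t := 0); first by rewrite lexx.
rewrite /H lam0 mul1r; have := ler_wpM2r F0 c1.
have : F 0 <= 9/10 * eta * F 0 by rewrite ler_peMl//; move: eta10; lra.
by move: f0; lra.
Qed.

(** Let [z] be the infimum of the times at which [H <= 0]. Before [z] the Wronskian is positive, so
    [F >= 0] up to and including [z], and [H_incr] with [P = q = 0] gives [H z >= H 0 > 0]. By
    continuity [H] stays positive slightly beyond [z], contradicting the choice of [z]. *)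
Let H_gt0 (t : R) : 0 <= t <= T -> 0 < H t.
Proof.
move=> t0T; have T0 : 0 <= T by case/andP: t0T => /le_trans; exact.
rewrite ltNge; apply/negP => Ht.
pose S := [set x | 0 <= x <= T /\ H x <= 0].
have hS : has_inf S by split; [exists t|exists 0 => x [/andP[]]].
pose z := inf S.
have zS x : S x -> z <= x by apply: ge_inf; case: hS.
have z0 : 0 <= z by apply: lb_le_inf; [exists t|move=> x [/andP[]]].
have zT : z <= T by apply: (le_trans (zS t _)) => //; case/andP: t0T.
have Hlt s : 0 <= s < z -> 0 < H s.
  move=> /andP[s0 sz]; rewrite ltNge; apply/negP => Hs.
  move: (sz); rewrite ltNge => /negP; apply; apply: zS; split=> //.
  by rewrite s0 (le_trans (ltW sz)).
have Hz : 0 < H z.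
  apply: (@lt_le_trans _ _ (H 0)); first by have [/(lt_le_trans Ff0)] := H0_ge T0.
  rewrite -subr_ge0.
  have := @H_incr 0 z (fun=> 0) (fun=> 0) (lexx 0) z0 zT.
  rewrite subrr; apply.
  - move=> x /andP[x0 xz]; apply: F_ge0; first by rewrite x0 (le_trans xz).
    by move=> s /andP[s0 sx]; apply: Hlt; rewrite s0 (lt_le_trans sx).
  - exact: primitive_on_cst.
  - move=> x /andP[x0 xz]; rewrite mulr_ge0 ?expR_ge0// h0//.
    by rewrite (ltW x0) (le_trans (ltW xz)).
have : \forall x \near within `[0, T] (nbhs z), 0 < H x.
  move/subspace_continuousP : cH => /(_ z) /(_ _)/wrap[|]; first by rewrite /= in_itv/= z0.
  by move=> /cvgr_gt /(_ _ Hz).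
move=> /nbhs_ballP[e /= e0 ze].
have [x Sx xze] := inf_adherent e0 hS.
have zx := zS _ Sx; case: Sx => xT.
rewrite leNgt => /negP; apply; apply: ze; last by rewrite /= in_itv.
by rewrite /ball/= distrC ger0_norm ?subr_ge0// ltrBlDl.
Qed.

(** As [H] is nondecreasing, [q' = H X] bounds [q t] by [F 0] plus [H t] times the integral of [X],
    and this integral is comparable to [X t / eta]. Hence [lam * F] is at most a fixed multiple of
    [H / eta]. The constants multiply to [21/20 * 11/9 * 5/9 < 3/4], so at least a quarter of [H] is
    carried by [lam * f]. *)
Let lamf_ge (t : R) : 1 <= t <= T -> H t <= 4 * (lam t * f t).
Proof.
move=> /andP[t1 tT]; have t0 : 0 <= t by exact: le_trans t1.
have t0T : 0 <= t <= T by rewrite t0.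
have nd s : 0 <= s <= t -> H s <= H t.
  move=> /andP[s0 st]; rewrite -subr_ge0.
  have := @H_incr s t (fun=> 0) (fun=> 0) s0 st tT; rewrite subrr; apply.
  - move=> x /andP[sx xt].
    have x0 := le_trans s0 sx.
    apply: F_ge0; first by rewrite x0 (le_trans xt).
    move=> y /andP[y0 yx]; apply: H_gt0.
    by rewrite y0 (le_trans (ltW yx))// (le_trans xt).
  - exact: primitive_on_cst.
  - move=> x /andP[sx xt]; rewrite mulr_ge0 ?expR_ge0// h0//.
    by rewrite (le_trans s0 (ltW sx)) (le_trans (ltW xt)).
have Ht := H_gt0 t0T.
have dX : primitive_on 0 T X (fun x => (2 * eta - 2 * g x) * X x).
  have := primitive_on_expR (primitive_onB
    (primitive_onZ (2 * eta) (primitive_on_id 0 T)) (primitive_onZ 2 dG)).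
  by apply: eq_primitive_on => x _ /=; rewrite mulr1.
have X0 : X 0 = 1 by rewrite /X G0 !mulr0 subr0 expR0.
(* Since [g <= v <= eta / 10], the derivative of [X] is at least [9/5 * eta * X]; [c] is the
   reciprocal of [9/5 * eta]. *)
pose c := 5/9 / eta.
have := primitive_onB (primitive_onZ (H t * c) dX) dq.
move=> /(primitive_onS (lexx 0) tT) /(primitive_on_le t0) /(_ _)/wrap[x|].
  rewrite in_itv/= => /andP[x0 xt].
  have /nd Hx : 0 <= x <= t by rewrite !ltW.
  have /andP[g1 g2] : 0 <= g x <= v by apply: g_bnd; rewrite (ltW x0) (le_trans (ltW xt)).
  rewrite mulrA -mulrBl mulr_ge0 ?expR_ge0// subr_ge0 (le_trans Hx)//.
  rewrite -mulrA ler_peMr ?(ltW Ht)// /c mulrAC ler_pdivlMr; last by move: eta10; lra.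
  by move: etaE v0 beta0; lra.
rewrite X0 q0 mulr1 => qX.
have c0 : 0 < c by rewrite /c divr_gt0.
have [_ HF0] := H0_ge (le_trans t0 tT).
have H0t : H 0 <= H t by apply: nd; rewrite lexx.
(* Here [t >= 1] enters: it gives [eta * t >= 10], which makes the contribution of the initial
   value, of size [c * H t], small against [c * H t * X t]. *)
have X18 : 18 <= X t.
  have /andP[_ G2] := G_bnd t0T.
  apply: le_trans (expR_ge1Dx _).
  have : 10 <= eta * t by rewrite (le_trans eta10)// ler_peMr// ltW.
  by rewrite -mulrA; move: (eta * t) (G t) G2 => x y; lra.
have lamF : lam t * F t * X t = q t.
  by rewrite /lam /q /X mulrAC -expRD; congr (expR _ * _) => /=; field.
have F0H : F 0 <= 2 * c * H t.
  rewrite /c -ler_pdivrMl; last by rewrite mulr_gt0// divr_gt0.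
  have -> : (2 * (5 / 9 / eta))^-1 = 9/10 * eta by field; rewrite gt_eqF.
  exact: le_trans H0t.
have lF0 : 0 <= lam t * F t.
  rewrite mulr_ge0 ?expR_ge0//; apply: F_ge0 => // s /andP[s0 st].
  by apply: H_gt0; rewrite s0 (le_trans (ltW st)).
have lF : lam t * F t <= 11/9 * (c * H t).
  have cH0 : 0 <= c * H t by rewrite mulr_ge0 ?ltW.
  have X0' : 0 < X t by exact: expR_gt0.
  rewrite -(ler_pM2r X0') lamF.
  have : 18 * (c * H t) <= X t * (c * H t) by rewrite ler_wpM2r.
  by move: qX; lra.
have [c1 c2 _] := coef_bnd t0T.
have : (b t / 2 + (eta - g t)) * (lam t * F t) <= 21/20 * eta * (11/9 * (c * H t)).
  by apply: ler_pM => //; move: c1; lra.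
have -> : 21/20 * eta * (11/9 * (c * H t)) = (21/20 * 11/9 * 5/9) * H t.
  by rewrite /c; field; rewrite gt_eqF.
have HE : H t = lam t * f t + (b t / 2 + (eta - g t)) * (lam t * F t).
  by rewrite /H; ring.
by move: HE Ht; lra.
Qed.

(** [H] need not be differentiable, because [f - E] is only monotone. The inequality [H' >= lam h]
    is therefore exported as a comparison with every primitive [P] whose derivative lies below
    [lam h]. *)
Lemma wronskian_lower_bound : 0 <= T -> exists lam H : R -> R,
  [/\ forall t, 0 <= t <= T -> 0 < lam t <= expR (B t / 2 - eta * t + 1),
      {within `[0, T], continuous H},
      F 0 + f 0 <= H 0,
      forall s t P q, 0 <= s -> s <= t -> t <= T -> primitive_on s t P q ->
        (forall x, s < x < t -> q x <= lam x * h x) -> P t - P s <= H t - H s &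
      forall t, 1 <= t <= T -> H t <= 4 * (lam t * f t)].
Proof.
move=> T0; exists lam, H; split.
- move=> t t0T; rewrite expR_gt0/= ler_expR; have /andP[_ G1] := G_bnd t0T; lra.
- exact: cH.
- by have [] := H0_ge T0.
- move=> s t P q' s0 st tT dP q'h; apply: (H_incr s0 st tT _ dP q'h) => x /andP[sx xt].
  apply: F_ge0; first by rewrite (le_trans s0 sx) (le_trans xt).
  move=> y /andP[y0 yx]; apply: H_gt0.
  by rewrite y0 (le_trans (ltW yx))// (le_trans xt).
- exact: lamf_ge.
Qed.

End wronskian.

Section blowup.
Context {R : realType}.
Local Notation mu := (@lebesgue_measure R).

(* A primitive [K <= H] of [c th' H^p] satisfies [K' >= c th' K^p], so that
   [K^(1-p) + (p-1) c th] is nonincreasing. *)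
Lemma integral_ode_blowup (a T c e p : R) (H th dth : R -> R) :
  a <= T -> 0 < e -> 0 < c -> 1 < p ->
  {within `[a, T], continuous H} -> (forall t, a <= t <= T -> e <= H t) ->
  primitive_on a T th dth -> {within `[a, T], continuous dth} ->
  (forall t, a <= t <= T -> 0 <= dth t) ->
  (forall t P, a <= t <= T ->
    primitive_on a t P (fun s => c * dth s * H s `^ p) -> P t - P a <= H t - H a) ->
  (p - 1) * c * (th T - th a) <= e `^ (- (p - 1)).
Proof.
move=> aT e0 c0 p1 cH eH dT cdth dth0 incr.
pose r s := c * dth s * H s `^ p.
have cr : {within `[a, T], continuous r}.
  apply/subspace_continuousP => x xaT.
  apply: cvgM.
    by apply: cvgM; [exact: cvg_cst|move/subspace_continuousP : cdth; exact].
  have Hx0 : 0 < H x by apply: lt_le_trans (eH x _) => //; rewrite /= in_itv in xaT.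
  have [+ _] := is_derive1_powR p Hx0.
  move=> /derivable1_diffP/differentiable_continuous cp.
  apply: (cvg_comp H (fun y : R => y `^ p) _ cp).
  by move/subspace_continuousP : cH; exact.
pose P t := \int[mu]_(s in `[a, t]) r s.
have dP : primitive_on a T P r by exact: primitive_on_int.
pose K t := e + P t.
have Pa : P a = 0 by rewrite /P set_itv1 Rintegral_set1.
have eK t : a <= t <= T -> e <= K t.
  move=> /andP[at_ tT]; rewrite /K lerDl -Pa.
  apply: (primitive_on_le at_ (primitive_onS (lexx a) tT dP)) => s.
  rewrite in_itv/= => /andP[as_ st].
  rewrite /r mulr_ge0 ?powR_ge0// mulr_ge0 ?(ltW c0)// dth0// (ltW as_)/=.
  exact: le_trans (ltW st) tT.
have KH t : a <= t <= T -> K t <= H t.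
  move=> atT; have /andP[at_ tT] := atT.
  have := incr t P atT (primitive_onS (lexx a) tT dP).
  have : e <= H a by apply: eH; rewrite lexx.
  by rewrite Pa /K; lra.
have dK : primitive_on a T K r.
  apply: eq_primitive_on (primitive_onD (primitive_on_cst a T e) dP).
  by move=> x _; rewrite add0r.
have dKp : primitive_on a T (fun x => K x `^ (1 - p))
    (fun x => r x * ((1 - p) * K x `^ (1 - p - 1))).
  apply: (@primitive_on_comp _ a T K r (fun y => y `^ (1 - p))
    (fun y => (1 - p) * y `^ (1 - p - 1))) => // x.
  rewrite in_itv/= => xaT; have Kx0 := lt_le_trans e0 (eK x xaT).
  exact: is_derive1_powR.
have := primitive_onN (primitive_onD dKp (primitive_onZ ((p - 1) * c) dT)).
move=> /(primitive_on_le aT) /(_ _)/wrap[x|].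
  rewrite in_itv/= => /andP[ax xT].
  have xaT : a <= x <= T by rewrite !ltW.
  have Kx0 := lt_le_trans e0 (eK x xaT).
  have KHp : K x `^ p <= H x `^ p.
    by apply: ge0_ler_powR (KH x xaT); rewrite ?nnegrE ?(ltW Kx0)//;
      [lra|exact: le_trans (ltW Kx0) (KH x xaT)].
  have -> : 1 - p - 1 = - p by ring.
  rewrite powRN /r.
  have Kp0 : 0 < K x `^ p by exact: powR_gt0.
  have -> : - (c * dth x * H x `^ p * ((1 - p) * (K x `^ p)^-1) +
      (p - 1) * c * dth x) =
    (p - 1) * (c * dth x) * ((H x `^ p - K x `^ p) / K x `^ p).
    by field; rewrite gt_eqF.
  rewrite mulr_ge0//; last by rewrite divr_ge0 ?subr_ge0// ltW.
  by rewrite mulr_ge0 ?subr_ge0 ?(ltW p1)// mulr_ge0 ?(ltW c0)// dth0.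
have -> : - (p - 1) = 1 - p by ring.
rewrite {1}/K Pa addr0 => le1.
have := powR_ge0 (K T) (1 - p).
rewrite mulrBr; move: le1; lra.
Qed.

End blowup.

Section glassey_ode.
Context {R : realType}.
Local Notation mu := (@lebesgue_measure R).

(** Write [M] for the bound [CM * (expR (eta * t) * (1 + t)^(d / 2))] on the weighted volume; [d] is
    the space dimension minus one and [nu] the growth rate of [B]. Inserting [f >= H / (4 lam)] into
    [lam |f|^p M^(1 - p)] gives [4^(- p) H^p (lam M)^(1 - p)], so only the product [lam M] has to be
    bounded. The comparison starts at time 1, where [f] begins to control [H]. *)
Lemma glassey_ode_bound (T eta v beta p nu CB d CM e : R)
    (b db m V B F f E th : R -> R) :
  1 <= T -> 0 <= v -> 0 <= beta -> 10 * (v + beta + 1) <= eta ->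
  1 < p -> 0 < CM -> 0 < e ->
  B 0 = 0 -> primitive_on 0 T B b -> primitive_on 0 T b db ->
  (forall t, 0 <= t <= T -> `|b t| <= beta) ->
  (forall t, 0 < t < T -> V t = m t - db t / 2 - b t ^+ 2 / 4) ->
  {within `[0, T], continuous V} -> \int[mu]_(t in `[0, T]) `|V t| <= v ->
  (forall t, 0 <= t <= T -> B t <= nu * ln (1 + t) + CB) ->
  primitive_on 0 T F f -> {within `[0, T], continuous f} ->
  primitive_on 0 T E (fun t => (eta ^+ 2 - m t) * F t - b t * f t +
    `|f t| `^ p * (CM * (expR (eta * t) * (1 + t) `^ (d / 2))) `^ (- (p - 1))) ->
  (forall s t, 0 <= s -> s <= t -> t <= T -> f s - E s <= f t - E t) ->
  0 <= F 0 -> 0 <= f 0 -> e <= F 0 + f 0 ->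
  primitive_on 1 T th (fun t => (1 + t) `^ (- ((d + nu) * (p - 1) / 2))) ->
  (p - 1) * (4 `^ (- p) * (expR (CB / 2 + 1) * CM) `^ (- (p - 1))) * (th T - th 1)
    <= e `^ (- (p - 1)).
Proof.
move=> T1 v0 beta0 etaE p1 CM0 e0 B0 dB b_db b_beta VE cV V1 BCB dF cf dE fE F0 f0
  eFf dth.
have T0 : 0 <= T by exact: le_trans T1.
have M0 t : 0 <= t -> 0 < CM * (expR (eta * t) * (1 + t) `^ (d / 2)).
  move=> t0; have t10 : 0 < 1 + t by lra.
  by rewrite !mulr_gt0 ?expR_gt0 ?powR_gt0.
have [||lam [H [lamE cH H0 Hincr lamf]]] :=
  wronskian_lower_bound v0 beta0 etaE B0 dB b_db b_beta VE cV V1 dF cf dE _ fE F0 f0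
   _ T0.
- by move=> t _; rewrite mulr_ge0 ?powR_ge0.
- exact: lt_le_trans eFf.
have eH t : 0 <= t <= T -> e <= H t.
  move=> /andP[t0 tT]; rewrite (le_trans eFf)// (le_trans H0)// -subr_ge0.
  have := Hincr 0 t (fun=> 0) (fun=> 0) (lexx 0) t0 tT (primitive_on_cst _ _ _).
  rewrite subrr; apply => x /andP[x0 xt].
  have /andP[l0 _] : 0 < lam x <= expR (B x / 2 - eta * x + 1).
    by apply: lamE; rewrite (ltW x0) (le_trans (ltW xt)).
  by rewrite mulr_ge0 ?(ltW l0)// mulr_ge0 ?powR_ge0.
have sub1T t : 1 <= t <= T -> 0 <= t <= T.
  by move=> /andP[/(le_trans ler01) -> ->].
apply: (integral_ode_blowup (H := H) _ e0 _ p1 _ _ dth) => //.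
- by rewrite mulr_gt0// powR_gt0// mulr_gt0// expR_gt0.
- by apply: continuous_subspaceW cH; apply: subset_itvr; rewrite bnd_simp.
- by move=> t /sub1T; exact: eH.
- apply: continuous_in_subspaceT => t; rewrite inE/= in_itv/= => /andP[t1 _].
  have t0 : 0 < 1 + t by lra.
  have [+ _] := is_derive1_powR (- ((d + nu) * (p - 1) / 2)) t0.
  move=> /derivable1_diffP/differentiable_continuous ct.
  apply: (cvg_comp (fun s => 1 + s) (fun y : R => y `^ _) _ ct).
  by apply: cvgD; [exact: cvg_cst|exact: cvg_id].
- by move=> t _; exact: powR_ge0.
move=> t P /andP[t1 tT] dP.
apply: (Hincr _ _ _ _ ler01 t1 tT dP) => x /andP[x1 xt].
have x0 : 0 < x by exact: lt_trans x1.
have xT : 0 <= x <= T by rewrite (ltW x0) (le_trans (ltW xt)).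
have /andP[l0 lE] := lamE x xT.
have Hx0 : 0 < H x by exact: lt_le_trans (eH x xT).
have lf : H x <= 4 * (lam x * f x).
  by apply: lamf; rewrite (ltW x1) (le_trans (ltW xt)).
have fx : H x / (4 * lam x) <= `|f x|.
  rewrite ler_pdivrMr ?mulr_gt0// (le_trans lf)//.
  by rewrite mulrA mulrC ler_wpM2r ?ler_norm// mulr_ge0// ltW.
have Mx := M0 x (ltW x0); set M := CM * _ in Mx *.
have x10 : 0 < 1 + x by lra.
(* The factors [expR (- eta * x)] of [lam] and [expR (eta * x)] of [M] cancel exactly. The factor
   [expR (B / 2)] contributes the power [nu / 2] of [1 + x], the volume the power [d / 2]. *)
have lM : lam x * M <= expR (CB / 2 + 1) * CM * (1 + x) `^ ((d + nu) / 2).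
  apply: (@le_trans _ _ (expR (B x / 2 - eta * x + 1) * M)).
    by rewrite ler_pM2r.
  rewrite /M mulrCA [leRHS]mulrAC [leRHS]mulrC ler_pM2l// mulrA -expRD.
  have -> : (d + nu) / 2 = nu / 2 + d / 2 by lra.
  rewrite powRD; last by apply/implyP => _; rewrite gt_eqF.
  rewrite mulrA ler_pM2r ?powR_gt0// /powR gt_eqF// -expRD ler_expR.
  by have := BCB x xT; lra.
have lM0 : 0 < lam x * M by rewrite mulr_gt0.
have q0 : 0 <= p - 1 by rewrite subr_ge0 ltW.
have -> : (d + nu) * (p - 1) / 2 = (d + nu) / 2 * (p - 1) by lra.
have e1 : (4 `^ (- p) * (expR (CB / 2 + 1) * CM) `^ (- (p - 1)) *
    (1 + x) `^ (- ((d + nu) / 2 * (p - 1)))) * H x `^ p =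
  (4 `^ (- p) * H x `^ p) * (expR (CB / 2 + 1) * CM * (1 + x) `^ ((d + nu) / 2)) `^ (- (p - 1)).
  have eC : 0 <= expR (CB / 2 + 1) * CM by rewrite mulr_ge0 ?expR_ge0// ltW.
  rewrite (powRM _ eC) ?powR_ge0//.
  by rewrite -[in RHS]powRrM mulrN; ring.
rewrite e1.
apply: (@le_trans _ _ ((4 `^ (- p) * H x `^ p) * (lam x * M) `^ (- (p - 1)))).
  rewrite ler_wpM2l ?mulr_ge0 ?powR_ge0// !powRN lef_pV2 ?posrE ?powR_gt0//; last first.
    exact: lt_le_trans lM.
  by apply: ge0_ler_powR => //; rewrite nnegrE ltW//; exact: lt_le_trans lM.
apply: (@le_trans _ _ (lam x * ((H x / (4 * lam x)) `^ p * M `^ (- (p - 1))))); last first.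
  rewrite ler_pM2l// ler_pM2r ?powR_gt0//.
  apply: ge0_ler_powR => //; rewrite ?nnegrE//; first by lra.
  by rewrite divr_ge0 ?mulr_ge0// ltW.
have l40 : 0 <= (4 * lam x)^-1 by rewrite invr_ge0 mulr_ge0// ltW.
rewrite (powRM _ (ltW Hx0) l40) (powRM _ (ltW l0) (ltW Mx)).
rewrite -(powR_inv1 (a := 4 * lam x)) ?mulr_ge0 ?(ltW l0)// -powRrM mulN1r.
rewrite (powRM _ _ (ltW l0))// le_eqVlt; apply/orP; left; apply/eqP.
have -> : lam x `^ (- (p - 1)) = lam x * lam x `^ (- p).
  rewrite -{2}(powRr1 (ltW l0)) -powRD; first by congr (_ `^ _); ring.
  by apply/implyP => _; rewrite gt_eqF.
ring.
Qed.

End glassey_ode.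

(** * Smooth test functions *)

Section flat_functions.
Context {R : realType}.

(** The powers of [x^-1] are carried along because they appear under differentiation: the derivative
    of [flat k] is [flat k.+2 - k * flat k.+1], so the linear span of the family is stable. *)
Definition flat (k : nat) (x : R) : R := if 0 < x then x^-1 ^+ k * expR (- x^-1) else 0.

Lemma flat_ge0 k (x : R) : 0 <= flat k x.
Proof.
rewrite /flat; case: ifPn => // x0; rewrite mulr_ge0 ?expR_ge0// exprn_ge0//.
by rewrite invr_ge0 ltW.
Qed.

Lemma flat_le0 k (x : R) : x <= 0 -> flat k x = 0.
Proof. by rewrite /flat; case: ltgtP. Qed.

Lemma flat_gt0 k (x : R) : 0 < x -> 0 < flat k x.
Proof. by move=> x0; rewrite /flat x0 mulr_gt0 ?expR_gt0// exprn_gt0// invr_gt0. Qed.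

(** With [y = x^-1], the exponential series gives [expR y >= y^(k + 2) / (k + 2)!]. Quadratic
    smallness is what makes the difference quotient at the origin tend to 0. *)
Let flat_le_sqr k (x : R) : flat k x <= k.+2`!%:R * x ^+ 2.
Proof.
have [x0|x0] := leP x 0; first by rewrite flat_le0// mulr_ge0// sqr_ge0.
rewrite /flat x0; set y := x^-1; have y0 : 0 < y by rewrite invr_gt0.
have := expR_ge1Dxn k.+1 (ltW y0) => /(le_trans _) => /(_ (y ^+ k.+2 / k.+2`!%:R)).
rewrite lerDr ler01 => /(_ isT); rewrite ler_pdivrMr ?ltr0n ?fact_gt0// => ey.
rewrite expRN -[leLHS]/(_ / _) ler_pdivrMr ?expR_gt0//.
rewrite -(ler_pM2l (exprn_gt0 2 y0)) -exprD add2n (le_trans ey)//.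
rewrite mulrA mulrCA -exprMn mulVf ?gt_eqF// expr1n mulr1 mulrC.
by [].
Qed.

Lemma is_derive_flat k (x : R) : is_derive x 1 (flat k) (flat k.+2 x - k%:R * flat k.+1 x).
Proof.
have [x0|x0|->] := ltgtP x 0.
- rewrite !flat_le0 ?ltW// mulr0 subr0.
  apply: (near_eq_is_derive (f := cst 0)).
  by near=> z; rewrite flat_le0// ltW//; near: z; exact: lt_nbhsl.
- apply: (near_eq_is_derive (f := fun z : R => z^-1 ^+ k * expR (- z^-1))).
    by near=> z; rewrite /flat ifT//; near: z; exact: lt_nbhsr.
  have dV : is_derive x 1 (fun z : R => z^-1) (- x ^- 2 *: 1).
    split; first by apply: derivableV; [rewrite gt_eqF|exact: derivable_id].
    by rewrite (@deriveV _ R (@idfun R)) ?derive_id// gt_eqF.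
  have de : is_derive x^-1 1 (fun y : R => expR (- y)) (- 1 * expR (- x^-1)).
    have := @is_derive1_comp R expR -%R x^-1 (expR (- x^-1)) (- 1).
    by rewrite mulrC; apply.
  have dX : is_derive x^-1 1 (fun y : R => y ^+ k) ((k%:R * x^-1 ^+ k.-1) *: 1).
    by have := @is_deriveX R R (@idfun R) k x^-1 1 1 _; rewrite exprfctE; apply.
  have H := is_derive1_comp (is_deriveM dX de) dV.
  apply: (is_derive_eq H).
  rewrite /flat x0 -exprVn; set y := x^-1; set E := expR _.
  rewrite /GRing.scale/= !mulr1.
  by case: k {H dX} => [|k]; rewrite ?expr0 /= ?exprS; ring.
- suff H : h^-1 *: (flat k (h *: 1 + 0) - flat k 0) @[h --> (0 : R)^'] --> (0 : R).
    rewrite !flat_le0// mulr0 subr0; split; first by apply/cvg_ex; exists 0.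
    exact: cvg_lim H.
  have C0 : 0 < k.+2`!%:R + 1 :> R by rewrite ltr_pwDr.
  apply/cvgr0Pnorm_le => e e0; near=> h.
  have h0 : h != 0 by near: h; exact: nbhs_dnbhs_neq.
  rewrite (flat_le0 k (lexx 0)) subr0 addr0 /GRing.scale/= mulr1 normrM normfV.
  rewrite ler_pdivrMl ?normr_gt0// ger0_norm ?flat_ge0//.
  apply: (le_trans (flat_le_sqr k h)).
  rewrite -(real_normK (num_real h)) expr2 mulrA mulrC ler_wpM2l//.
  apply: (@le_trans _ _ ((k.+2`!%:R + 1) * `|h|)).
    by rewrite ler_wpM2r// lerDl.
  rewrite -ler_pdivlMl//.
  near: h; apply: dnbhs0_le; rewrite mulr_gt0// invr_gt0.
Unshelve. all: by end_near. Qed.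

Lemma continuous_flat k : continuous (flat k).
Proof.
move=> x; apply/differentiable_continuous/derivable1_diffP.
by have [] := is_derive_flat k x.
Qed.

End flat_functions.

Section smooth_class.
Context {R : realType} {V : normedModType R} {I : Type} (L : I -> V -> R).

(** Smoothness asks for differentiability of all iterated directional derivatives. It is obtained by
    induction from a class of expressions stable under every directional derivative; the generators
    [L i] are coordinates, with constant derivatives. *)
Inductive smooth_class : (V -> R) -> Prop :=
| smooth_class_coord i : smooth_class (L i)
| smooth_class_cst c : smooth_class (fun=> c)
| smooth_classD f g : smooth_class f -> smooth_class g ->
    smooth_class (fun x => f x + g x)
| smooth_classM f g : smooth_class f -> smooth_class g ->
    smooth_class (fun x => f x * g x)
| smooth_class_flat k f : smooth_class f -> smooth_class (fun x => flat k (f x))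
| smooth_class_expR f : smooth_class f -> smooth_class (fun x => expR (f x))
| smooth_classV f : smooth_class f -> (forall x, 0 < f x) ->
    smooth_class (fun x => (f x)^-1).

Lemma eq_smooth_class f g : f =1 g -> smooth_class f -> smooth_class g.
Proof. by move=> /funext ->. Qed.

Lemma smooth_class_prod (J : Type) (r : seq J) (F : J -> V -> R) :
  (forall j, smooth_class (F j)) -> smooth_class (fun x => \prod_(j <- r) F j x).
Proof.
move=> scF; elim: r => [|j r IH].
  by apply: eq_smooth_class (smooth_class_cst 1) => x; rewrite big_nil.
by apply: eq_smooth_class (smooth_classM (scF j) IH) => x; rewrite big_cons.
Qed.

Lemma differentiable_derive_comp (g : R -> R) (f : V -> R) dg x v :
  differentiable f x -> is_derive (f x) 1 g dg ->
  differentiable (fun y => g (f y)) x /\ 'D_v (fun y => g (f y)) x = 'D_v f x * dg.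
Proof.
move=> df [/derivable1_diffP dg1 <-].
have dgf : differentiable (g \o f) x by exact: differentiable_comp.
split; first exact: dgf.
rewrite (deriveE v dgf) diff_comp//= (deriveE v df) (@deriveE R R R g (f x) 1 dg1).
by rewrite -[X in 'd g _ X]mulr1 -[_ * 1]/(_ *: 1) linearZ.
Qed.

Hypothesis dL : forall i x, differentiable (L i) x.
Hypothesis DL : forall i v, exists c, forall x, 'D_v (L i) x = c.

Lemma smooth_class_derive f : smooth_class f ->
  (forall x, differentiable f x) /\ forall v, smooth_class (fun x => 'D_v f x).
Proof.
elim => {f} [i|c|f g sf [df Df] sg [dg Dg]|f g sf [df Df] sg [dg Dg]
  |k f sf [df Df]|f sf [df Df]|f sf [df Df] f0].
- split=> // v; have [c Dc] := DL i v.
  exact: eq_smooth_class (fun x => esym (Dc x)) (smooth_class_cst c).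
- split=> [x|v]; first exact: differentiable_cst.
  apply: eq_smooth_class (smooth_class_cst 0) => x.
  by rewrite derive_cst.
- split=> [x|v]; first by apply: differentiableD.
  apply: eq_smooth_class (smooth_classD (Df v) (Dg v)) => x.
  by rewrite deriveD//; exact: diff_derivable.
- split=> [x|v]; first by apply: differentiableM.
  apply: eq_smooth_class
    (smooth_classD (smooth_classM sf (Dg v)) (smooth_classM sg (Df v))) => x.
  by rewrite deriveM//; exact: diff_derivable.
- have H x v := differentiable_derive_comp v (df x) (is_derive_flat k (f x)).
  split=> [x|v]; first by have [] := H x 0.
  apply: (@eq_smooth_class (fun x => 'D_v f x *
    (flat k.+2 (f x) + - k%:R * flat k.+1 (f x)))) => [x|].
    by have [_ ->] := H x v; rewrite mulNr.
  apply: smooth_classM => //; apply: smooth_classD; first exact: smooth_class_flat.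
  by apply: smooth_classM; [exact: smooth_class_cst|exact: smooth_class_flat].
- have H x v := differentiable_derive_comp v (df x) (is_derive_expR (f x)).
  split=> [x|v]; first by have [] := H x 0.
  apply: eq_smooth_class (smooth_classM (Df v) (smooth_class_expR sf)) => x.
  by have [_ ->] := H x v.
- split=> [x|v]; first by apply: differentiableV => //; rewrite gt_eqF.
  have sV := smooth_classV sf f0.
  apply: eq_smooth_class (smooth_classM (smooth_classM (smooth_class_cst (-1))
    (smooth_classM sV sV)) (Df v)) => x.
  rewrite deriveV ?gt_eqF//; last exact: diff_derivable.
  by rewrite /GRing.scale/= mulN1r -exprVn expr2.
Qed.

Lemma smooth_class_smooth f : smooth_class f -> smooth f.
Proof.
move=> sf vs x.
suff : smooth_class (iter_derive vs f) by move=> /smooth_class_derive[].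
by elim: vs => //= v vs /smooth_class_derive[].
Qed.

End smooth_class.

Section cutoff.
Context {R : realType}.

Definition smooth_step (x : R) : R := flat 0 x / (flat 0 x + flat 0 (1 - x)).

Lemma smooth_step_den_gt0 x : 0 < flat 0 x + flat 0 (1 - x) :> R.
Proof.
have [x0|x0] := ltP 0 x; first by rewrite ltr_pwDl ?flat_gt0 ?flat_ge0.
by rewrite ltr_wpDl ?flat_ge0// flat_gt0//; lra.
Qed.

Lemma smooth_step_ge0 x : 0 <= smooth_step x.
Proof. by rewrite divr_ge0 ?flat_ge0// ltW// smooth_step_den_gt0. Qed.

Lemma smooth_step_le0 x : x <= 0 -> smooth_step x = 0.
Proof. by move=> x0; rewrite /smooth_step flat_le0 ?mul0r. Qed.

Lemma smooth_step_ge1 x : 1 <= x -> smooth_step x = 1.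
Proof.
move=> x1; rewrite /smooth_step (flat_le0 _ (x := 1 - x)); last by lra.
by rewrite addr0 divff// gt_eqF// flat_gt0//; lra.
Qed.

Lemma smooth_class_step (V : normedModType R) (I : Type) (L : I -> V -> R) f :
  smooth_class L f -> smooth_class L (fun x => smooth_step (f x)).
Proof.
move=> sf; rewrite /smooth_step; apply: smooth_classM; first exact: smooth_class_flat.
apply: smooth_classV => [|x]; last exact: smooth_step_den_gt0.
apply: smooth_classD; first exact: smooth_class_flat.
apply: smooth_class_flat; apply: smooth_classD; first exact: smooth_class_cst.
apply: eq_smooth_class (smooth_classM (smooth_class_cst L (-1)) sf) => x.
by rewrite mulN1r.
Qed.

End cutoff.

Section linear_coordinates.
Context {R : realType} {V : normedModType R}.

Lemma derive_linear (f : V -> R) (x v : V) :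
  (forall (h : R) (y z : V), f (h *: y + z) = h * f y + f z) -> 'D_v f x = f v.
Proof.
move=> flin; apply: cvg_lim => //; apply: cvg_near_cst; near=> h.
have h0 : h != 0 by near: h; exact: nbhs_dnbhs_neq.
by rewrite /= flin addrK /GRing.scale/= mulKf.
Unshelve. all: by end_near. Qed.

Lemma differentiable_linear (f : V -> R) (x : V) :
  (forall (h : R) (y z : V), f (h *: y + z) = h * f y + f z) -> continuous f ->
  differentiable f x.
Proof.
move=> flin cf.
have lf : linear (f : V -> R^o) by exact: flin.
pose F := GRing.isLinear.Build R V R^o *:%R f lf.
pose f' : {linear V -> R^o} := HB.pack f F.
exact: (@linear_differentiable R V R f').
Qed.

End linear_coordinates.

Section rV_coordinates.
Context {R : realType} {n : nat}.

Definition rV_coord (i : 'I_n) (x : 'rV[R]_n) : R := x ord0 i.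

Definition spacetime_coord (i : option 'I_n) (z : R * 'rV[R]_n) : R :=
  if i is Some j then z.2 ord0 j else z.1.

Lemma differentiable_rV_coord i x : differentiable (rV_coord i) x.
Proof. exact: differentiable_coord. Qed.

Lemma derive_rV_coord i (x v : 'rV[R]_n) : 'D_v (rV_coord i) x = v ord0 i.
Proof. by apply: derive_linear => h y z; rewrite /rV_coord !mxE. Qed.

Lemma differentiable_spacetime_coord i x : differentiable (spacetime_coord i) x.
Proof.
apply: differentiable_linear; first by case: i => [i|] h y z //=; rewrite !mxE.
case: i => [i|] z /=; last exact: cvg_fst.
apply: (@cvg_comp _ _ _ snd (rV_coord i) _ (nbhs z.2)); first exact: cvg_snd.
exact: coord_continuous.
Qed.

Lemma derive_spacetime_coord i (x v : R * 'rV[R]_n) :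
  'D_v (spacetime_coord i) x = spacetime_coord i v.
Proof. by apply: derive_linear; case: i => [i|] h y z //=; rewrite !mxE. Qed.

Lemma smooth_class_rV_derive (f : 'rV[R]_n -> R) : smooth_class rV_coord f ->
  (forall x, differentiable f x) /\ forall v, smooth_class rV_coord (fun x => 'D_v f x).
Proof.
apply: smooth_class_derive; first exact: differentiable_rV_coord.
by move=> i v; exists (v ord0 i) => x; exact: derive_rV_coord.
Qed.

Lemma smooth_class_rV_smooth (f : 'rV[R]_n -> R) :
  smooth_class rV_coord f -> smooth f.
Proof.
apply: smooth_class_smooth; first exact: differentiable_rV_coord.
by move=> i v; exists (v ord0 i) => x; exact: derive_rV_coord.
Qed.

Lemma smooth_class_spacetime_smooth (f : R * 'rV[R]_n -> R) :
  smooth_class spacetime_coord f -> smooth f.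
Proof.
apply: smooth_class_smooth; first exact: differentiable_spacetime_coord.
by move=> i v; exists (spacetime_coord i v) => x; exact: derive_spacetime_coord.
Qed.

(* The sigma-algebra of ['rV_n] is generated by the coordinates, so the
   measurability of an arbitrary continuous function is not at hand. *)
Lemma smooth_class_measurable (f : 'rV[R]_n -> R) :
  smooth_class rV_coord f -> measurable_fun setT f.
Proof.
elim=> {f} [i|c|f g _ mf _ mg|f g _ mf _ mg|k f _ mf|f _ mf|f _ mf f0].
- exact: measurable_coord_rV.
- exact: measurable_cst.
- exact: measurable_funD.
- exact: measurable_funM.
- exact: measurableT_comp (continuous_measurable_fun (@continuous_flat R k)) mf.
- exact: measurableT_comp.
- rewrite (_ : (fun _ => _) = (fun x => f x `^ (-1))); last first.
    by apply/funext => x; rewrite powR_inv1// ltW.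
  exact: measurableT_comp (measurable_powR (-1)) mf.
Qed.

Lemma smooth_class_continuous (f : 'rV[R]_n -> R) :
  smooth_class rV_coord f -> continuous f.
Proof.
by move=> /smooth_class_rV_derive[df _] x; exact: differentiable_continuous.
Qed.

(** A cube rather than a Euclidean ball, because the spatial cut-off is a product of one-variable
    cut-offs and the measure is known on boxes. *)
Definition rV_box (r : R) : set 'rV[R]_n := [set x | forall i, `|x ord0 i| <= r].

Lemma compact_rV_box r : compact (rV_box r).
Proof.
have := @rV_compact R n (fun=> `[- r, r]%classic) (fun=> @segment_compact R _ _).
rewrite (_ : [set _ | _] = rV_box r)//.
by apply/seteqP; split=> x /= xr i; have := xr i; rewrite /= in_itv/= -ler_norml.
Qed.

Lemma smooth_class_bounded (f : 'rV[R]_n -> R) r : smooth_class rV_coord f ->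
  (forall x, ~ rV_box r x -> f x = 0) -> exists C, forall x, `|f x| <= C.
Proof.
move=> /smooth_class_continuous cf f0.
have := continuous_compact (f := f) (continuous_subspaceT cf) (@compact_rV_box r).
move=> /compact_bounded[M [_ Mf]]; exists (`|M| + 1) => x.
have [xr|/f0 ->] := pselect (rV_box r x); last by rewrite normr0 addr_ge0.
by apply: (Mf (`|M| + 1)); [rewrite ltr_pwDr// ler_norm|exists x].
Qed.

Lemma near_rV_coord_lt (x : 'rV[R]_n) (r : R) : (forall i, `|x ord0 i| < r) ->
  nbhs x [set y | forall i, `|y ord0 i| < r].
Proof.
move=> xr; have := @filter_forall _ _ (fun i => [set y : 'rV[R]_n | `|y ord0 i| < r])
  (nbhs x) (nbhs_filter x); apply => i.
have := @coord_continuous R 1 n ord0 i x => /cvg_norm /cvgr_lt; apply.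
exact: xr.
Qed.

Lemma near_rV_box_compl (x : 'rV[R]_n) (r : R) : ~ rV_box r x ->
  nbhs x (~` rV_box r).
Proof.
move=> /existsNP[i /negP]; rewrite -ltNge => xr.
have := @coord_continuous R 1 n ord0 i x => /cvg_norm /cvgr_gt /(_ _ xr).
by apply: filterS => y yr /(_ i); rewrite leNgt yr.
Qed.

End rV_coordinates.

Section test_functions.
Context {R : realType} {n : nat}.
Variables (eta A : R).

Definition cutoff (y : R) : R :=
  smooth_step (A + 1 - y) * smooth_step (A + 1 + y).

Lemma cutoff_ge0 y : 0 <= cutoff y.
Proof. by rewrite mulr_ge0// smooth_step_ge0. Qed.

Lemma cutoff1 y : `|y| <= A -> cutoff y = 1.
Proof.
by rewrite ler_norml => /andP[y1 y2]; rewrite /cutoff !smooth_step_ge1 ?mulr1//; lra.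
Qed.

Lemma cutoff0 y : A + 1 < `|y| -> cutoff y = 0.
Proof.
rewrite lter_normr /cutoff => /orP[y1|y1].
  by rewrite smooth_step_le0 ?mul0r//; lra.
by rewrite [X in _ * X]smooth_step_le0 ?mulr0//; lra.
Qed.

Definition expw (x : 'rV[R]_n.+1) : R := expR (eta * x ord0 ord0).

Definition expw_cut (x : 'rV[R]_n.+1) : R := expw x * \prod_i cutoff (x ord0 i).

Lemma expw_gt0 x : 0 < expw x. Proof. exact: expR_gt0. Qed.

Lemma expw_cut_ge0 x : 0 <= expw_cut x.
Proof.
by rewrite mulr_ge0 ?expR_ge0// prodr_ge0// => i _; exact: cutoff_ge0.
Qed.

Lemma expw_cutE x : rV_box A x -> expw_cut x = expw x.
Proof.
move=> xA; rewrite /expw_cut big1 ?mulr1// => i _; exact/cutoff1/xA.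
Qed.

Lemma expw_cut_eq0 x : ~ rV_box (A + 1) x -> expw_cut x = 0.
Proof.
move=> /existsNP[i /negP]; rewrite -ltNge => /cutoff0 xi.
by rewrite /expw_cut (bigD1 i)//= xi mul0r mulr0.
Qed.

Lemma smooth_class_cutoff (V : normedModType R) (I : Type) (L : I -> V -> R) i :
  smooth_class L (fun x => cutoff (L i x)).
Proof.
have sL := smooth_class_coord L i; have sA := smooth_class_cst L (A + 1).
apply: smooth_classM; apply: smooth_class_step.
  apply: eq_smooth_class (smooth_classD sA (smooth_classM (smooth_class_cst L (-1)) sL)).
  by move=> x; rewrite mulN1r.
exact: smooth_classD.
Qed.

Lemma smooth_class_expw : smooth_class rV_coord expw.
Proof.
apply: smooth_class_expR; apply: smooth_classM; first exact: smooth_class_cst.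
exact: (smooth_class_coord rV_coord).
Qed.

Lemma smooth_class_expw_cut : smooth_class rV_coord expw_cut.
Proof.
apply: smooth_classM; first exact: smooth_class_expw.
by apply: smooth_class_prod => i; exact: (smooth_class_cutoff rV_coord).
Qed.

Lemma derive_expw (x v : 'rV[R]_n.+1) : 'D_v expw x = eta * v ord0 ord0 * expw x.
Proof.
have dl : differentiable (fun y : 'rV[R]_n.+1 => eta * y ord0 ord0) x.
  by apply: differentiableM; [exact: differentiable_cst|exact: differentiable_coord].
have [_ ->] := differentiable_derive_comp v dl (is_derive_expR (eta * x ord0 ord0)).
congr (_ * _); apply: derive_linear => h y z; rewrite !mxE; ring.
Qed.

Definition smooth_supp (r : R) (f : 'rV[R]_n.+1 -> R) : Prop :=
  smooth_class rV_coord f /\ forall x, ~ rV_box r x -> f x = 0.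

Lemma smooth_supp_test_fun r f : smooth_supp r f -> test_fun f.
Proof.
move=> [sf f0]; split; first exact: smooth_class_rV_smooth.
by exists (rV_box r) => //; exact: compact_rV_box.
Qed.

Lemma smooth_supp_partial r f i : smooth_supp r f -> smooth_supp r (partial i f).
Proof.
move=> [sf f0]; split.
  by have [_] := smooth_class_rV_derive sf; exact.
move=> x xr; rewrite /partial -(@derive_cst _ _ _ 0 x (delta_mx ord0 i)).
apply: near_eq_derive.
by have := near_rV_box_compl xr; apply: filterS => y /f0.
Qed.

Lemma smooth_supp_expw_cut : smooth_supp (A + 1) expw_cut.
Proof. by split; [exact: smooth_class_expw_cut|exact: expw_cut_eq0]. Qed.

Lemma partial_expw_cut i (x : 'rV[R]_n.+1) : (forall j, `|x ord0 j| < A) ->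
  partial i expw_cut x = (i == ord0)%:R * eta * expw x.
Proof.
move=> xA; rewrite /partial (near_eq_derive (g := expw)).
  by rewrite derive_expw mxE eqxx /= eq_sym [eta * _]mulrC.
have := near_rV_coord_lt xA; apply: filterS => y yA.
by apply: expw_cutE => j; exact: ltW.
Qed.

Lemma laplacian_expw_cut (x : 'rV[R]_n.+1) : (forall j, `|x ord0 j| < A) ->
  \sum_i partial i (partial i expw_cut) x = eta ^+ 2 * expw x.
Proof.
move=> xA.
have H i : partial i (partial i expw_cut) x = (i == ord0)%:R * (eta ^+ 2 * expw x).
  rewrite {1}/partial (near_eq_derive (g := fun y => (i == ord0)%:R * eta * expw y)).
    have dex : derivable expw x (delta_mx ord0 i).
      by apply: diff_derivable; have [+ _] := smooth_class_rV_derive smooth_class_expw.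
    rewrite (deriveZ _ dex) derive_expw mxE eqxx/= [_ == i]eq_sym /GRing.scale/=.
    by case: eqP => _; rewrite /= ?mul0r//; ring.
  by have := near_rV_coord_lt xA; apply: filterS => y yA; exact: partial_expw_cut.
under eq_bigr do rewrite H.
rewrite (bigD1 ord0)//= mul1r big1 ?addr0// => i /negbTE ->.
by rewrite mul0r.
Qed.

(** The time factor is 1 up to [t0] and 0 from [t1] on. At times below [t0] this acts as a
    time-independent test function, so the term with the time derivative drops out of the weak form,
    while the support stays compact. *)
Definition spacetime_cut (t0 t1 : R) (z : R * 'rV[R]_n.+1) : R :=
  smooth_step ((t1 - t0)^-1 * (t1 - z.1)) * expw_cut z.2.

Lemma spacetime_cutE t0 t1 t x : t0 < t1 -> t <= t0 ->
  spacetime_cut t0 t1 (t, x) = expw_cut x.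
Proof.
move=> t01 tt0; rewrite /spacetime_cut/= smooth_step_ge1 ?mul1r//.
by rewrite ler_pdivlMl ?subr_gt0// mulr1; lra.
Qed.

Lemma spacetime_cut_test_fun (T : \bar R) t0 t1 : t0 < t1 -> (t1%:E < T)%E ->
  spacetime_test_fun T (spacetime_cut t0 t1).
Proof.
move=> t01 t1T; split.
  apply: smooth_class_spacetime_smooth; apply: smooth_classM.
    apply: smooth_class_step; apply: smooth_classM; first exact: smooth_class_cst.
    apply: eq_smooth_class (smooth_classD (smooth_class_cst _ t1) (smooth_classM
      (smooth_class_cst _ (-1)) (smooth_class_coord spacetime_coord None))).
    by move=> z; rewrite mulN1r.
  apply: smooth_classM.
    apply: smooth_class_expR; apply: smooth_classM; first exact: smooth_class_cst.
    exact: (smooth_class_coord spacetime_coord (Some ord0)).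
  apply: smooth_class_prod => i.
  exact: (smooth_class_cutoff spacetime_coord (Some i)).
exists (`[0, t1] `*` rV_box (A + 1)); split.
- by apply: compact_setX; [exact: segment_compact|exact: compact_rV_box].
- move=> [t x] [/=]; rewrite in_itv/= => /andP[t0' tt1] _; split=> //; split=> //=.
  by rewrite (le_lt_trans _ t1T)// lee_fin.
- move=> t x [t0' _] /not_andP[|xA]; rewrite /spacetime_cut/=.
    rewrite in_itv/= t0'/= => /negP; rewrite -ltNge => tt1.
    rewrite smooth_step_le0 ?mul0r// mulrC pmulr_lle0 ?invr_gt0 ?subr_gt0//; lra.
  by rewrite expw_cut_eq0// mulr0.
Qed.

Lemma spacetime_cut_derive t0 t1 t x : t0 < t1 -> t < t0 ->
  'D_1 (fun r => spacetime_cut t0 t1 (r, x)) t = 0.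
Proof.
move=> t01 tt0; rewrite -(@derive_cst R R R (expw_cut x) t 1).
apply: near_eq_derive; near=> s; apply: spacetime_cutE => //.
by apply: ltW; near: s; exact: lt_nbhsl.
Unshelve. all: by end_near. Qed.

End test_functions.

(** * Integrals on row vectors *)

Section Lfun2.
Context d (T : measurableType d) (R : realType) (mu : {measure set T -> \bar R}).
Implicit Types f g : T -> R.

Let le12 : (1 <= 2%:E :> \bar R)%E. Proof. by rewrite lee_fin ler1n. Qed.

Lemma Lfun2_scaleD a f g : f \in Lfun mu 2%:E -> g \in Lfun mu 2%:E ->
  (fun x => a * f x + g x) \in Lfun mu 2%:E.
Proof.
move=> f2 g2; have [_ H] := Lfun_submod_closed mu le12.
exact: H a f g f2 g2.
Qed.

Lemma Lfun2B f g : f \in Lfun mu 2%:E -> g \in Lfun mu 2%:E ->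
  (fun x => f x - g x) \in Lfun mu 2%:E.
Proof.
move=> f2 g2; have := Lfun2_scaleD (-1) g2 f2.
by rewrite (_ : (fun x => -1 * g x + f x) = (fun x => f x - g x))//;
  apply/funext => x; rewrite mulN1r addrC.
Qed.

Lemma Lfun2_measurable f : f \in Lfun mu 2%:E -> measurable_fun setT f.
Proof. by rewrite inE => /andP[/[!inE]/=]. Qed.

Lemma Lfun2_fin f : f \in Lfun mu 2%:E -> ('N[mu]_2%:E[EFin \o f] < +oo)%E.
Proof. by rewrite inE => /andP[_ /[!inE]/=]. Qed.

Lemma Lfun2_integrableM f g : f \in Lfun mu 2%:E -> g \in Lfun mu 2%:E ->
  mu.-integrable setT (EFin \o (fun x => f x * g x)).
Proof. by move=> f2 g2; apply/Lfun1_integrable; exact: Lfun2_mul_Lfun1. Qed.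

Lemma Cauchy_Schwarz_Rintegral f g : f \in Lfun mu 2%:E -> g \in Lfun mu 2%:E ->
  `|\int[mu]_x (f x * g x)| <=
  fine 'N[mu]_2%:E[EFin \o f]%E * fine 'N[mu]_2%:E[EFin \o g]%E.
Proof.
move=> f2 g2; have ifg := Lfun2_integrableM f2 g2.
apply: (le_trans (le_normr_Rintegral measurableT ifg)).
have Nf := Lfun2_fin f2; have Ng := Lfun2_fin g2.
rewrite -fineM ?ge0_fin_numE ?Lnorm_ge0//.
have := hoelder mu (Lfun2_measurable f2) (Lfun2_measurable g2) (ltr0n _ 2) (ltr0n _ 2).
rewrite Lnorm1 => /(_ _)/wrap[|H]; first by rewrite [RHS]splitr !div1r.
apply: fine_le => //.
- rewrite ge0_fin_numE ?integral_ge0//.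
  by case/integrableP : ifg.
- by rewrite fin_numM// ge0_fin_numE// Lnorm_ge0.
Qed.

End Lfun2.

Section rV_integrals.
Context {R : realType} {n : nat}.
Local Notation leb := (@lebesgue_rV R n).

Lemma measurable_rV_box r : measurable (rV_box r : set 'rV[R]_n).
Proof.
rewrite (_ : rV_box r = \bigcap_(i in [set: 'I_n])
    ((fun x : 'rV[R]_n => x ord0 i) @^-1` `[- r, r])).
  apply: fin_bigcap_measurable; first exact: finite_finset.
  by move=> i _; rewrite -[X in measurable X]setTI; exact: measurable_coord_rV.
apply/seteqP; split=> x xr i; have := xr i; rewrite /= in_itv/= -ler_norml//.
exact.
Qed.

Lemma lebesgue_rV_box_lty r : (leb (rV_box r) < +oo)%E.
Proof.
have [r0|r0] := leP 0 r.
  rewrite (_ : rV_box r = [set x | forall i, - r <= x ord0 i <= r]).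
    by rewrite (@lebesgue_rV_box R n (fun=> - r) (fun=> r)) ?ltry// => _; lra.
  by apply/seteqP; split=> x xr i; have := xr i; rewrite ler_norml.
apply: (@le_lt_trans _ _ (leb (rV_box 0))).
  apply: le_measure; rewrite ?inE; try exact: measurable_rV_box.
  by move=> x xr i; apply: (le_trans (xr i)); rewrite ltW.
rewrite (_ : rV_box 0 = [set x | forall i, 0 <= x ord0 i <= 0]).
  by rewrite (@lebesgue_rV_box R n (fun=> 0) (fun=> 0)) ?ltry.
by apply/seteqP; split=> x xr i; have := xr i; rewrite ler_norml oppr0.
Qed.

Lemma bounded_box_Lfun2 (f : 'rV[R]_n -> R) r C : measurable_fun setT f ->
  (forall x, ~ rV_box r x -> f x = 0) -> (forall x, `|f x| <= C) ->
  f \in Lfun leb 2%:E.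
Proof.
move=> mf f0 fC; rewrite inE; apply/andP; split; rewrite inE//=.
rewrite /finite_norm unlock; apply: poweR_lty => /=.
apply: (@le_lt_trans _ _ (\int[leb]_x ((C ^+ 2)%:E * (\1_(rV_box r) x)%:E))%E).
  apply: ge0_le_integral => //=.
  - apply/measurable_EFinP; apply: (measurableT_comp (measurable_powR _)) => //.
    exact: measurableT_comp.
  - apply: measurable_funeM; apply/measurable_EFinP/measurable_indic.
    exact: measurable_rV_box.
  - move=> x _; rewrite -EFinM lee_fin powR_mulrn//.
    have [xr|xr] := pselect (rV_box r x).
      rewrite indicE mem_set// mulr1 lerXn2r ?nnegrE//.
      exact: le_trans (fC x).
    by rewrite f0// normr0 expr0n/= mulr_ge0// ?sqr_ge0.
rewrite ge0_integralZl//=; last 2 first.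
- by apply/measurable_EFinP/measurable_indic; exact: measurable_rV_box.
- by rewrite lee_fin sqr_ge0.
rewrite integral_indic//; last exact: measurable_rV_box.
by rewrite setIT lte_mul_pinfty ?lee_fin ?sqr_ge0// lebesgue_rV_box_lty.
Qed.

(** Each point of [K] has an open neighbourhood on which [f] vanishes almost everywhere; finitely
    many of them cover [K], and a finite union of null sets is null. *)
Lemma ae_eq0_compact (f : 'rV[R]_n -> R) (K : set 'rV[R]_n) : compact K ->
  (forall x, K x -> ~ ess_supp f x) -> {ae leb, forall x, K x -> f x = 0}.
Proof.
move=> cK Kf.
pose D := [set U : set 'rV[R]_n | open U /\ {ae leb, forall y, U y -> f y = 0}].
have := cK; rewrite compact_cover => /(_ _ D id) [||G GD KG].
- by move=> U [].
- move=> x /Kf /existsNP[U /not_implyP[xU /contrapT Uf]].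
  exists (interior U); last exact: xU.
  split; first exact: open_interior.
  by apply: filterS Uf => y fy /interior_subset; exact: fy.
have : {ae leb, forall (x : 'rV[R]_n) (U : set 'rV[R]_n), U \in G -> U x -> f x = 0}.
  have := @filter_bigI _ _ G (fun U => [set y | U y -> f y = 0])
    (almost_everywhere leb) (ae_filter_ringOfSetsType _).
  move=> /(_ _)/wrap[U /GD|]; first by rewrite inE => -[].
  by apply: filterS => x Gx U UG; apply: Gx.
by apply: filterS => x Gx /KG [U UG Ux]; exact: Gx UG Ux.
Qed.

Lemma continuous_enorm2 : continuous (fun x : 'rV[R]_n => \sum_i x ord0 i ^+ 2).
Proof.
apply: continuous_big => [|i _]; first exact: add_continuous.
move=> x; have c := @coord_continuous R 1 n ord0 i x; exact: (cvgM c c).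
Qed.

Lemma eballE r (x : 'rV[R]_n) :
  0 < r -> eball r x <-> \sum_i x ord0 i ^+ 2 < r ^+ 2.
Proof.
move=> r0; rewrite /eball/= -[X in Num.sqrt _ < X](gtr0_norm r0) -sqrtr_sqr.
by rewrite ltr_sqrt ?exprn_gt0.
Qed.

Lemma eball_box r : eball r `<=` (rV_box r : set 'rV[R]_n).
Proof.
move=> x; rewrite /eball/= => /ltW xr i; apply: le_trans xr.
rewrite -sqrtr_sqr ler_wsqrtr// (bigD1 i)//= lerDl sumr_ge0// => j _.
exact: sqr_ge0.
Qed.

(** The complement of the ball is the countable union of its intersections with the cubes of integer
    half-side, which are compact. *)
Lemma ae_eq0_eball (f : 'rV[R]_n -> R) r : 0 < r -> ess_supp f `<=` eball r ->
  {ae leb, forall x, ~ eball r x -> f x = 0}.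
Proof.
move=> r0 fr.
suff : {ae leb, forall x, forall k : nat, (rV_box k%:R `&` ~` eball r) x -> f x = 0}.
  apply: filterS => x Hx xr.
  pose k := (Num.truncn (\sum_i `|x ord0 i|)).+1.
  apply: (Hx k); split=> // i.
  rewrite (@le_trans _ _ (\sum_i `|x ord0 i|))//.
    by rewrite (bigD1 i)//= lerDl sumr_ge0.
  by apply/ltW/truncnS_gt.
apply: ae_foralln => k; apply: ae_eq0_compact.
  have -> : ~` eball r = [set x : 'rV[R]_n | r ^+ 2 <= \sum_i x ord0 i ^+ 2].
    apply/seteqP; split=> x /=; rewrite leNgt => xr.
      by apply/negP => /(eballE _ r0).
    by move=> /(eballE _ r0); exact/negP.
  apply: compact_closedI; first exact: compact_rV_box.
  rewrite (_ : [set _ | _] = (fun x : 'rV[R]_n => \sum_i x ord0 i ^+ 2) @^-1` `[r ^+ 2, +oo[).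
    by apply: preimage_closed; [move=> x _; exact: continuous_enorm2|exact: rray_closed].
  by apply/seteqP; split=> x /=; rewrite in_itv/= andbT.
by move=> x [_ xr] /fr.
Qed.

End rV_integrals.

(** * Exponentially weighted volume of a ball *)

Section ball_volume.
Context {R : realType}.
Local Notation mu := (@lebesgue_measure R).
Local Notation leb n := (@lebesgue_rV R n).

Lemma ge0_integral_rV_cons n (f : 'rV[R]_n.+1 -> \bar R) :
  measurable_fun setT f -> (forall x, (0 <= f x)%E) ->
  (\int[leb n.+1]_x f x = \int[mu]_y \int[leb n]_x f (rV_cons (y, x)))%E.
Proof.
move=> mf f0.
pose m : {measure set (measurableTypeR R * 'rV[R]_n)%type -> \bar R} :=
  (mu \x leb n)%E.
have mc : measurable_fun (setT : set (measurableTypeR R * 'rV[R]_n)%type) (@rV_cons R n).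
  exact: measurable_rV_cons.
have := ge0_integral_pushforward mc m measurableT mf (fun x _ => f0 x).
rewrite preimage_setT => H.
transitivity (\int[m]_x (f \o @rV_cons R n) x)%E; first exact: H.
rewrite /m fubini_tonelli1//; first exact: measurableT_comp mf mc.
by move=> x; exact: f0.
Qed.

Lemma measurable_int_rV_cons n (f : 'rV[R]_n.+1 -> \bar R) :
  measurable_fun setT f -> (forall x, (0 <= f x)%E) ->
  measurable_fun (setT : set (measurableTypeR R))
    (fun y => \int[leb n]_x f (rV_cons (y, x)))%E.
Proof.
move=> mf f0.
have mc : measurable_fun (setT : set (measurableTypeR R * 'rV[R]_n)%type) (@rV_cons R n).
  exact: measurable_rV_cons.
have f0' : forall z : measurableTypeR R * 'rV[R]_n, (0 <= (f \o @rV_cons R n) z)%E.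
  by move=> z; exact: f0.
exact: (measurable_fun_fubini_tonelli_F (m2 := leb n) _ (measurableT_comp mf mc) f0').
Qed.

Lemma measurable_eball n r : measurable (eball r : set 'rV[R]_n).
Proof.
have mS : measurable_fun setT (fun x : 'rV[R]_n => \sum_i x ord0 i ^+ 2).
  by apply: measurable_sum => i; apply: measurable_funX; exact: measurable_coord_rV.
have [r0|r0] := leP r 0.
  rewrite (_ : eball r = set0); first exact: measurable0.
  by apply/seteqP; split=> x //; rewrite /eball/= ltNge (le_trans r0)// sqrtr_ge0.
rewrite (_ : eball r = (fun x : 'rV[R]_n => \sum_i x ord0 i ^+ 2) @^-1` `]-oo, r ^+ 2[).
  by rewrite -[X in measurable X]setTI; exact: mS.
by apply/seteqP; split=> x; rewrite (eballE _ r0)/= in_itv.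
Qed.

Lemma lebesgue_rV_cube n s : 0 <= s -> leb n (rV_box s) = ((2 * s) ^+ n)%:E.
Proof.
move=> s0; rewrite (_ : rV_box s = [set x | forall i, - s <= x ord0 i <= s]).
  rewrite (@lebesgue_rV_box R n (fun=> - s) (fun=> s)); last by move=> _; lra.
  by rewrite prodr_const card_ord; congr (_ ^+ _)%:E; ring.
by apply/seteqP; split=> x xr i; have := xr i; rewrite ler_norml.
Qed.

Lemma exprn_le_expR n (x : R) : 0 <= x -> x ^+ n <= n`!%:R * expR x.
Proof.
move=> x0; case: n => [|n]; first by rewrite fact0 mul1r (le_trans _ (expR_ge1Dx x))// lerDl.
have := expR_ge1Dxn n x0 => /(le_trans _) => /(_ (x ^+ n.+1 / n.+1`!%:R)).
by rewrite lerDr ler01 => /(_ isT); rewrite ler_pdivrMr ?ltr0n ?fact_gt0// mulrC.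
Qed.

(* On the slice [x_0 = y] the ball has half-width [sqrt (r^2 - y^2)], at most
   [sqrt (2 r (r - y))]; hence the factor [r^(n/2)]. *)
Let slice_bound n (eta r y : R) : 0 < eta -> 0 <= r -> - r <= y <= r ->
  expR (eta * y) * (2 * Num.sqrt (r ^+ 2 - y ^+ 2)) ^+ n <=
  (n`!%:R * (2 / eta) ^+ n * expR (eta / 2) * 8 `^ (n%:R / 2)) *
  (expR (eta * r) * (1 + r) `^ (n%:R / 2)) * expR (eta / 2 * (y - r)).
Proof.
move=> eta0 r0 /andP[ry yr].
have t0 : 0 <= r - y by rewrite subr_ge0.
have e2 : 0 < eta / 2 by rewrite divr_gt0.
(* The 8 comes from squaring: [4 (r^2 - y^2) <= 8 r (r - y)]. The added ones keep both factors away
   from 0. *)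
have sq : 2 * Num.sqrt (r ^+ 2 - y ^+ 2) <= Num.sqrt (8 * (1 + r)) * (1 + (r - y)).
  rewrite -[leRHS]ger0_norm ?mulr_ge0 ?sqrtr_ge0//; last by lra.
  rewrite -[leLHS]ger0_norm ?mulr_ge0 ?sqrtr_ge0//.
  rewrite -ler_sqr ?nnegrE// !real_normK ?num_real// !exprMn.
  have [ge|lt] := leP 0 (r ^+ 2 - y ^+ 2); last first.
    by rewrite (ltr0_sqrtr lt) expr0n mulr0 mulr_ge0// sqr_ge0.
  rewrite !sqr_sqrtr//; last by lra.
  have h1 : 0 <= (r - y) * (r - y) by rewrite mulr_ge0.
  have h2 : 0 <= r * (1 + (r - y) + (r - y) ^+ 2).
    by rewrite mulr_ge0// addr_ge0 ?sqr_ge0//; lra.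
  have -> : 8 * (1 + r) * (1 + (r - y)) ^+ 2 = 2 ^+ 2 * (r ^+ 2 - y ^+ 2) +
    (4 * ((r - y) * (r - y)) + 8 * (r * (1 + (r - y) + (r - y) ^+ 2))
      + 8 * (1 + (r - y)) ^+ 2) by ring.
  by rewrite lerDl addr_ge0 ?mulr_ge0 ?sqr_ge0// addr_ge0// mulr_ge0.
apply: (@le_trans _ _ (expR (eta * y) * (Num.sqrt (8 * (1 + r)) * (1 + (r - y))) ^+ n)).
  by rewrite ler_wpM2l ?expR_ge0// lerXn2r// nnegrE ?mulr_ge0 ?sqrtr_ge0//; lra.
rewrite exprMn.
have -> : Num.sqrt (8 * (1 + r)) ^+ n = 8 `^ (n%:R / 2) * (1 + r) `^ (n%:R / 2).
  have r1 : 0 <= 1 + r by lra.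
  rewrite -powRM// -powR12_sqrt ?mulr_ge0//.
  by rewrite -powR_mulrn ?powR_ge0// -powRrM [2^-1 * _]mulrC.
(* Of the decay [expR (- eta * (r - y))] of the weight away from the pole, one half absorbs this
   polynomial factor and the other half remains for the integration in [y]. *)
have tn : (1 + (r - y)) ^+ n <=
    n`!%:R * (2 / eta) ^+ n * (expR (eta / 2) * expR (eta / 2 * (r - y))).
  rewrite -expRD -[X in expR (X + _)]mulr1 -mulrDr.
  have z0 : 0 <= eta / 2 * (1 + (r - y)) by rewrite mulr_ge0 ?(ltW e2)//; lra.
  have := exprn_le_expR n z0; rewrite exprMn => /(ler_wpM2l (_ : 0 <= (2 / eta) ^+ n)).
  rewrite mulrA -exprMn => /(_ _)/wrap[|].
    by rewrite exprn_ge0// divr_ge0// ltW.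
  have -> : 2 / eta * (eta / 2) = 1 by field; rewrite gt_eqF.
  by rewrite expr1n mul1r => /le_trans; apply; rewrite mulrA [_ ^+ n * _]mulrC.
set a := 8 `^ _; set q := (1 + r) `^ _.
have aq0 : 0 <= expR (eta * y) * (a * q) by rewrite mulr_ge0 ?expR_ge0 ?mulr_ge0 ?powR_ge0.
rewrite mulrA (le_trans (ler_wpM2l aq0 tn))// le_eqVlt; apply/orP; left; apply/eqP.
have e : expR (eta * y) * expR (eta / 2 * (r - y)) =
    expR (eta * r) * expR (eta / 2 * (y - r)).
  by rewrite -!expRD; congr expR; field.
transitivity (n`!%:R * (2 / eta) ^+ n * expR (eta / 2) * a * q *
  (expR (eta * y) * expR (eta / 2 * (r - y)))); first by ring.
by rewrite e; ring.
Qed.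

Lemma integral_expR_slice (k r : R) : 0 < k -> 0 <= r ->
  (\int[mu]_(y in `[(- r)%R, r]) (expR (k * (y - r)))%:E <= (k^-1)%:E)%E.
Proof.
move=> k0 r0.
have d : primitive_on (- r) r (fun y => k^-1 * expR (k * (y - r)))
    (fun y => expR (k * (y - r))).
  apply: eq_primitive_on (primitive_onZ k^-1 (primitive_on_expR (primitive_onZ k
    (primitive_onB (primitive_on_id (- r) r) (primitive_on_cst (- r) r r))))) => y _.
  by rewrite /= subr0 mulr1 mulrA mulVf ?mul1r// gt_eqF.
have c : {within `[- r, r], continuous (fun y => expR (k * (y - r)))}.
  have [+ _] := primitive_on_expR (primitive_onZ k
    (primitive_onB (primitive_on_id (- r) r) (primitive_on_cst (- r) r r))).
  exact.
have rr : - r <= r by lra.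
have := Rintegral_primitive_on rr c d.
rewrite subrr mulr0 expR0 mulr1 /Rintegral => H.
rewrite -[leLHS]fineK; last first.
  exact/integrable_fin_num/within_continuous_integrable.
by rewrite lee_fin H gerBl mulr_ge0 ?expR_ge0// invr_ge0 ltW.
Qed.

(** The weight concentrates on the cap of bounded thickness at [x_0 = r], whose slices have width of
    order [sqrt r]; this is why the power is [n / 2], with [n] the dimension of the slices. By
    Tonelli it suffices to enclose each slice in a cube. *)
Lemma integral_expw_eball n (eta : R) : 0 < eta -> exists2 C, 0 < C &
  forall r, 0 <= r -> (\int[leb n.+1]_(x in eball r) (expw eta x)%:E <=
    (C * (expR (eta * r) * (1 + r) `^ (n%:R / 2)))%:E)%E.
Proof.
move=> eta0.
have e2 : 0 < eta / 2 by rewrite divr_gt0.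
set c := n`!%:R * (2 / eta) ^+ n * expR (eta / 2) * 8 `^ (n%:R / 2).
have c0 : 0 < c.
  by rewrite !mulr_gt0 ?expR_gt0 ?powR_gt0 ?ltr0n ?fact_gt0 ?exprn_gt0 ?divr_gt0.
exists (c * (eta / 2)^-1) => [|r r0]; first by rewrite mulr_gt0// invr_gt0.
set q := expR (eta * r) * (1 + r) `^ (n%:R / 2).
have q0 : 0 <= q by rewrite mulr_ge0 ?expR_ge0 ?powR_ge0.
have mexpw : measurable_fun setT (expw eta : 'rV[R]_n.+1 -> R).
  by apply: smooth_class_measurable; exact: smooth_class_expw.
pose f : 'rV[R]_n.+1 -> \bar R := (fun x => (expw eta x)%:E) \_ (eball r).
have mf : measurable_fun setT f.
  apply/(measurable_restrictT _ _).1; first exact: measurable_eball.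
  by apply: measurable_funTS; exact/measurable_EFinP.
have f0 x : (0 <= f x)%E.
  by rewrite /f patchE; case: ifP => // _; rewrite lee_fin expR_ge0.
rewrite integral_mkcond ge0_integral_rV_cons//.
pose s (y : R) := Num.sqrt (r ^+ 2 - y ^+ 2).
have s0 y : 0 <= s y by exact: sqrtr_ge0.
pose g (y : R) := c * q * expR (eta / 2 * (y - r)).
have cE : continuous (fun y => expR (eta / 2 * (y - r))).
  move=> y; apply: (cvg_comp (fun y => eta / 2 * (y - r)) (@expR R)); last exact: continuous_expR.
  apply: cvgM; first exact: cvg_cst.
  by apply: cvgB; [exact: cvg_id|exact: cvg_cst].
have mg : measurable_fun setT g.
  by apply: continuous_measurable_fun => y; apply: cvgM; [exact: cvg_cst|exact: cE].
have cq0 : 0 <= c * q by rewrite mulr_ge0// ltW.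
have g0 y : 0 <= g y by rewrite mulr_ge0 ?expR_ge0.
have consE y (x : 'rV[R]_n) : f (rV_cons (y, x)) <> 0%E ->
    - r <= y <= r /\ rV_box (s y) x.
  rewrite /f patchE; case: ifPn => // /set_mem + _.
  rewrite /eball/= big_ord_recl !mxE unlift_none/= => ltr.
  have {}ltr : y ^+ 2 + \sum_(i < n) x ord0 i ^+ 2 <= r ^+ 2.
    move: ltr; under eq_bigr do rewrite mxE liftK/=.
    rewrite -{1}(ger0_norm r0) -sqrtr_sqr => /ltW; rewrite ler_sqrt ?sqr_ge0//.
  have S0 : 0 <= \sum_(i < n) x ord0 i ^+ 2 by rewrite sumr_ge0// => i _; exact: sqr_ge0.
  split.
    rewrite -ler_norml -(ger0_norm r0) -ler_sqr ?nnegrE// !real_normK ?num_real//.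
    by lra.
  move=> i; rewrite -sqrtr_sqr ler_sqrt; last by lra.
  have : x ord0 i ^+ 2 <= \sum_(i < n) x ord0 i ^+ 2.
    by rewrite (bigD1 i)//= lerDl sumr_ge0// => j _; exact: sqr_ge0.
  by lra.
apply: (@le_trans _ _ (\int[mu]_(y in `[(- r)%R, r]) (g y)%:E)%E).
  rewrite [leRHS]integral_mkcond; apply: ge0_le_integral => //=.
  - by move=> y _; apply: integral_ge0 => x _; exact: f0.
  - exact: (measurable_int_rV_cons mf f0).
  - apply/(measurable_restrictT _ _).1 => //.
    by apply: measurable_funTS; exact/measurable_EFinP.
  - move=> y _; rewrite patchE; case: ifPn => [/set_mem/=|/negP yr]; last first.
      rewrite integral0_eq// => x _; apply: contrapT => /consE[yr' _].
      by apply: yr; apply/mem_set; rewrite /= in_itv.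
    rewrite in_itv/= => yr.
    apply: (@le_trans _ _ (\int[leb n]_x ((expR (eta * y))%:E * (\1_(rV_box (s y)) x)%:E))%E).
      apply: ge0_le_integral => //=.
      + have mc : measurable_fun (setT : set (measurableTypeR R * 'rV[R]_n)%type)
            (@rV_cons R n) by exact: measurable_rV_cons.
        exact: (measurableT_comp mf (measurableT_comp mc (pair1_measurable y))).
      + apply: measurable_funeM; apply/measurable_EFinP/measurable_indic.
        exact: measurable_rV_box.
      + move=> x _; rewrite -/(f (rV_cons (y, x))).
        have [->|/eqP fx] := eqVneq (f (rV_cons (y, x))) 0%E.
          by rewrite mule_ge0// lee_fin expR_ge0.
        have [_ xs] := consE _ _ fx.
        rewrite indicE mem_set// mule1 /f patchE; case: ifP => _.
          by rewrite /expw mxE unlift_none.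
        by rewrite lee_fin expR_ge0.
    rewrite ge0_integralZl//=; last first.
      by apply/measurable_EFinP/measurable_indic; exact: measurable_rV_box.
    rewrite integral_indic//; last exact: measurable_rV_box.
    rewrite setIT [X in (_ * X)%E](lebesgue_rV_cube n (s0 y)) -EFinM lee_fin.
    exact: slice_bound.
rewrite /g; under eq_integral do rewrite EFinM.
rewrite ge0_integralZl//=; last first.
  by apply/measurable_EFinP; apply: measurable_funTS; exact: continuous_measurable_fun.
apply: (@le_trans _ _ ((c * q)%:E * ((eta / 2)^-1)%:E)%E).
  by rewrite lee_wpmul2l ?lee_fin//; exact: integral_expR_slice.
by rewrite -EFinM lee_fin mulrAC.
Qed.

End ball_volume.

Section Rintegral_ae.
Context d (T : measurableType d) (R : realType) (mu : {measure set T -> \bar R}).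
Implicit Types f g : T -> R.

Lemma ae_eq_Rintegral f g : measurable_fun setT f -> measurable_fun setT g ->
  {ae mu, forall x, f x = g x} -> \int[mu]_x f x = \int[mu]_x g x.
Proof.
move=> mf mg fg; rewrite /Rintegral; congr fine.
apply: ae_eq_integral => //; try exact/measurable_EFinP.
by apply: filterS fg => x fgx _ /=; rewrite fgx.
Qed.

Lemma Rintegral_sum_integrable (I : Type) (r : seq I) (F : I -> T -> R) :
  (forall i, mu.-integrable setT (EFin \o F i)) ->
  \int[mu]_x (\sum_(i <- r) F i x) = \sum_(i <- r) \int[mu]_x F i x /\
  mu.-integrable setT (EFin \o (fun x => \sum_(i <- r) F i x)).
Proof.
move=> iF; elim: r => [|i r [IH1 IH2]].
  rewrite big_nil; split.
    under eq_Rintegral do rewrite big_nil.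
    by rewrite Rintegral_cst// mul0r.
  rewrite (_ : _ \o _ = cst 0%E); first exact: integrable0.
  by apply/funext => x /=; rewrite big_nil.
have E x : \sum_(j <- i :: r) F j x = F i x + \sum_(j <- r) F j x by rewrite big_cons.
split.
  under eq_Rintegral do rewrite big_cons.
  by rewrite RintegralD// big_cons IH1.
rewrite (_ : _ \o _ = (EFin \o F i) \+ (EFin \o (fun x => \sum_(j <- r) F j x)%R))%E.
  exact: integrableD.
by apply/funext => x /=; rewrite E EFinD.
Qed.

Lemma Rintegral_sqr_eq0 f : f \in Lfun mu 2%:E -> \int[mu]_x (f x * f x) = 0 ->
  {ae mu, forall x, f x = 0}.
Proof.
move=> f2 f0; have iff := Lfun2_integrableM f2 f2.
have mf := Lfun2_measurable f2.
have : (\int[mu]_x `|(f x * f x)%:E| = 0)%E.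
  under eq_integral do rewrite gee0_abs ?lee_fin -?expr2 ?sqr_ge0//.
  rewrite -[LHS]fineK; first by congr (_%:E).
  exact: integrable_fin_num.
move=> /(ae_eq_integral_abs mu measurableT _).1 => /(_ _)/wrap[|].
  by apply/measurable_EFinP; exact: measurable_funM.
apply: filterS => x /(_ Logic.I) /= [] /eqP.
by rewrite mulf_eq0 orbb => /eqP.
Qed.

End Rintegral_ae.

Section L2_support.
Context {R : realType} {n : nat}.
Local Notation leb := (@lebesgue_rV R n).
Implicit Types (f g psi : 'rV[R]_n -> R) (W : set 'rV[R]_n).

Lemma CS_L2norm f g : f \in Lfun leb 2%:E -> g \in Lfun leb 2%:E ->
  `|\int[leb]_x (f x * g x)| <= L2norm f * L2norm g.
Proof. exact: Cauchy_Schwarz_Rintegral. Qed.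

Lemma restrict_Lfun2 f W : measurable W -> f \in Lfun leb 2%:E ->
  (fun x => f x * \1_W x) \in Lfun leb 2%:E.
Proof.
move=> mW f2; have mf := Lfun2_measurable f2.
have mfW : measurable_fun setT (fun x => f x * \1_W x).
  by apply: measurable_funM => //; exact: measurable_indic.
rewrite inE; apply/andP; split; rewrite inE//=.
have := Lfun2_fin f2; rewrite /finite_norm unlock.
have lt0 : (0 <= \int[leb]_x (`|(EFin \o f) x| `^ 2))%E.
  by apply: integral_ge0 => x _; exact: poweR_ge0.
move=> /(poweR_lty 2); rewrite -poweRrM mulVf// poweRe1// => fin.
apply: poweR_lty; apply: le_lt_trans fin.
apply: ge0_le_integral => //=.
- apply/measurable_EFinP; apply: (measurableT_comp (measurable_powR _)) => //.
  exact: measurableT_comp.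
- apply/measurable_EFinP; apply: (measurableT_comp (measurable_powR _)) => //.
  exact: measurableT_comp.
move=> x _; rewrite lee_fin; apply: ge0_ler_powR; rewrite ?nnegrE//.
rewrite normrM indicE; case: (x \in W); first by rewrite normr1 mulr1.
by rewrite normr0 mulr0.
Qed.

(* Tested against [w 1_W], the approximants contribute nothing. *)
Lemma L2_limit_ae_eq0 (q : R -> 'rV[R]_n -> R) (w : 'rV[R]_n -> R) W
    (F : set_system R) : ProperFilter F -> measurable W -> w \in Lfun leb 2%:E ->
  (\forall s \near F, q s \in Lfun leb 2%:E /\
    {ae leb, forall x, W x -> q s x = 0}) ->
  L2norm (fun x => q s x - w x) @[s --> F] --> (0 : R) ->
  {ae leb, forall x, W x -> w x = 0}.
Proof.
move=> FF mW w2 qF qw.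
pose g x := w x * \1_W x.
have g2 : g \in Lfun leb 2%:E by exact: restrict_Lfun2.
have le s : q s \in Lfun leb 2%:E /\ {ae leb, forall x, W x -> q s x = 0} ->
    \int[leb]_x (g x * g x) <= L2norm (fun x => q s x - w x) * L2norm g.
  move=> [qs2 qs0]; have qw2 := Lfun2B qs2 w2.
  have mg := Lfun2_measurable g2; have mqw := Lfun2_measurable qw2.
  rewrite (_ : \int[leb]_x (g x * g x) = - \int[leb]_x ((q s x - w x) * g x)).
    by apply: le_trans (ler_norm _) _; rewrite normrN; exact: CS_L2norm.
  rewrite -mulN1r -RintegralZl//; last exact: Lfun2_integrableM.
  apply: ae_eq_Rintegral.
  - exact: measurable_funM.
  - by apply: measurable_funM => //; exact: measurable_funM.
  apply: filterS qs0 => x qx; rewrite /g indicE.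
  have [/set_mem/qx ->|] := boolP (x \in W); rewrite ?mulr1 ?mulr0//; ring.
have gg0 : 0 <= \int[leb]_x (g x * g x).
  by apply: Rintegral_ge0 => x _; rewrite -expr2 sqr_ge0.
have : \int[leb]_x (g x * g x) <= 0.
  rewrite -[X in _ <= X](mul0r (L2norm g)).
  apply: (cvgr_to_ge (cvgM qw (cvg_cst (L2norm g)))).
  by apply: filterS qF => s; exact: le.
move=> gle0; have /(Rintegral_sqr_eq0 g2) : \int[leb]_x (g x * g x) = 0.
  by apply/eqP; rewrite eq_le gle0.
by apply: filterS => x + Wx; rewrite /g indicE mem_set// mulr1.
Qed.

End L2_support.

(** * The weighted mean of an energy solution *)

(** The power function is differentiable at positive arguments only; at the origin [|z|^p <= |z|]
    for [|z| <= 1] takes over. *)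
Lemma continuous_abs_powR (R : realType) (p : R) : 1 <= p ->
  continuous (fun y : R => `|y| `^ p).
Proof.
move=> p1 y; have p0 : 0 < p by exact: lt_le_trans p1.
have [->|y0] := eqVneq y 0.
  have n0 (r : R) : 0 < r -> \forall z \near (0 : R), `|z| <= r by exact: nbhs0_le.
  rewrite /continuous_at normr0 powR0 ?gt_eqF//; apply/cvgr0Pnorm_le => e e0.
  near=> z; rewrite ger0_norm ?powR_ge0//.
  have ze : `|z| <= e by near: z; exact: n0 e0.
  have z1 : `|z| <= 1 by near: z; exact: n0 ltr01.
  have [->|z0] := eqVneq z 0; first by rewrite normr0 powR0 ?gt_eqF// ltW.
  by apply: le_trans ze; apply: ge1r_powR; rewrite ?normr_gt0 ?z0.
have ny : 0 < `|y| by rewrite normr_gt0.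
have [+ _] := is_derive1_powR p ny.
move=> /derivable1_diffP/differentiable_continuous cp.
by apply: (cvg_comp (fun z : R => `|z|) (fun z : R => z `^ p) _ cp); exact: norm_continuous.
Unshelve. all: by end_near. Qed.

Lemma measurable_time_itv (R : realType) (T : \bar R) :
  measurable (time_itv T : set (measurableTypeR R)).
Proof.
case: T => [r||].
- rewrite (_ : time_itv _ = `[0, r[%classic); first exact: measurable_itv.
  apply/seteqP; split=> t; rewrite /time_itv/= in_itv/= lte_fin.
    by move=> [-> ->].
  by move=> /andP[].
- rewrite (_ : time_itv _ = `[0, +oo[%classic); first exact: measurable_itv.
  apply/seteqP; split=> t; rewrite /time_itv/= in_itv/= ltry andbT.
    by move=> [].
  by [].
- rewrite (_ : time_itv _ = set0); first exact: measurable0.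
  by apply/seteqP; split=> // t [].
Qed.

Section energy_functional.
Context {R : realType} {n : nat}.
Local Notation leb := (@lebesgue_rV R n.+1).
Local Notation mu := (@lebesgue_measure R).

Lemma smooth_supp_Lfun2 r (f : 'rV[R]_n.+1 -> R) :
  smooth_supp r f -> f \in Lfun leb 2%:E.
Proof.
move=> [sf f0]; have [C fC] := smooth_class_bounded sf f0.
exact: bounded_box_Lfun2 (smooth_class_measurable sf) f0 fC.
Qed.

Lemma L2norm_ge0 (f : 'rV[R]_n.+1 -> R) : 0 <= L2norm f.
Proof. by rewrite fine_ge0// Lnorm_ge0. Qed.

Lemma L2norm_le_H1norm (f : 'rV[R]_n.+1 -> R) : L2norm f <= H1norm f.
Proof.
rewrite /H1norm -[leLHS]ger0_norm ?L2norm_ge0// -sqrtr_sqr ler_wsqrtr//.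
by rewrite lerDl sumr_ge0// => i _; exact: sqr_ge0.
Qed.

Lemma weak_partialP i (f : 'rV[R]_n.+1 -> R) : in_H1 f ->
  weak_partial i f \in Lfun leb 2%:E /\ is_weak_partial i f (weak_partial i f).
Proof.
move=> [_ /(_ i)[g g2 fg]]; rewrite /weak_partial.
by case: xgetP => [h ->//|/(_ g)]; case.
Qed.

Lemma eball_subset r s : r <= s -> eball r `<=` (eball s : set 'rV[R]_n.+1).
Proof. by move=> rs x; rewrite /eball/= => /lt_le_trans; exact. Qed.

Lemma eball_rV_coord_lt r (x : 'rV[R]_n.+1) i : eball r x -> `|x ord0 i| < r.
Proof.
rewrite /eball/=; apply: le_lt_trans; rewrite -sqrtr_sqr ler_wsqrtr//.
by rewrite (bigD1 i)//= lerDl sumr_ge0// => j _; exact: sqr_ge0.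
Qed.

Variables (b m : R -> R) (p rho eps eta T2 : R) (u1 : 'rV[R]_n.+1 -> R) (T : \bar R).
Variables u ut : R -> 'rV[R]_n.+1 -> R.
Hypothesis rho0 : 0 < rho.
Hypothesis T20 : 0 < T2.
Hypothesis T2T : (T2%:E < T)%E.
Hypothesis u_H1 : C0_H1 T u.
Hypothesis u_ut : deriv_L2 T u ut.
Hypothesis ut_L2 : C0_L2 T ut.
Hypothesis u_supp : forall t, time_itv T t -> ess_supp (u t) `<=` eball (rho + t).
Hypothesis weak : forall t Phi, time_itv T t -> spacetime_test_fun T Phi ->
  weak_form b m p eps u1 u ut Phi t.

(** The velocity is confined to radius [rho + t + 1], strictly less than [A] for [t <= T2]. Hence
    the cut-off weight agrees with the exponential in a whole neighbourhood of each point of that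
    ball, and so do its derivatives. *)
Let A := rho + T2 + 2.
Let psi : 'rV[R]_n.+1 -> R := expw_cut eta A.

Let psi_supp : smooth_supp (A + 1) psi. Proof. exact: smooth_supp_expw_cut. Qed.
Let psi2 : psi \in Lfun leb 2%:E. Proof. exact: smooth_supp_Lfun2 psi_supp. Qed.

Let tT t : 0 <= t <= T2 -> time_itv T t.
Proof.
by move=> /andP[t0 tT2]; split=> //; rewrite (le_lt_trans _ T2T)// lee_fin.
Qed.

Let u2 t : time_itv T t -> u t \in Lfun leb 2%:E.
Proof. by move=> /u_H1[[]]. Qed.

Let ut2 t : time_itv T t -> ut t \in Lfun leb 2%:E.
Proof. by move=> /ut_L2[]. Qed.

Let u_ae0 t : time_itv T t -> {ae leb, forall x, ~ eball (rho + t) x -> u t x = 0}.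
Proof.
move=> tt; apply: ae_eq0_eball; last exact: u_supp.
by case: tt => t0 _; rewrite ltr_pwDl.
Qed.

Let quot2 s t : time_itv T s -> time_itv T t ->
  (fun x => (u s x - u t x) / (s - t)) \in Lfun leb 2%:E.
Proof.
move=> sT tT'; have := Lfun2B (u2 sT) (u2 tT') => d2.
have := Lfun2_scaleD (s - t)^-1 d2 (Lfun2B (u2 sT) (u2 sT)).
rewrite (_ : (fun x => _ + _) = (fun x => (u s x - u t x) / (s - t)))//.
by apply/funext => x; rewrite subrr addr0 mulrC.
Qed.

(** [ut t] is the L2 limit of difference quotients, and for [t < s < t + 1] both [u s] and [u t]
    vanish outside radius [rho + t + 1]. The extra 1 spares a passage to the limit in the radius and
    only affects constants; quotients from the right also cover [t = 0]. *)
Lemma velocity_ae_eq0 t : 0 <= t <= T2 ->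
  {ae leb, forall x, ~ eball (rho + t + 1) x -> ut t x = 0}.
Proof.
move=> tT2; have tt := tT tT2.
have near_t : \forall s \near t^'+, time_itv T s /\ s < t + 1.
  have [e e0 te] : exists2 e : R, 0 < e & ((t + e)%:E <= T)%E.
    move: T2T; case: T => [r||//]; last by exists 1 => //; rewrite leey.
    rewrite lte_fin => T2r; exists (r - T2); first by rewrite subr_gt0.
    by rewrite lee_fin; case/andP: tT2; lra.
  near=> s; split; last by near: s; apply: nbhs_right_lt; rewrite ltrDl.
  split; first by rewrite (le_trans tt.1)// ltW.
  by rewrite (lt_le_trans _ te)// lte_fin; near: s; apply: nbhs_right_lt; rewrite ltrDl.
apply: (L2_limit_ae_eq0 (q := fun s x => (u s x - u t x) / (s - t)) (F := t^'+)).
- by apply: measurableC; exact: measurable_eball.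
- exact: ut2.
- apply: filterS near_t => s [sT st]; split; first exact: quot2.
  have := u_ae0 sT; have := u_ae0 tt; apply: filterS2 => x utx usx xn.
  have sub r : r <= rho + t + 1 -> ~ eball r x.
    by move=> rt xr; apply: xn; exact: eball_subset rt x xr.
  by rewrite utx ?usx ?subrr ?mul0r//; apply: sub; lra.
- apply: cvg_trans (u_ut tt); apply: cvg_app => P.
  move=> tP.
  have {}tP : nbhs t [set s | s != t -> time_itv T s -> P s] by exact: tP.
  have gt : \forall s \near t^'+, t < s by exact: nbhs_right_gt.
  have {}tP : \forall s \near t^'+, s != t -> time_itv T s -> P s.
    exact: cvg_within tP.
  near=> s.
  have sP : s != t -> time_itv T s -> P s by near: s; exact: tP.
  have ts : t < s by near: s; exact: gt.
  have [sT _] : time_itv T s /\ s < t + 1 by near: s; exact: near_t.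
  by apply: sP => //; rewrite gt_eqF.
Unshelve. all: by end_near. Qed.

Definition energy_mean (w : R -> 'rV[R]_n.+1 -> R) (t : R) : R :=
  \int[leb]_x (w t x * psi x).

Let meanB w s t : w s \in Lfun leb 2%:E -> w t \in Lfun leb 2%:E ->
  energy_mean w s - energy_mean w t = \int[leb]_x ((w s x - w t x) * psi x).
Proof.
move=> ws wt; rewrite /energy_mean -RintegralB//; try exact: Lfun2_integrableM.
by apply: eq_Rintegral => x _; rewrite mulrBl.
Qed.

Let mean_cvg w t (D : set R) (bound : R -> R) :
  (forall s, D s -> w s \in Lfun leb 2%:E) -> w t \in Lfun leb 2%:E ->
  (forall s, D s -> L2norm (fun x => w s x - w t x) <= bound s) ->
  bound s @[s --> within D (nbhs t)] --> (0 : R) ->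
  energy_mean w s @[s --> within D (nbhs t)] --> energy_mean w t.
Proof.
move=> w2 wt2 wb b0.
apply/subr_cvg0; apply/cvgr0Pnorm_le => e e0.
(* The added 1 avoids a division by zero. *)
have e' : 0 < e / (L2norm psi + 1) by rewrite divr_gt0// ltr_pwDr// L2norm_ge0.
have /cvgr0Pnorm_le/(_ _ e') be := b0.
near=> s.
have Ds : D s by near: s; exact: withinT.
have bs : `|bound s| <= e / (L2norm psi + 1) by near: s; exact: be.
rewrite meanB//; last exact: w2.
have d2 := Lfun2B (w2 s Ds) wt2.
apply: (le_trans (CS_L2norm d2 psi2)).
have bse : bound s <= e / (L2norm psi + 1).
  by apply: le_trans bs; exact: ler_norm.
apply: (@le_trans _ _ (e / (L2norm psi + 1) * (L2norm psi + 1))); last first.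
  by rewrite mulfVK// gt_eqF// ltr_pwDr// L2norm_ge0.
apply: ler_pM; rewrite ?L2norm_ge0//; last by rewrite lerDl.
exact: le_trans (wb s Ds) bse.
Unshelve. all: by end_near. Qed.

Let in_itvT t : `[0, T2]%classic t -> 0 <= t <= T2. Proof. by rewrite /= in_itv. Qed.

Lemma continuous_energy_mean : {within `[0, T2], continuous (energy_mean u)}.
Proof.
apply/subspace_continuousP => t /in_itvT tT2; have tt := tT tT2.
have sub : within (time_itv T) (nbhs t) `<=` within `[0, T2]%classic (nbhs t).
  move=> P; rewrite /within/=; apply: filterS => s sP sT2.
  exact/sP/tT/in_itvT.
apply: cvg_trans (mean_cvg (D := time_itv T)
  (bound := fun s => H1norm (u s \- u t)) _ _ _ _) => //.
- exact: cvg_app sub.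
- exact: u2.
- by move=> s _; exact: L2norm_le_H1norm.
- by case: (u_H1 tt).
Qed.

Lemma continuous_energy_velocity : {within `[0, T2], continuous (energy_mean ut)}.
Proof.
apply/subspace_continuousP => t /in_itvT tT2; have tt := tT tT2.
have sub : within (time_itv T) (nbhs t) `<=` within `[0, T2]%classic (nbhs t).
  move=> P; rewrite /within/=; apply: filterS => s sP sT2.
  exact/sP/tT/in_itvT.
apply: cvg_trans (mean_cvg (D := time_itv T)
  (bound := fun s => L2norm (ut s \- ut t)) _ _ _ _) => //.
- exact: cvg_app sub.
- exact: ut2.
- by case: (ut_L2 tt).
Qed.

Lemma is_derive_energy_mean t : 0 < t < T2 ->
  is_derive t 1 (energy_mean u) (energy_mean ut t).
Proof.
move=> /andP[t0 tT2]; have tt : time_itv T t by apply: tT; rewrite !ltW.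
have nT : \forall s \near t^', time_itv T s.
  apply: nbhs_dnbhs; near=> s; apply: tT; apply/andP; split; apply: ltW; near: s.
    exact: lt_nbhsr.
  exact: lt_nbhsl.
have lim : (energy_mean u s - energy_mean u t) / (s - t) @[s --> t^'] -->
    energy_mean ut t.
  apply/subr_cvg0; apply/cvgr0Pnorm_le => e e0.
  have e' : 0 < e / (L2norm psi + 1) by rewrite divr_gt0// ltr_pwDr// L2norm_ge0.
  have /cvgr0Pnorm_le/(_ _ e') be := u_ut tt.
  have {}be : \forall s \near t^', time_itv T s ->
    `|L2norm (fun x => (u s x - u t x) / (s - t) - ut t x)| <= e / (L2norm psi + 1).
    exact: be.
  near=> s.
  have sT : time_itv T s by near: s; exact: nT.
  have : `|L2norm (fun x => (u s x - u t x) / (s - t) - ut t x)| <= e / (L2norm psi + 1).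
    by move: sT; near: s; exact: be.
  rewrite ger0_norm ?L2norm_ge0// => bs.
  have -> : (energy_mean u s - energy_mean u t) / (s - t) - energy_mean ut t =
      \int[leb]_x (((u s x - u t x) / (s - t) - ut t x) * psi x).
    rewrite meanB ?u2// mulrC -RintegralZl//; last first.
      exact: Lfun2_integrableM (Lfun2B (u2 sT) (u2 tt)) psi2.
    rewrite -RintegralB//.
    - by apply: eq_Rintegral => x _; ring.
    - have := Lfun2_integrableM (quot2 sT tt) psi2.
      apply: eq_integrable => // x _ /=; congr (_%:E); ring.
    - exact: Lfun2_integrableM (ut2 tt) psi2.
  apply: (le_trans (CS_L2norm (Lfun2B (quot2 sT tt) (ut2 tt)) psi2)).
  apply: (@le_trans _ _ (e / (L2norm psi + 1) * (L2norm psi + 1))); last first.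
    by rewrite mulfVK// gt_eqF// ltr_pwDr// L2norm_ge0.
  by apply: ler_pM; rewrite ?L2norm_ge0// lerDl.
apply/is_derive1_caratheodory.
exists (fun s => if s == t then energy_mean ut t
  else (energy_mean u s - energy_mean u t) / (s - t)); split; last by rewrite eqxx.
  move=> s; case: eqP => [->|/eqP]; first by rewrite !subrr mulr0.
  by rewrite -subr_eq0 => /divfK->.
apply/continuous_withinNx; rewrite eqxx.
apply: cvg_trans lim; apply: near_eq_cvg; near=> s.
by rewrite ifN//; near: s; exact: nbhs_dnbhs_neq.
Unshelve. all: by end_near. Qed.

Let ball_lt t x : 0 <= t <= T2 -> eball (rho + t + 1) x ->
  forall i : 'I_n.+1, `|x ord0 i| < A.
Proof.
move=> /andP[_ tT2] xt i; rewrite (lt_le_trans (eball_rV_coord_lt i xt))// /A.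
lra.
Qed.

Let psiE t x : 0 <= t <= T2 -> eball (rho + t + 1) x -> psi x = expw eta x.
Proof.
by move=> tT2 xt; apply: expw_cutE => i; apply: ltW; exact: ball_lt xt i.
Qed.

(** Each [partial i psi] is itself a test function, so the definition of weak derivative moves the
    gradient onto it and produces the Laplacian of [psi]. On the support of [u t] this is [eta^2]
    times the weight. *)
Lemma weak_laplacian t : 0 <= t <= T2 ->
  \int[leb]_x (\sum_i weak_partial i (u t) x * partial i psi x) =
  - (eta ^+ 2 * energy_mean u t).
Proof.
move=> tT2; have tt := tT tT2; have [uH1 _] := u_H1 tt.
have ds i := smooth_supp_partial i psi_supp.
have dds i := smooth_supp_partial i (ds i).
have iwp i : leb.-integrable setT
    (EFin \o (fun x => weak_partial i (u t) x * partial i psi x)).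
  by apply: Lfun2_integrableM (smooth_supp_Lfun2 (ds i)); have [] := weak_partialP i uH1.
have iud i : leb.-integrable setT
    (EFin \o (fun x => u t x * partial i (partial i psi) x)).
  exact: Lfun2_integrableM (u2 tt) (smooth_supp_Lfun2 (dds i)).
have [-> _] := Rintegral_sum_integrable (index_enum 'I_n.+1) iwp.
rewrite (eq_bigr (fun i => - \int[leb]_x (u t x * partial i (partial i psi) x))).
  rewrite sumrN; congr (- _).
  have [<- iS] := Rintegral_sum_integrable (index_enum 'I_n.+1) iud.
  rewrite /energy_mean -RintegralZl//; last exact: Lfun2_integrableM (u2 tt) psi2.
  have mu_ := Lfun2_measurable (u2 tt); have mpsi := Lfun2_measurable psi2.
  apply: ae_eq_Rintegral.
  - by apply/measurable_EFinP; case/integrableP : iS.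
  - by apply: measurable_funM => //; exact: measurable_funM.
  have := u_ae0 tt; apply: filterS => x ux.
  rewrite -mulr_sumr; have [xt|/ux ->] := pselect (eball (rho + t) x); last by rewrite !mul0r mulr0.
  have xt1 : eball (rho + t + 1) x by apply: eball_subset xt; rewrite lerDl.
  rewrite (laplacian_expw_cut eta (ball_lt tT2 xt1)) (psiE tT2 xt1); ring.
move=> i _; have [_ wp] := weak_partialP i uH1.
by rewrite (wp _ (smooth_supp_test_fun (ds i))) opprK.
Qed.

Definition energy_source (t : R) : R := \int[leb]_x (`|ut t x| `^ p * psi x).

Hypothesis cb : {within `[0, T2], continuous b}.
Hypothesis cm : {within `[0, T2], continuous m}.

Lemma continuous_energy_force : {within `[0, T2], continuous (fun s =>
  (eta ^+ 2 - m s) * energy_mean u s - b s * energy_mean ut s)}.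
Proof.
move=> t; apply: cvgB; apply: cvgM.
- by apply: cvgB; [exact: cvg_cst|exact: cm].
- exact: continuous_energy_mean.
- exact: cb.
- exact: continuous_energy_velocity.
Qed.

Lemma energy_velocity_eq t : 0 <= t <= T2 ->
  energy_mean ut t - eps * \int[leb]_x (u1 x * psi x) =
  \int[mu]_(s in `[0, t]) ((eta ^+ 2 - m s) * energy_mean u s - b s * energy_mean ut s) +
  \int[mu]_(s in `[0, t]) energy_source s.
Proof.
move=> tT2; have tt := tT tT2; have /andP[t0' tle] := tT2.
(* Room for switching off the test function: [T2 < t0 < t1 < T] keeps it equal to [psi] on [[0, T2]]
   and its support inside [[0, T)]. *)
have [t1 T2t1 t1T] : exists2 t1, T2 < t1 & (t1%:E < T)%E.
  move: T2T; case: T => [r||//]; last by exists (T2 + 1); rewrite ?ltrDl ?ltry.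
  by rewrite lte_fin => T2r; exists ((T2 + r) / 2); rewrite ?lte_fin; lra.
pose t0 := (T2 + t1) / 2.
have t01 : t0 < t1 by rewrite /t0; lra.
have T2t0 : T2 < t0 by rewrite /t0; lra.
have PhiE s : s <= T2 -> (fun x => spacetime_cut eta A t0 t1 (s, x)) = psi.
  by move=> sT2; apply/funext => x; apply: spacetime_cutE => //; lra.
have PhiE' s x : s <= T2 -> spacetime_cut eta A t0 t1 (s, x) = psi x.
  by move=> sT2; rewrite -(PhiE s sT2).
have st2 s : s \in [set` `[0, t]] -> 0 <= s <= T2.
  by rewrite inE/= in_itv/= => /andP[-> st]; exact: le_trans tle.
have := weak tt (spacetime_cut_test_fun eta A t01 t1T); rewrite /weak_form.
rewrite [X in X - _ - _ + _ + _ = _ -> _](@eq_Rintegral _ _ _ _ _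
    (fun x => ut t x * psi x)); last by move=> x _; rewrite PhiE'.
rewrite [X in _ - eps * X - _ + _ + _ = _ -> _](@eq_Rintegral _ _ _ _ _
    (fun x => u1 x * psi x)); last first.
  by move=> x _; rewrite PhiE'// ltW.
rewrite [X in _ - X + _ + _ = _ -> _](_ : _ = 0); last first.
  rewrite (@eq_Rintegral _ _ _ _ _ (fun=> 0)) ?Rintegral_cst ?mul0r// => s /st2/andP[_ sT2].
  rewrite (@eq_Rintegral _ _ _ _ _ (fun=> 0)) ?Rintegral_cst ?mul0r// => x _.
  by rewrite spacetime_cut_derive ?mulr0//; exact: le_lt_trans T2t0.
rewrite [X in _ + X + _ = _ -> _](@eq_Rintegral _ _ _ mu _
    (fun s => - (eta ^+ 2 * energy_mean u s))); last first.
  move=> s /st2 sT2; have /andP[_ sle] := sT2.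
  transitivity (\int[leb]_x (\sum_i weak_partial i (u s) x * partial i psi x)).
    by rewrite (PhiE s sle).
  exact: weak_laplacian.
rewrite [X in _ + _ + X = _ -> _](@eq_Rintegral _ _ _ mu _
    (fun s => b s * energy_mean ut s + m s * energy_mean u s)); last first.
  move=> s /st2 sT2; have /andP[_ sle] := sT2; have sT := tT sT2.
  have i1 := Lfun2_integrableM (ut2 sT) psi2; have i2 := Lfun2_integrableM (u2 sT) psi2.
  have iZ c (w : 'rV[R]_n.+1 -> R) : leb.-integrable setT (EFin \o w) ->
      leb.-integrable setT (EFin \o (fun x => c * w x)).
    by move=> iw; exact: (integrableZl measurableT c iw).
  rewrite /energy_mean -!RintegralZl// -RintegralD//; try exact: iZ.
  by apply: eq_Rintegral => x _; rewrite PhiE'//; ring.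
rewrite [X in _ = X -> _](@eq_Rintegral _ _ _ mu _ energy_source); last first.
  move=> s /st2/andP[_ sT2]; rewrite /energy_source.
  by apply: eq_Rintegral => x _; rewrite PhiE'.
move=> eqn.
have cW f : {within `[0, T2], continuous f} -> mu.-integrable `[0, t] (EFin \o f).
  move=> cf; apply: within_continuous_integrable.
  by apply: continuous_subspaceW cf; exact: subset_itvl.
have i1 : mu.-integrable `[0, t] (EFin \o (fun s => - (eta ^+ 2 * energy_mean u s))).
  apply: cW => s; apply: cvgN; apply: cvgM; first exact: cvg_cst.
  exact: continuous_energy_mean.
have i2 : mu.-integrable `[0, t]
    (EFin \o (fun s => b s * energy_mean ut s + m s * energy_mean u s)).
  apply: cW => s; apply: cvgD; apply: cvgM; [exact: cb|
    exact: continuous_energy_velocity|exact: cm|exact: continuous_energy_mean].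
have : \int[mu]_(s in `[0, t]) ((eta ^+ 2 - m s) * energy_mean u s - b s * energy_mean ut s) =
    - (\int[mu]_(s in `[0, t]) (- (eta ^+ 2 * energy_mean u s)) +
    \int[mu]_(s in `[0, t]) (b s * energy_mean ut s + m s * energy_mean u s)).
  rewrite -RintegralD// -mulN1r -RintegralZl//; last first.
    apply: cW => s; apply: cvgD.
      apply: cvgN; apply: cvgM; [exact: cvg_cst|exact: continuous_energy_mean].
    apply: cvgD; apply: cvgM; [exact: cb|
      exact: continuous_energy_velocity|exact: cm|exact: continuous_energy_mean].
  by apply: eq_Rintegral => s _; ring.
by move: eqn; rewrite /energy_mean; lra.
Qed.

Hypothesis p1 : 1 < p.
Hypothesis ut_Lp : Lp_loc T p (fun z => ut z.1 z.2).
Variable M : R -> R.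
Hypothesis M0 : forall t, 0 <= t <= T2 -> 0 < M t.
Hypothesis M_vol : forall t, 0 <= t <= T2 ->
  (\int[leb]_(x in eball (rho + t + 1)) (expw eta x)%:E <= (M t)%:E)%E.

(** Kept extended-valued: [ut t] lies in L2, and local p-integrability in space-time does not
    exclude an infinite spatial integral at exceptional times. *)
Let esource (t : R) : \bar R := (\int[leb]_x (`|ut t x| `^ p * psi x)%:E)%E.

Let esource_ge0 t : (0 <= esource t)%E.
Proof.
by apply: integral_ge0 => x _; rewrite lee_fin mulr_ge0 ?powR_ge0// expw_cut_ge0.
Qed.

(** The convex function [a^p] lies above its tangent at [k]. The free parameter [k] is chosen in
    [esource_lower]. *)
Let young (a k : R) : 0 <= a -> 0 <= k ->
  p * k `^ (p - 1) * a <= a `^ p + (p - 1) * k `^ p.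
Proof.
move=> a0 k0; have p0 : 0 < p by exact: lt_trans p1.
have q0 : 0 < p / (p - 1) by rewrite divr_gt0// subr_gt0.
have pq : p^-1 + (p / (p - 1))^-1 = 1.
  by rewrite invf_div; field; rewrite gt_eqF.
have := conjugate_powR a0 (powR_ge0 k (p - 1)) p0 q0 pq.
rewrite -powRrM (_ : (p - 1) * (p / (p - 1)) = p); last first.
  by field; rewrite gt_eqF// subr_gt0.
move=> /(ler_wpM2l (ltW p0)).
rewrite invf_div [p * (_ + _)]mulrDr => H.
rewrite mulrAC -mulrA; apply: le_trans H _.
by rewrite le_eqVlt; apply/orP; left; apply/eqP; field; rewrite gt_eqF.
Qed.

(** Hoelder's inequality through its linearised form. Integrating [young] against the weight on the
    ball carrying [ut t] gives [p k^(p - 1) |F'| <= esource + (p - 1) k^p M]. The optimal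
    [k = |F'| / M] makes the left side [p k^p M], and [k^p M = |F'|^p M^(1 - p)] remains. An
    infinite [esource] causes no difficulty. *)
Let esource_lower t : 0 <= t <= T2 ->
  ((`|energy_mean ut t| `^ p * M t `^ (- (p - 1)))%:E <= esource t)%E.
Proof.
move=> tT2; have tt := tT tT2; have Mt := M0 tT2.
pose k := `|energy_mean ut t| / M t.
have k0 : 0 <= k by rewrite divr_ge0// ltW.
have c0 : 0 <= p * k `^ (p - 1) by rewrite mulr_ge0 ?powR_ge0//; move: p1; lra.
have d0 : 0 <= (p - 1) * k `^ p by rewrite mulr_ge0 ?powR_ge0// subr_ge0 ltW.
pose B : set 'rV[R]_n.+1 := eball (rho + t + 1).
have mB : measurable B by exact: measurable_eball.
have mut := Lfun2_measurable (ut2 tt); have mpsi := Lfun2_measurable psi2.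
have mutp : measurable_fun setT (fun x => `|ut t x| `^ p * psi x).
  apply: measurable_funM => //; apply: (measurableT_comp (measurable_powR p)).
  exact: measurableT_comp.
have mutpsi : measurable_fun setT (fun x => `|ut t x * psi x|).
  by apply: measurableT_comp => //; exact: measurable_funM.
have mexpw : measurable_fun setT (expw eta : 'rV[R]_n.+1 -> R).
  by apply: smooth_class_measurable; exact: smooth_class_expw.
have mBe : measurable_fun setT (fun x => expw eta x * \1_B x).
  by apply: measurable_funM => //; exact: measurable_indic.
have iup := Lfun2_integrableM (ut2 tt) psi2.
have le1 : ((p * k `^ (p - 1) * `|energy_mean ut t|)%:E <=
    \int[leb]_x (p * k `^ (p - 1) * `|ut t x * psi x|)%:E)%E.
  under eq_integral do rewrite EFinM.
  rewrite ge0_integralZl//=; last by apply/measurable_EFinP.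
  rewrite EFinM lee_wpmul2l ?lee_fin//.
  apply: le_trans (le_abse_integral leb measurableT (measurable_int _ iup)).
  by rewrite /energy_mean /Rintegral -abse_EFin fineK//; exact: integrable_fin_num.
have le2 : (\int[leb]_x (p * k `^ (p - 1) * `|ut t x * psi x|)%:E <=
    \int[leb]_x ((`|ut t x| `^ p * psi x)%:E +
      ((p - 1) * k `^ p)%:E * (expw eta x * \1_B x)%:E))%E.
  apply: ae_ge0_le_integral => //.
  - by move=> x _; rewrite lee_fin mulr_ge0.
  - by apply/measurable_EFinP; apply: measurable_funM.
  - move=> x _; apply: adde_ge0.
      by rewrite lee_fin mulr_ge0 ?powR_ge0 ?expw_cut_ge0.
    by apply: mule_ge0; rewrite lee_fin// mulr_ge0 ?expR_ge0.
  - apply: emeasurable_funD; first exact/measurable_EFinP.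
    by apply: measurable_funeM; exact/measurable_EFinP.
  have := velocity_ae_eq0 tT2; apply: filterS => x utx _.
  rewrite -EFinM -EFinD lee_fin indicE.
  have [/set_mem xB|xB] := boolP (x \in B).
    rewrite mulr1 (psiE tT2 xB) normrM (gtr0_norm (expw_gt0 eta x)) !mulrA -mulrDl.
    by rewrite ler_pM2r ?expw_gt0//; exact: young.
  rewrite utx; last by move=> xB'; move: xB; rewrite mem_set.
  by rewrite mul0r normr0 !mulr0 addr0 mulr_ge0 ?powR_ge0// expw_cut_ge0.
have le3 : (\int[leb]_x ((`|ut t x| `^ p * psi x)%:E +
      ((p - 1) * k `^ p)%:E * (expw eta x * \1_B x)%:E) <=
    esource t + ((p - 1) * k `^ p * M t)%:E)%E.
  rewrite ge0_integralD//; last 4 first.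
  - by move=> x _; rewrite lee_fin mulr_ge0 ?powR_ge0// expw_cut_ge0.
  - exact/measurable_EFinP.
  - by move=> x _; rewrite mule_ge0// lee_fin mulr_ge0// expR_ge0.
  - by apply: measurable_funeM; exact/measurable_EFinP.
  rewrite leeD2l// ge0_integralZl//; last 2 first.
  - exact/measurable_EFinP.
  - by move=> x _; rewrite lee_fin mulr_ge0// expR_ge0.
  rewrite [leRHS]EFinM lee_wpmul2l ?lee_fin//; apply: le_trans (M_vol tT2).
  rewrite [leRHS]integral_mkcond le_eqVlt; apply/orP; left; apply/eqP.
  apply: eq_integral => x _; rewrite patchE indicE.
  by case: (x \in _); rewrite ?mulr1 ?mulr0.
have kM : `|energy_mean ut t| = k * M t by rewrite /k divfK// gt_eqF.
have kp : `|energy_mean ut t| `^ p * M t `^ (- (p - 1)) = k `^ p * M t.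
  rewrite kM (powRM _ k0 (ltW Mt)) -mulrA -powRD; last first.
    by apply/implyP => _; rewrite gt_eqF.
  by rewrite (_ : p + - (p - 1) = 1) ?powRr1 ?(ltW Mt)//; ring.
rewrite kp; have := le_trans le1 (le_trans le2 le3).
have -> : p * k `^ (p - 1) * `|energy_mean ut t| = p * (k `^ p * M t).
  by rewrite kM -(mulr_powRB1 k0 (lt_trans ltr01 p1)); ring.
rewrite -leeBlDr// -EFinB.
by rewrite (_ : p * _ - _ = k `^ p * M t)//; ring.
Qed.

Let D : set (measurableTypeR R * 'rV[R]_n.+1)%type := `[0, T2] `*` setT.

Let source_density : measurableTypeR R * 'rV[R]_n.+1 -> \bar R :=
  (fun z => (`|ut z.1 z.2| `^ p * psi z.2)%:E) \_ D.

Let mD : measurable D. Proof. exact: measurableX. Qed.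

Let measurable_source_density : measurable_fun setT source_density.
Proof.
suff mf : measurable_fun D (fun z => (`|ut z.1 z.2| `^ p * psi z.2)%:E).
  exact: (measurable_restrictT _ mD).1 mf.
apply/measurable_EFinP; apply: measurable_funM.
  apply: (measurableT_comp (measurable_powR p)); apply: measurableT_comp => //.
  have [mut _] := ut_Lp; apply: measurable_funS mut.
    by apply: measurableX => //; exact: measurable_time_itv.
  by move=> [t x] [/= t0T _]; split=> //; apply: tT; rewrite in_itv in t0T.
apply: measurable_funTS; apply: measurableT_comp => //.
exact: Lfun2_measurable psi2.
Qed.

Let source_density_ge0 z : (0 <= source_density z)%E.
Proof.
rewrite /source_density patchE; case: ifP => // _.
by rewrite lee_fin mulr_ge0 ?powR_ge0 ?expw_cut_ge0.
Qed.

(** [psi] is bounded and vanishes outside a cube, so the integral is controlled by that of [|ut|^p]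
    over a compact subset of space-time. *)
Let int_source_density :
  (\int[(mu \x leb)%E]_z source_density z < +oo)%E.
Proof.
have [C psiC] : exists C, forall x, `|psi x| <= C.
  by have [sp p0] := psi_supp; exact: smooth_class_bounded sp p0.
have C0 : 0 <= C by exact: le_trans (psiC 0).
pose K : set (measurableTypeR R * 'rV[R]_n.+1)%type := `[0, T2] `*` rV_box (A + 1).
have mK : measurable K by apply: measurableX => //; exact: measurable_rV_box.
have [mut /(_ K)] := ut_Lp.
move=> /(_ _ _)/wrap[||intK].
- by apply: compact_setX; [exact: segment_compact|exact: compact_rV_box].
- by move=> [t x] [/= t0T _]; split=> //; apply: tT; rewrite in_itv in t0T.
have mutK : measurable_fun K (fun z => (`|ut z.1 z.2| `^ p)%:E).
  apply/measurable_EFinP; apply: (measurableT_comp (measurable_powR p)).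
  apply: measurableT_comp => //; apply: measurable_funS mut.
    by apply: measurableX => //; exact: measurable_time_itv.
  by move=> [t x] [/= t0T _]; split=> //; apply: tT; rewrite in_itv in t0T.
apply: (@le_lt_trans _ _ (\int[(mu \x leb)%E]_(z in K) (C%:E * (`|ut z.1 z.2| `^ p)%:E))%E).
  rewrite [leRHS]integral_mkcond; apply: ge0_le_integral => //.
  - exact: (measurable_restrictT _ mK).1 (measurable_funeM _ mutK).
  move=> [t x] _; rewrite /source_density !patchE.
  have [/set_mem[/= t0T _]|_] := boolP (_ \in D); last first.
    by case: ifP => // _; rewrite mule_ge0// lee_fin powR_ge0.
  have [xA|xA] := pselect (rV_box (A + 1) x).
    rewrite mem_set// -EFinM lee_fin mulrC ler_wpM2r ?powR_ge0//.
    exact: le_trans (ler_norm _) (psiC x).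
  rewrite [psi _](expw_cut_eq0 eta xA) mulr0; case: ifP => // _.
  by rewrite mule_ge0// lee_fin powR_ge0.
rewrite ge0_integralZl//.
by apply: lte_mul_pinfty; [rewrite lee_fin| |exact: intK].
Qed.

Let esource_patch s : (\int[leb]_x source_density (s, x) = (esource \_ `[0%R, T2]) s)%E.
Proof.
rewrite patchE /esource; case: ifPn => [/set_mem sT2|/negP sT2].
  apply: eq_integral => x _; rewrite /source_density patchE mem_set//.
rewrite integral0_eq// => x _; rewrite /source_density patchE ifN//.
by apply/negP => /set_mem[/= s0 _]; apply: sT2; exact/mem_set.
Qed.

Let measurable_esource : measurable_fun (`[0, T2] : set (measurableTypeR R)) esource.
Proof.
have mF := measurable_fun_fubini_tonelli_F (m2 := leb) _ measurable_source_density
  source_density_ge0.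
suff me : measurable_fun (setT : set (measurableTypeR R)) (esource \_ `[0, T2]).
  exact: (measurable_restrictT _ (measurable_itv _)).2 me.
by apply: eq_measurable_fun mF => s _; exact: esource_patch.
Qed.

Let int_esource : (\int[mu]_(s in `[0%R, T2]) esource s < +oo)%E.
Proof.
rewrite integral_mkcond; apply: le_lt_trans int_source_density.
rewrite fubini_tonelli1//.
by rewrite le_eqVlt; apply/orP; left; apply/eqP; apply: eq_integral => s _;
  rewrite -esource_patch.
Qed.

Let integrable_esource : mu.-integrable `[0, T2] esource.
Proof.
apply/integrableP; split; first exact: measurable_esource.
by under eq_integral do rewrite gee0_abs ?esource_ge0//; exact: int_esource.
Qed.

(** The real-valued integral has the default value 0 where the extended one is infinite.
    Integrability in time makes these times a null set, so the lower bound survives almost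
    everywhere. *)
Let source_esource :
  {ae mu, forall s, `[0, T2]%classic s -> (energy_source s)%:E = esource s}.
Proof.
have m02 : measurable (`[0, T2] : set (measurableTypeR R)) by exact: measurable_itv.
have := integrable_ae m02 integrable_esource.
by apply: filterS => s /[apply]; exact: fineK.
Qed.

Lemma integrable_energy_source : mu.-integrable `[0, T2] (EFin \o energy_source).
Proof.
have mes : measurable_fun (`[0, T2] : set (measurableTypeR R)) (EFin \o energy_source).
  apply/measurable_EFinP.
  exact: (measurableT_comp (fine_measurable measurableT) measurable_esource).
apply/integrableP; split => //; apply: le_lt_trans int_esource.
apply: ge0_le_integral => //.
- exact: measurableT_comp.
move=> s _; rewrite /= /energy_source /Rintegral -/(esource s).
have := esource_ge0 s; case: (esource s) => [r|_|//]; last by rewrite leey.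
by rewrite lee_fin => r0; rewrite lee_fin ger0_norm.
Qed.

Let h (t : R) := `|energy_mean ut t| `^ p * M t `^ (- (p - 1)).
Hypothesis cM : {within `[0, T2], continuous M}.

Lemma continuous_energy_lower : {within `[0, T2], continuous h}.
Proof.
apply/subspace_continuousP => r /[dup] rT2 /in_itvT rT2'.
apply: cvgM.
  have := @continuous_abs_powR R p (ltW p1) (energy_mean ut r) => cp.
  apply: (cvg_comp (energy_mean ut) (fun y : R => `|y| `^ p) _ cp).
  by move/subspace_continuousP : continuous_energy_velocity; exact.
have Mr := M0 rT2'.
have [+ _] := is_derive1_powR (- (p - 1)) Mr.
move=> /derivable1_diffP/differentiable_continuous cp.
apply: (cvg_comp M (fun y : R => y `^ _) _ cp).
by move/subspace_continuousP : cM; exact.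
Qed.

Lemma energy_source_lower s t : 0 <= s -> s <= t -> t <= T2 ->
  \int[mu]_(r in `]s, t]) h r <= \int[mu]_(r in `]s, t]) energy_source r.
Proof.
move=> s0 st tT2.
have sub : `]s, t] `<=` (`[0, T2] : set R).
  by apply: subset_itv; rewrite bnd_simp.
have mst : measurable (`]s, t] : set (measurableTypeR R)) by exact: measurable_itv.
have m02 : measurable (`[0, T2] : set (measurableTypeR R)) by exact: measurable_itv.
have subT2 r : `]s, t]%classic r -> 0 <= r <= T2 by move=> /sub /in_itvT.
have isrc : mu.-integrable `]s, t] (EFin \o energy_source).
  exact: integrableS m02 mst sub integrable_energy_source.
have ch := continuous_energy_lower.
have ih : mu.-integrable `]s, t] (EFin \o h).
  exact: integrableS m02 mst sub (within_continuous_integrable ch).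
rewrite -lee_fin /Rintegral !fineK; try exact: integrable_fin_num.
apply: ae_ge0_le_integral => //=.
- by move=> r _; rewrite lee_fin mulr_ge0 ?powR_ge0.
- exact: measurable_int ih.
- by move=> r _; rewrite lee_fin Rintegral_ge0// => x _; rewrite mulr_ge0 ?powR_ge0 ?expw_cut_ge0.
- exact: measurable_int isrc.
apply: (@filterS _ (almost_everywhere mu) (ae_filter_ringOfSetsType mu) _ _ _
  source_esource) => r rE rst.
by rewrite (rE (sub r rst)); apply: esource_lower; exact: subT2.
Qed.

(** [E] uses the continuous bound [h] instead of the true source. Up to a constant, [f - E] is then
    the integral of [energy_source - h], which is nondecreasing in time by [energy_source_lower]. *)
Lemma energy_ode : exists E, [/\
  primitive_on 0 T2 (energy_mean u) (energy_mean ut),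
  {within `[0, T2], continuous (energy_mean ut)},
  primitive_on 0 T2 E (fun t => (eta ^+ 2 - m t) * energy_mean u t -
    b t * energy_mean ut t + `|energy_mean ut t| `^ p * M t `^ (- (p - 1))) &
  forall s t, 0 <= s -> s <= t -> t <= T2 ->
    energy_mean ut s - E s <= energy_mean ut t - E t].
Proof.
pose k s := (eta ^+ 2 - m s) * energy_mean u s - b s * energy_mean ut s.
have ck : {within `[0, T2], continuous k} by exact: continuous_energy_force.
have ch : {within `[0, T2], continuous h} by exact: continuous_energy_lower.
exists (fun t => \int[mu]_(s in `[0, t]) k s + \int[mu]_(s in `[0, t]) h s); split.
- split; first exact: continuous_energy_mean.
  by move=> t; rewrite in_itv/=; exact: is_derive_energy_mean.
- exact: continuous_energy_velocity.
- exact: primitive_onD (primitive_on_int ck) (primitive_on_int ch).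
move=> s t s0 st tT2.
have t0 := le_trans s0 st; have sT2 := le_trans st tT2.
have /energy_velocity_eq Et : 0 <= t <= T2 by rewrite t0.
have /energy_velocity_eq Es : 0 <= s <= T2 by rewrite s0.
have sub : `[0, t] `<=` (`[0, T2] : set R) by exact: subset_itvl.
have m02 : measurable (`[0, T2] : set (measurableTypeR R)) by exact: measurable_itv.
have m0t : measurable (`[0, t] : set (measurableTypeR R)) by exact: measurable_itv.
have le0s : (BLeft 0 <= BRight s)%O by rewrite bnd_simp.
have lest : (BRight s <= BRight t)%O by rewrite bnd_simp.
have := Rintegral_itvB (integrableS m02 m0t sub (within_continuous_integrable ch))
  le0s lest.
have := Rintegral_itvB (integrableS m02 m0t sub integrable_energy_source) le0s lest.
have := energy_source_lower s0 st tT2.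
by move: Et Es; rewrite -/(k _); lra.
Qed.

Lemma energy_mean_init (w : R -> 'rV[R]_n.+1 -> R) w0 :
  w 0 \in Lfun leb 2%:E -> w0 \in Lfun leb 2%:E ->
  {ae leb, forall x, w 0 x = eps * w0 x} -> ess_supp w0 `<=` eball rho ->
  energy_mean w 0 = eps * \int[leb]_x (w0 x * expw eta x).
Proof.
move=> w2 w02 ww0 w0supp.
have mw0 := Lfun2_measurable w02; have mpsi := Lfun2_measurable psi2.
have mexpw : measurable_fun setT (expw eta : 'rV[R]_n.+1 -> R).
  by apply: smooth_class_measurable; exact: smooth_class_expw.
have -> : \int[leb]_x (w0 x * expw eta x) = \int[leb]_x (w0 x * psi x).
  apply: ae_eq_Rintegral; [exact: measurable_funM|exact: measurable_funM|].
  have := ae_eq0_eball rho0 w0supp; apply: filterS => x wx.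
  have [xr|/wx ->] := pselect (eball rho x); last by rewrite !mul0r.
  have xr1 : eball (rho + 0 + 1) x by apply: eball_subset xr; rewrite addr0 lerDl.
  have z0 : (0 : R) <= 0 <= T2 by rewrite lexx ltW.
  by rewrite (psiE z0 xr1).
rewrite -RintegralZl//; last exact: Lfun2_integrableM.
apply: ae_eq_Rintegral.
- by apply: measurable_funM => //; exact: Lfun2_measurable w2.
- by apply: measurable_funM => //; exact: measurable_funM.
by apply: filterS ww0 => x ->; rewrite mulrA.
Qed.

End energy_functional.

(** * Regularity and bounds of the coefficients *)

Section coefficients.
Context {R : realType}.
Local Notation mu := (@lebesgue_measure R).
Implicit Types (b m : R -> R) (t : R).

Let hline t : 0 <= t -> `[0, +oo[%classic t. Proof. by rewrite /= in_itv/= andbT. Qed.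

Lemma within_segment_hline (T2 : R) (f : R -> R) :
  {within `[0, +oo[, continuous f} -> {within `[0, T2], continuous f}.
Proof. by apply: continuous_subspaceW; exact: subset_itvl. Qed.

Lemma C1_on_continuous b : C1_on `[0, +oo[ b -> {within `[0, +oo[, continuous b}.
Proof.
move=> [db _]; apply/subspace_continuousP => t tD.
have [l bl] := (cvg_ex _).1 (db t tD).
have lim0 : (b s - b t) / (s - t) * (s - t) @[s --> within `[0, +oo[%classic t^'] --> l * 0.
  apply: cvgM => //; rewrite -(subrr t); apply: cvgB; last exact: cvg_cst.
  by move=> P tP; do 2 apply: cvg_within => //.
rewrite mulr0 in lim0.
apply/cvgrPdist_le => e e0.
have /cvgr0Pnorm_le/(_ _ e0) le := lim0.
have {}le : nbhs t [set s | s != t -> `[0, +oo[%classic s ->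
  `|(b s - b t) / (s - t) * (s - t)| <= e] by exact: le.
have : nbhs t [set s | `[0, +oo[%classic s -> `|b t - b s| <= e].
  apply: filterS le => s sle sD.
  have [->|st] := eqVneq s t; first by rewrite subrr normr0 ltW.
  by have := sle st sD; rewrite divfK ?subr_eq0// distrC.
exact.
Qed.

Lemma C1_on_primitive b (T2 : R) : C1_on `[0, +oo[ b ->
  primitive_on 0 T2 b (derive_on `[0, +oo[ b).
Proof.
move=> Cb; split; first exact/within_segment_hline/C1_on_continuous.
move=> t; rewrite in_itv/= => /andP[t0 _].
have [db _] := Cb; have := db t (hline (ltW t0)).
rewrite -/(derive_on _ _ _) => cvb.
have {cvb} lim : (b s - b t) / (s - t) @[s --> t^'] --> derive_on `[0, +oo[ b t.
  apply: cvg_trans cvb; apply: cvg_app => P tP.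
  have {}tP : nbhs t [set s | s != t -> `[0, +oo[%classic s -> P s] by exact: tP.
  have : nbhs t [set s | s != t -> P s].
    have := lt_nbhsr t0; move: tP; apply: filterS2 => s sP s0 st.
    by apply: sP => //; apply: hline; exact: ltW.
  exact.
apply/is_derive1_caratheodory.
exists (fun s => if s == t then derive_on `[0, +oo[ b t
  else (b s - b t) / (s - t)); split; last by rewrite eqxx.
  move=> s; case: eqP => [->|/eqP]; first by rewrite !subrr mulr0.
  by rewrite -subr_eq0 => /divfK->.
apply/continuous_withinNx; rewrite eqxx.
apply: cvg_trans lim; apply: near_eq_cvg; near=> s.
by rewrite ifN//; near: s; exact: nbhs_dnbhs_neq.
Unshelve. all: by end_near. Qed.

Lemma continuous_effective_potential b m : C1_on `[0, +oo[ b ->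
  {within `[0, +oo[, continuous m} ->
  {within `[0, +oo[, continuous (effective_potential b m)}.
Proof.
move=> Cb cm; have cb := C1_on_continuous Cb; have [_ cdb] := Cb.
move=> t; apply: cvgB; first apply: cvgB.
- exact: cm.
- by apply: cvgM; [exact: cdb|exact: cvg_cst].
- apply: cvgM; last exact: cvg_cst.
  by apply: cvgM; exact: cb.
Qed.

(** Were [|b t|] above the essential bound, continuity would keep it above on some []t, t + e[], a
    set of positive measure. An interval to the right of [t] also serves [t = 0]. *)
Lemma Linfty_bound b : {within `[0, +oo[, continuous b} ->
  (b \_ `]0, +oo[) \in Lfun mu +oo%E ->
  exists2 beta, 0 <= beta & forall t, 0 <= t -> `|b t| <= beta.
Proof.
move=> cb; rewrite inE => /andP[_]; rewrite inE/= /finite_norm unlock.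
have itv_gt0 (x y : R) : x < y -> (0 < mu `]x, y[%classic)%E.
  by move=> xy; rewrite lebesgue_measure_itv/= lte_fin xy -EFinB lte_fin subr_gt0.
have mu0 : (0 < mu [set: R])%E.
  apply: (lt_le_trans (itv_gt0 0 1 ltr01)); apply: le_measure; rewrite ?inE//.
rewrite mu0 => supb.
have [|M bM] := @ess_supr_bounded _ _ R mu
  (fun t => `|(b \_ `]0, +oo[) t|).
  by apply: le_lt_trans supb; rewrite le_eqVlt; apply/orP; left; apply/eqP.
exists `|M| => // t t0; rewrite leNgt; apply/negP => bt.
have := cb; move/subspace_continuousP => /(_ t (hline t0)) /cvg_norm /cvgr_gt /(_ _ bt).
move=> bgt.
have /nbhs_ballP[e /= e0 te] : nbhs t [set s | `[0, +oo[%classic s -> `|M| < `|b s|].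
  exact: bgt.
have [N [mN N0 bN]] := bM.
have sub : `]t, t + e[%classic `<=` N.
  move=> s; rewrite /= in_itv/= => /andP[ts st]; apply: bN => /= bsM.
  have s0 : 0 < s by exact: le_lt_trans ts.
  have := te s; rewrite /ball/= distrC gtr0_norm ?subr_gt0// ltrBlDl => /(_ st).
  move=> /(_ (hline (ltW s0))); rewrite ltNge => /negP; apply.
  apply: le_trans (ler_norm M).
  by move: bsM; rewrite patchE mem_set//= in_itv/= s0.
have := itv_gt0 t (t + e); rewrite ltrDl => /(_ e0).
rewrite ltNge => /negP; apply; rewrite -N0.
by apply: le_measure; rewrite ?inE//.
Qed.

Lemma integrable_bound (V : R -> R) : {within `[0, +oo[, continuous V} ->
  mu.-integrable `]0, +oo[ (EFin \o V) ->
  exists2 v, 0 <= v & forall T2, \int[mu]_(t in `[0, T2]) `|V t| <= v.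
Proof.
move=> cV iV; exists (\int[mu]_(t in `]0, +oo[) `|V t|).
  by apply: Rintegral_ge0 => t _.
move=> T2.
have iT2 : mu.-integrable `]0, T2] (EFin \o V).
  by apply: integrableS iV => //; exact: subset_itvl.
have iaV D : mu.-integrable D (EFin \o V) -> mu.-integrable D (EFin \o (fun t => `|V t|)).
  by move=> /integrable_norm.
rewrite -Rintegral_itv_obnd_cbnd; last exact: iaV.
rewrite /Rintegral; apply: fine_le.
- by apply: integrable_fin_num => //; exact: iaV.
- by apply: integrable_fin_num => //; exact: iaV.
apply: ge0_subset_integral => //.
- by apply: measurable_int; exact: iaV.
- exact: subset_itvl.
Qed.

End coefficients.

(** * A bound uniform over all energy solutions *)

Section energy_bound.
Context {R : realType}.
Local Notation mu := (@lebesgue_measure R).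

(** The integrand agrees almost everywhere with [|w * psi|], so a zero integral forces it to vanish
    almost everywhere, and the weight is positive. Applied to both data, this provides the positive
    constant that multiplies [eps]. *)
Lemma weighted_mean_ge0 n (eta rho : R) (w : 'rV[R]_n.+1 -> R) : 0 < rho ->
  w \in Lfun (lebesgue_rV n.+1) 2%:E -> ess_supp w `<=` eball rho ->
  {ae lebesgue_rV n.+1, forall x, 0 <= w x} ->
  0 <= \int[lebesgue_rV n.+1]_x (w x * expw eta x) /\
  (\int[lebesgue_rV n.+1]_x (w x * expw eta x) = 0 ->
    {ae lebesgue_rV n.+1, forall x, w x = 0}).
Proof.
move=> rho0 w2 wsupp w0.
pose psi : 'rV[R]_n.+1 -> R := expw_cut eta rho.
have psi2 := smooth_supp_Lfun2 (smooth_supp_expw_cut (n := n) eta rho).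
have mw := Lfun2_measurable w2; have mpsi := Lfun2_measurable psi2.
have mexpw : measurable_fun setT (expw eta : 'rV[R]_n.+1 -> R).
  by apply: smooth_class_measurable; exact: smooth_class_expw.
have iw := Lfun2_integrableM w2 psi2.
have wae := ae_eq0_eball rho0 wsupp.
have psiE (x : 'rV[R]_n.+1) : eball rho x -> psi x = expw eta x.
  by move=> xr; apply: expw_cutE; exact: eball_box.
have mwpsi : measurable_fun setT (fun x => w x * psi x) by exact: measurable_funM.
have -> : \int[lebesgue_rV n.+1]_x (w x * expw eta x) =
    \int[lebesgue_rV n.+1]_x `|w x * psi x|.
  apply: ae_eq_Rintegral; [exact: measurable_funM|exact: measurableT_comp|].
  apply: filterS2 w0 wae => x wx0 wx.
  have [xr|/wx ->] := pselect (eball rho x); last by rewrite !mul0r normr0.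
  by rewrite (psiE x xr) ger0_norm// mulr_ge0// ltW// expw_gt0.
split; first by apply: Rintegral_ge0.
move=> I0.
have : (\int[lebesgue_rV n.+1]_x `|(w x * psi x)%:E| = 0)%E.
  rewrite -[LHS]fineK; first by congr (_%:E).
  have := integrable_norm iw; exact: integrable_fin_num.
move=> /(ae_eq_integral_abs _ measurableT _).1 => /(_ _)/wrap[|].
  exact/measurable_EFinP.
apply: filterS2 wae => x wx /(_ Logic.I)[] /eqP.
have [xr|/wx //] := pselect (eball rho x).
rewrite (psiE x xr) mulf_eq0 => /orP[/eqP //|].
by rewrite gt_eqF ?expw_gt0.
Qed.

(** The bounds [v] and [beta] hold on the whole half-line, so [eta], and with it [K] and [c0], can
    be fixed before [eps], the solution and the final time [T2]. This uniformity is what permits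
    letting [T2] approach the lifespan. *)
Lemma energy_solution_bound n (p : R) (b m : R -> R) (u0 u1 : 'rV[R]_n.+1 -> R)
    (rho nu CB : R) :
  1 < p -> C1_on `[0, +oo[ b -> (b \_ `]0, +oo[) \in Lfun mu +oo%E ->
  {within `[0, +oo[, continuous m} ->
  mu.-integrable `]0, +oo[ (EFin \o effective_potential b m) ->
  u0 \in Lfun (lebesgue_rV n.+1) 2%:E -> u1 \in Lfun (lebesgue_rV n.+1) 2%:E ->
  {ae lebesgue_rV n.+1, forall x, 0 <= u0 x} ->
  {ae lebesgue_rV n.+1, forall x, 0 <= u1 x} ->
  ~ ({ae lebesgue_rV n.+1, forall x, u0 x = 0} /\
     {ae lebesgue_rV n.+1, forall x, u1 x = 0}) ->
  0 < rho -> ess_supp u0 `|` ess_supp u1 `<=` eball rho ->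
  (forall t, 0 <= t -> damping_primitive b t <= nu * ln (1 + t) + CB) ->
  exists K c0 : R, [/\ 0 < K, 0 < c0 &
    forall eps T u, 0 < eps -> energy_solution b m p rho eps u0 u1 T u ->
    forall T2 th, 1 <= T2 -> (T2%:E < T)%E ->
      primitive_on 1 T2 th (fun t => (1 + t) `^ (- ((n%:R + nu) * (p - 1) / 2))) ->
      K * (th T2 - th 1) <= (eps * c0) `^ (- (p - 1))].
Proof.
move=> p1 Cb Lb cm iV u02 u12 u0ge u1ge une rho0 usupp BCB.
have cb := C1_on_continuous Cb.
have cV := continuous_effective_potential Cb cm.
have [beta beta0 b_beta] := Linfty_bound cb Lb.
have [v v0 Vv] := integrable_bound cV iV.
pose eta := 10 * (v + beta + 1).
have eta0 : 0 < eta by rewrite /eta; lra.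
have [C C0 HC] := integral_expw_eball n eta0.
have u0s : ess_supp u0 `<=` eball rho by move=> x xs; apply: usupp; left.
have u1s : ess_supp u1 `<=` eball rho by move=> x xs; apply: usupp; right.
have [I0ge I0eq] := weighted_mean_ge0 eta rho0 u02 u0s u0ge.
have [I1ge I1eq] := weighted_mean_ge0 eta rho0 u12 u1s u1ge.
set I0 := \int[_]_x (u0 x * _) in I0ge I0eq.
set I1 := \int[_]_x (u1 x * _) in I1ge I1eq.
have I01 : 0 < I0 + I1.
  rewrite lt_neqAle addr_ge0// andbT eq_sym paddr_eq0//.
  by apply/negP => /andP[/eqP/I0eq e0 /eqP/I1eq e1]; exact: une.
(* The radius is [rho + t + 1]; [CM] absorbs the shift by [rho + 1], in the exponential directly and
   in the power through [1 + (rho + t + 1) <= (2 + rho) * (1 + t)]. *)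
pose CM := C * (expR (eta * (rho + 1)) * (2 + rho) `^ (n%:R / 2)).
have CM0 : 0 < CM.
  by rewrite mulr_gt0// mulr_gt0 ?expR_gt0// powR_gt0//; lra.
pose M t := CM * (expR (eta * t) * (1 + t) `^ (n%:R / 2)).
have M0 t : 0 <= t -> 0 < M t.
  by move=> t0; rewrite !mulr_gt0 ?expR_gt0// powR_gt0//; lra.
have MV t : 0 <= t -> (\int[lebesgue_rV n.+1]_(x in eball (rho + t + 1))
    (expw eta x)%:E <= (M t)%:E)%E.
  move=> t0; have r0 : 0 <= rho + t + 1 by lra.
  apply: (le_trans (HC _ r0)); rewrite lee_fin /M /CM -mulrA ler_pM2l//.
  rewrite mulrACA -expRD -mulrDr -powRM; [|lra|lra].
  have -> : rho + 1 + t = rho + t + 1 by ring.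
  have a1 : 0 <= 1 + (rho + t + 1) by lra.
  have a2 : 1 + (rho + t + 1) <= (2 + rho) * (1 + t).
    by have := mulr_ge0 (ltW rho0) t0; lra.
  rewrite ler_pM2l ?expR_gt0//.
  by apply: ge0_ler_powR; rewrite ?nnegrE ?divr_ge0//; exact: le_trans a2.
exists ((p - 1) * (4 `^ (- p) * (expR (CB / 2 + 1) * CM) `^ (- (p - 1)))), (I0 + I1).
split=> //.
  by rewrite mulr_gt0 ?subr_gt0// mulr_gt0 ?powR_gt0// mulr_gt0 ?expR_gt0.
move=> eps T u eps0 [T0 [ut [uH1 [u_ut ut_L2] utLp us [uini utini weak]]]] T2 th T21 T2T dth.
have T20 : 0 < T2 by exact: lt_le_trans T21.
have cM : {within `[0, T2], continuous M}.
  apply: continuous_in_subspaceT => t; rewrite inE/= in_itv/= => /andP[t0 _].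
  have t1 : 0 < 1 + t by lra.
  have [+ _] := is_derive1_powR (n%:R / 2) t1.
  move=> /derivable1_diffP/differentiable_continuous ct.
  apply: cvgM; first exact: cvg_cst.
  apply: cvgM.
    apply: (cvg_comp (fun s => eta * s) (@expR R)); last exact: continuous_expR.
    by apply: cvgM; [exact: cvg_cst|exact: cvg_id].
  apply: (cvg_comp (fun s => 1 + s) (fun y : R => y `^ _) _ ct).
  by apply: cvgD; [exact: cvg_cst|exact: cvg_id].
have cb2 := within_segment_hline (T2 := T2) cb.
have cm2 := within_segment_hline (T2 := T2) cm.
have [E [dF cf dE fE]] := energy_ode rho0 T20 T2T uH1 u_ut ut_L2 us weak cb2 cm2 p1 utLp
  (M := M) (fun t t0 => M0 t (proj1 (andP t0))) (fun t t0 => MV t (proj1 (andP t0))) cM.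
have T0T : time_itv T 0 by split.
have F0 : energy_mean rho eta T2 u 0 = eps * I0.
  apply: energy_mean_init => //; first by have [[]] := uH1 0 T0T.
  by apply: filterS uini => x /(_ Logic.I).
have f0 : energy_mean rho eta T2 ut 0 = eps * I1.
  apply: energy_mean_init => //; first by have [] := ut_L2 0 T0T.
  by apply: filterS utini => x /(_ Logic.I).
apply: (glassey_ode_bound (T := T2) (eta := eta) (v := v) (beta := beta)
  (B := damping_primitive b) (b := b) (V := effective_potential b m) (nu := nu)
  (CB := CB) (CM := CM) (d := n%:R) _ v0 beta0 _ p1 CM0 _ _ _ (C1_on_primitive T2 Cb)
  _ _ _ _ _ dF cf dE fE) => //.
- by rewrite mulr_gt0.
- by rewrite /damping_primitive set_itv1 Rintegral_set1.
- exact: primitive_on_int.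
- by move=> t /andP[t0 _]; exact: b_beta.
- exact: within_segment_hline.
- by move=> t /andP[t0 _]; exact: BCB.
- by rewrite F0 mulr_ge0// ltW.
- by rewrite f0 mulr_ge0// ltW.
- by rewrite F0 f0 mulrDr.
Qed.

End energy_bound.

(** * Lifespan *)

Section conclusion.
Context {R : realType}.

Lemma ereal_le_of_lt (T : \bar R) (X : R) : 1 <= X ->
  (forall T2, 1 <= T2 -> (T2%:E < T)%E -> T2 <= X) -> (T <= X%:E)%E.
Proof.
move=> X1 TX; rewrite leNgt; apply/negP => XT.
have [T2 XT2 T2T] : exists2 T2, X < T2 & (T2%:E < T)%E.
  move: XT; case: T {TX} => [r||//]; last by exists (X + 1); rewrite ?ltrDl ?ltry.
  by rewrite lte_fin => Xr; exists ((X + r) / 2); rewrite ?lte_fin; lra.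
have := TX T2 (le_trans X1 (ltW XT2)) T2T.
by rewrite leNgt XT2.
Qed.

Variables (a p K c0 : R) (Sol : R -> \bar R -> Prop).
Hypotheses (p1 : 1 < p) (K0 : 0 < K) (c00 : 0 < c0).
Hypothesis bound : forall (eps : R) T, 0 < eps -> Sol eps T ->
  forall T2 th, 1 <= T2 -> (T2%:E < T)%E ->
    primitive_on 1 T2 th (fun t => (1 + t) `^ (- a)) ->
    K * (th T2 - th 1) <= (eps * c0) `^ (- (p - 1)).

Let one_powR (x : R) : (1 : R) `^ x = 1. Proof. by rewrite powR1. Qed.

Let epsM (eps : R) : 0 < eps -> (eps * c0) `^ (- (p - 1)) = eps `^ (- (p - 1)) * c0 `^ (- (p - 1)).
Proof. by move=> e0; rewrite powRM ?ltW. Qed.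

Let eps_ge1 (eps q : R) : 0 < eps <= 1 -> 0 <= q -> 1 <= eps `^ (- q).
Proof.
move=> /andP[e0 e1] q0; rewrite powRN invr_ge1 ?unitfE ?gt_eqF ?powR_gt0//.
by rewrite -[X in _ <= X](one_powR q); apply: ge0_ler_powR; rewrite ?nnegrE// ltW.
Qed.

(** For [a < 1] the primitive [(1 + t)^(1 - a) / (1 - a)] is unbounded, so the bound on its
    increment limits [T2]. [Y eps] is the resulting bound on [(1 + T2)^(1 - a)]; its term
    [2^(1 - a)] comes from the starting time 1. *)
Lemma lifespan_subcritical : 0 <= a -> a < 1 ->
  (forall eps T, 0 < eps -> Sol eps T -> (T < +oo)%E) /\
  exists C : R, 0 < C /\ forall eps T, 0 < eps <= 1 -> Sol eps T ->
    (T <= (C * eps `^ (- ((p - 1) / (1 - a))))%:E)%E.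
Proof.
move=> a0 a1; have a1' : 0 < 1 - a by lra.
pose Y eps := 2 `^ (1 - a) + (1 - a) / K * (eps * c0) `^ (- (p - 1)).
have two1 : 1 <= 2 `^ (1 - a).
  by rewrite -[leLHS](one_powR (1 - a)); apply: ge0_ler_powR; rewrite ?nnegrE//; lra.
have Y1 eps : 1 <= Y eps.
  by rewrite (le_trans two1)// lerDl mulr_ge0 ?powR_ge0// divr_ge0// ltW.
have key eps T : 0 < eps -> Sol eps T -> (T <= (Y eps `^ (1 - a)^-1)%:E)%E.
  move=> e0 sol; apply: ereal_le_of_lt.
    rewrite -[leLHS](one_powR (1 - a)^-1).
    apply: ge0_ler_powR; rewrite ?nnegrE ?invr_ge0 ?(ltW a1')//.
    exact: le_trans (Y1 eps).
  move=> T2 T21 T2T.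
  pose th t := (1 - a)^-1 * (1 + t) `^ (1 - a).
  have dth : primitive_on 1 T2 th (fun t => (1 + t) `^ (- a)).
    have d1 := primitive_onD (primitive_on_cst 1 T2 1) (primitive_on_id 1 T2).
    have := @primitive_on_comp _ 1 T2 _ _ (fun y => y `^ (1 - a))
      (fun y => (1 - a) * y `^ (1 - a - 1)) _ d1.
    move=> /(_ _)/wrap[t|].
      rewrite in_itv/= => /andP[t1 _]; have t0 : 0 < 1 + t by lra.
      exact: is_derive1_powR.
    move=> /(primitive_onZ (1 - a)^-1); apply: eq_primitive_on => t _ /=.
    rewrite add0r mul1r mulrA mulVf ?gt_eqF// mul1r.
    by congr (_ `^ _); ring.
  have := bound e0 sol T21 T2T dth; rewrite /th -mulrBr => H.
  have : (1 + T2) `^ (1 - a) <= Y eps.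
    rewrite /Y; move: H; rewrite mulrA -[1 + 1]/(2 : R).
    rewrite -ler_pdivlMl ?divr_gt0// invf_div lerBlDl//.
  move=> le; apply: (@le_trans _ _ (1 + T2)); first by lra.
  have T20 : 0 <= 1 + T2 by lra.
  rewrite -[leLHS](powRr1 T20) -[X in _ `^ X](mulfV (lt0r_neq0 a1')) powRrM.
  apply: ge0_ler_powR; rewrite ?nnegrE ?powR_ge0 ?invr_ge0 ?(ltW a1')//.
  exact: le_trans (Y1 eps).
split; first by move=> eps T e0 sol; apply: le_lt_trans (key _ _ e0 sol) _; exact: ltry.
(* For [eps <= 1] the factor [eps^(- (p - 1))] is at least 1, so it can also be put on the constant
   term [2^(1 - a)]. *)
pose C1 := 2 `^ (1 - a) + (1 - a) / K * c0 `^ (- (p - 1)).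
have C10 : 0 < C1.
  by rewrite ltr_pwDl ?powR_gt0// mulr_ge0 ?powR_ge0// divr_ge0// ltW.
exists (C1 `^ (1 - a)^-1); split; first exact: powR_gt0.
move=> eps T /[dup] e01 /andP[e0 e1] sol; apply: le_trans (key _ _ e0 sol) _.
rewrite lee_fin -mulNr mulrC powRrM -powRM ?powR_ge0 ?(ltW C10)//.
apply: ge0_ler_powR; rewrite ?nnegrE ?invr_ge0 ?(ltW a1')//.
- exact: le_trans (Y1 eps).
- by rewrite mulr_ge0 ?powR_ge0// ltW.
rewrite /Y /C1 epsM// mulrDr lerD//.
  by rewrite ler_peMl ?powR_ge0// eps_ge1// subr_ge0 ltW.
by rewrite le_eqVlt; apply/orP; left; apply/eqP; ring.
Qed.

(** At [a = 1] the primitive is only [ln (1 + t)], which turns the power of [eps] into an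
    exponential of that power. *)
Lemma lifespan_critical : a = 1 ->
  (forall eps T, 0 < eps -> Sol eps T -> (T < +oo)%E) /\
  exists C : R, 0 < C /\ forall eps T, 0 < eps <= 1 -> Sol eps T ->
    (T <= (expR (C * eps `^ (- (p - 1))))%:E)%E.
Proof.
move=> a1.
have ln2 : 0 < ln 2 :> R by apply: ln_gt0; lra.
pose Y eps := ln 2 + K^-1 * (eps * c0) `^ (- (p - 1)).
have Y0 eps : 0 <= Y eps by rewrite addr_ge0 ?(ltW ln2)// mulr_ge0 ?powR_ge0// invr_ge0 ltW.
have key eps T : 0 < eps -> Sol eps T -> (T <= (expR (Y eps))%:E)%E.
  move=> e0 sol; apply: ereal_le_of_lt; first by rewrite -expR0 ler_expR.
  move=> T2 T21 T2T.
  pose th t := ln (1 + t) : R.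
  have dth : primitive_on 1 T2 th (fun t => (1 + t) `^ (- a)).
    have d1 := primitive_onD (primitive_on_cst 1 T2 1) (primitive_on_id 1 T2).
    have := @primitive_on_comp _ 1 T2 _ _ (@ln R) (fun y => y^-1) _ d1.
    move=> /(_ _)/wrap[t|].
      rewrite in_itv/= => /andP[t1 _]; have t0 : 0 < 1 + t by lra.
      exact: is_derive1_ln.
    apply: eq_primitive_on => t; rewrite in_itv/= => /andP[t1 _].
    by rewrite add0r mul1r a1 powR_inv1//; lra.
  have := bound e0 sol T21 T2T dth; rewrite /th -ler_pdivlMl// lerBlDl => H.
  apply: (@le_trans _ _ (1 + T2)); first by lra.
  have T20 : 0 < 1 + T2 by lra.
  by rewrite -[leLHS](lnK T20) ler_expR.
split; first by move=> eps T e0 sol; apply: le_lt_trans (key _ _ e0 sol) _; exact: ltry.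
exists (ln 2 + K^-1 * c0 `^ (- (p - 1))); split.
  by rewrite ltr_pwDl// mulr_ge0 ?powR_ge0// invr_ge0 ltW.
move=> eps T /[dup] e01 /andP[e0 e1] sol; apply: le_trans (key _ _ e0 sol) _.
rewrite lee_fin ler_expR /Y epsM// mulrDl lerD//.
  by rewrite ler_peMr ?(ltW ln2)// eps_ge1// subr_ge0 ltW.
by rewrite le_eqVlt; apply/orP; left; apply/eqP; ring.
Qed.

End conclusion.

Theorem corollary2p6 (R : realType) (n : nat) (p : R) (b m : R -> R)
    (u0 u1 : 'rV[R]_n -> R) (rho mu CB : R) :
  (1 <= n)%N -> 1 < p ->
  C1_on `[0, +oo[ b -> (b \_ `]0, +oo[) \in Lfun lebesgue_measure +oo%E ->
  {within `[0, +oo[, continuous m} ->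
  lebesgue_measure.-integrable `]0, +oo[
    (EFin \o effective_potential b m) ->
  in_H1 u0 -> u1 \in Lfun (lebesgue_rV n) 2%:E ->
  {ae lebesgue_rV n, forall x, 0 <= u0 x} ->
  {ae lebesgue_rV n, forall x, 0 <= u1 x} ->
  compact (ess_supp u0) -> compact (ess_supp u1) ->
  ~ ({ae lebesgue_rV n, forall x, u0 x = 0} /\
     {ae lebesgue_rV n, forall x, u1 x = 0}) ->
  0 < rho -> ess_supp u0 `|` ess_supp u1 `<=` eball rho ->
  0 <= mu -> 0 <= CB ->
  (forall t, 0 <= t -> damping_primitive b t <= mu * ln (1 + t) + CB) ->
  (1 < n%:R + mu -> p <= glassey (n%:R + mu) ->
     (forall eps T u, 0 < eps ->
        is_lifespan b m p rho eps u0 u1 T u -> (T < +oo)%E) /\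
     exists C eps0 : R, [/\ 0 < C, 0 < eps0 &
       forall eps T u, 0 < eps <= eps0 ->
         is_lifespan b m p rho eps u0 u1 T u ->
         (p < glassey (n%:R + mu) ->
           (T <= (C * eps `^ (- (2 * (p - 1) /
                    (2 - (n%:R + mu - 1) * (p - 1)))))%:E)%E) /\
         (p = glassey (n%:R + mu) ->
           (T <= (expR (C * eps `^ (- (p - 1))))%:E)%E)]) /\
  (n = 1%N -> mu = 0 ->
     (forall eps T u, 0 < eps ->
        is_lifespan b m p rho eps u0 u1 T u -> (T < +oo)%E) /\
     exists C eps0 : R, [/\ 0 < C, 0 < eps0 &
       forall eps T u, 0 < eps <= eps0 ->
         is_lifespan b m p rho eps u0 u1 T u ->
         (T <= (C * eps `^ (- (p - 1)))%:E)%E]).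
Proof.
move=> n1 p1 Cb Lb cm iV u0H1 u12 u0ge u1ge _ _ une rho0 usupp mu0 _ BCB.
case: n n1 u0 u1 u0H1 u12 u0ge u1ge une usupp => [//|n] _ u0 u1 u0H1 u12
  u0ge u1ge une usupp.
have u02 : u0 \in Lfun (lebesgue_rV n.+1) 2%:E by case: u0H1.
have [K [c0 [K0 c00 bound]]] := energy_solution_bound p1 Cb Lb cm iV u02 u12
  u0ge u1ge une rho0 usupp BCB.
pose Sol eps T := exists u, energy_solution b m p rho eps u0 u1 T u.
have solP eps T u : is_lifespan b m p rho eps u0 u1 T u -> Sol eps T.
  by move=> [sol _]; exists u.
have {}bound eps T : 0 < eps -> Sol eps T -> forall T2 th, 1 <= T2 -> (T2%:E < T)%E ->
    primitive_on 1 T2 th (fun t => (1 + t) `^ (- ((n%:R + mu) * (p - 1) / 2))) ->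
    K * (th T2 - th 1) <= (eps * c0) `^ (- (p - 1)).
  by move=> eps0 [u sol]; exact: bound eps0 sol.
(* After the case split the space dimension is [n.+1], so this is the decay exponent [a]. The
   condition [p <= glassey (n.+1%:R + mu)] amounts to [a <= 1], with equality exactly at the
   critical exponent. *)
have a0 : 0 <= (n%:R + mu) * (p - 1) / 2.
  by rewrite divr_ge0// mulr_ge0//; [exact: addr_ge0|lra].
have dE : n.+1%:R + mu - 1 = n%:R + mu by rewrite -natr1; ring.
split=> [d1 pd|nE muE].
  have d0 : 0 < n%:R + mu by rewrite -dE subr_gt0.
  move: pd; rewrite /glassey dE => pd.
  have pE : (n%:R + mu) * (2 / (n%:R + mu)) = 2 by rewrite mulrC divfK// gt_eqF.
  move: pd; rewrite le_eqVlt => /orP[/eqP pE'|pd].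
    have a1 : (n%:R + mu) * (p - 1) / 2 = 1.
      by rewrite pE' addrAC subrr add0r pE divff.
    have [fin [C [C0 CT]]] := lifespan_critical p1 K0 c00 bound a1.
    split=> [eps T u eps0 /solP|]; first exact: fin.
    exists C, 1; split=> // eps T u eps01 /solP sol; split=> [|_].
      by rewrite -pE' ltxx.
    exact: CT.
  have a1 : (n%:R + mu) * (p - 1) / 2 < 1.
    rewrite ltr_pdivrMr// mul1r -[ltRHS]pE ltr_pM2l//.
    by rewrite ltrBlDl.
  have [fin [C [C0 CT]]] := lifespan_subcritical p1 K0 c00 bound a0 a1.
  split=> [eps T u eps0 /solP|]; first exact: fin.
  exists C, 1; split=> // eps T u eps01 /solP sol; split=> [_|pE'].
    suff -> : 2 * (p - 1) / (2 - (n%:R + mu) * (p - 1)) =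
        (p - 1) / (1 - (n%:R + mu) * (p - 1) / 2) by exact: CT.
    by field; rewrite !lt0r_neq0//; lra.
  by move: pd; rewrite -pE' ltxx.
(* In dimension one with [mu = 0] the exponent vanishes whatever [p] is, so the subcritical estimate
   applies for every [p > 1], and its power [(p - 1) / (1 - a)] is [p - 1]. *)
have aE : (n%:R + mu) * (p - 1) / 2 = 0.
  by case: nE => ->; rewrite muE addr0 !mul0r.
have a1 : (n%:R + mu) * (p - 1) / 2 < 1 by rewrite aE.
have [fin [C [C0 CT]]] := lifespan_subcritical p1 K0 c00 bound a0 a1.
split=> [eps T u eps0 /solP|]; first exact: fin.
exists C, 1; split=> // eps T u eps01 /solP sol.
by have := CT eps T eps01 sol; rewrite aE subr0 divr1.
Qed.
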